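(* Let $r\ge1$. Let $\Gamma$ be a 2-uniform loop of loops of genus $g$ and $\pi \colon \widetilde{\Gamma} \to \Gamma$ the quotient by the antipodal involution. If $g-1 > r+1$, then $V^r (\Gamma,\pi)$ is connected in codimension $1$.
   Context: Divisors on metric graphs. $\mathrm{PL}(\Gamma)$ is the set of continuous piecewise linear functions with integer slopes on $\Gamma$; $\mathrm{ord}_p(\varphi)$ is the sum of the incoming slopes of $\varphi$ at $p$, $\mathrm{div}(\varphi)=\sum_p \mathrm{ord}_p(\varphi)\,p$; divisors are linearly equivalent if they differ by some $\mathrm{div}(\varphi)$; $\mathrm{Pic}(\Gamma)$ is the group of classes, each degree-$d$ part of which is a real torus of dimension the genus. $\mathrm{rk}(D)$ is the Baker-Norine rank: the largest $r$ such that $D-E$ is equivalent to an effective divisor for every effective $E$ of degree $r$ ($-1$ if $D$ is not equivalent to an effective divisor). $K_\Gamma=\sum_p(\mathrm{val}(p)-2)p$. Loop of loops. For $g\ge 2$, a loop of loops of genus $g$ is a metric graph $\Gamma$ with vertices $v_j,w_j$ ($j\in\mathbb Z/(g-1)\mathbb Z$), with two edges joining $v_j$ to $w_j$ (forming the loop $\gamma_j$) and one edge $\beta_j$ joining $w_{j-1}$ to $v_j$; edge lengths are positive reals. It is 2-uniform if every loop $\gamma_j$ has torsion order 2, i.e. the two edges of each $\gamma_j$ have equal length. The cover. $\widetilde\Gamma$ is the loop of loops of genus $2g-1$ (indices in $\mathbb Z/(2g-2)\mathbb Z$) whose $j$th and $(g-1+j)$th edges and loops are isometric copies of the corresponding ones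 of $\Gamma$; the antipodal involution shifts indices by $g-1$ and $\pi$ is the quotient map. $\mathrm{Nm}_\pi(\sum a_pp)=\sum a_p\pi(p)$, and $V^r(\Gamma,\pi)=\{[D]\in \mathrm{Pic}(\widetilde\Gamma)\mid\mathrm{Nm}_\pi[D]=[K_\Gamma],\ \mathrm{rk}(D)\ge r,\ \mathrm{rk}(D)\equiv r\ (\mathrm{mod}\ 2)\}$. $V^r(\Gamma,\pi)$ is a finite union of real (translated) subtori of $\mathrm{Pic}^{2g-2}(\widetilde\Gamma)$. Connected in codimension 1 means: for any two of these tori $T,T'$ that are maximal under inclusion there is a sequence $T=T_0,T_1,\dots,T_m=T'$ of maximal tori such that each $T_{i-1}\cap T_i$ has codimension $1$ in both $T_{i-1}$ and $T_i$. *)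

(* Defs.v *)
From HB Require Import structures.
From mathcomp Require Import all_boot all_order all_algebra.
From mathcomp.multinomials Require Import freeg.
From mathcomp Require Import all_classical all_reals interval_inference.
From mathcomp Require Import topology normedtype.

Set Implicit Arguments.
Unset Strict Implicit.
Unset Printing Implicit Defensive.

Import Order.TTheory GRing.Theory Num.Theory.
Import numFieldNormedType.Exports.
Local Open Scope classical_set_scope.
Local Open Scope ring_scope.

(** * Integer-slope piecewise linear functions on an interval *)

Section PiecewiseLinear.
Variable R : realType.
Implicit Types (f : R -> R) (l t : R) (m : int).

(* [s] lists finitely many break points; [f] is affine with integer slope on
   each closed subinterval of [0, l] with no break point in its interior.  This
   forces continuity on [0, l]. *)
Definition pl_on l f : Prop := exists s : seq R, forall a b : R,
  0 <= a -> a <= b -> b <= l -> (forall x, x \in s -> ~~ (a < x < b)) ->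
  exists m : int, forall x, a <= x <= b -> f x = f a + m%:~R * (x - a).

Definition has_rslope f t m : Prop :=
  \forall h \near 0^'+, f (t + h) = f t + m%:~R * h.

Definition has_lslope f t m : Prop :=
  \forall h \near 0^'+, f (t - h) = f t - m%:~R * h.

Definition rslope f t : int := xget 0 (has_rslope f t).

Definition lslope f t : int := xget 0 (has_lslope f t).

Lemma rslopeP f t m : has_rslope f t m -> rslope f t = m.
Proof.
move=> fm; rewrite /rslope; case: xgetP => [m' _ fm'|/(_ m)//].
near (0 : R)^'+ => h.
have h0 : h != 0 by rewrite gt_eqF//; near: h; exact: nbhs_right_gt.
have e1 : f (t + h) = f t + m%:~R * h by near: h.
have e2 : f (t + h) = f t + m'%:~R * h by near: h.
by move: e2; rewrite e1 => /addrI/(mulIf h0)/intr_inj.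
Unshelve. all: by end_near. Qed.

Lemma lslopeP f t m : has_lslope f t m -> lslope f t = m.
Proof.
move=> fm; rewrite /lslope; case: xgetP => [m' _ fm'|/(_ m)//].
near (0 : R)^'+ => h.
have h0 : h != 0 by rewrite gt_eqF//; near: h; exact: nbhs_right_gt.
have e1 : f (t - h) = f t - m%:~R * h by near: h.
have e2 : f (t - h) = f t - m'%:~R * h by near: h.
by move: e2; rewrite e1 => /addrI/oppr_inj/(mulIf h0)/intr_inj.
Unshelve. all: by end_near. Qed.

Lemma has_rslopeB f1 f2 t m1 m2 : has_rslope f1 t m1 -> has_rslope f2 t m2 ->
  has_rslope (f1 \- f2) t (m1 - m2).
Proof.
move=> h1 h2; near=> h.
have e1 : f1 (t + h) = f1 t + m1%:~R * h by near: h.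
have e2 : f2 (t + h) = f2 t + m2%:~R * h by near: h.
by rewrite /= e1 e2 intrB mulrBl opprD addrACA.
Unshelve. all: by end_near. Qed.

Lemma has_lslopeB f1 f2 t m1 m2 : has_lslope f1 t m1 -> has_lslope f2 t m2 ->
  has_lslope (f1 \- f2) t (m1 - m2).
Proof.
move=> h1 h2; near=> h.
have e1 : f1 (t - h) = f1 t - m1%:~R * h by near: h.
have e2 : f2 (t - h) = f2 t - m2%:~R * h by near: h.
by rewrite /= e1 e2 intrB mulrBl !opprD addrACA.
Unshelve. all: by end_near. Qed.

Lemma pl_onB l f1 f2 : pl_on l f1 -> pl_on l f2 -> pl_on l (f1 \- f2).
Proof.
move=> [s1 h1] [s2 h2]; exists (s1 ++ s2) => a b a0 ab bl hs.
have [|m1 e1] := h1 a b a0 ab bl.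
  by move=> x xs; apply: hs; rewrite mem_cat xs.
have [|m2 e2] := h2 a b a0 ab bl.
  by move=> x xs; apply: hs; rewrite mem_cat xs orbT.
exists (m1 - m2) => x xab.
by rewrite /= e1// e2// intrB mulrBl opprD addrACA.
Qed.

Lemma pl_on0 l : pl_on l (fun=> 0).
Proof.
by exists [::] => a b _ _ _ _; exists 0 => x _; rewrite mul0r addr0.
Qed.

Lemma near_avoid_right (s : seq R) t :
  \forall d \near 0^'+, forall x, x \in s -> ~~ (t < x < t + d).
Proof.
elim: s => [|y s IH]; first by near=> d.
have [yt|ty] := leP y t.
  near=> d => x; rewrite inE => /orP[/eqP->|]; last by move: x; near: d.
  by rewrite ltNge yt.
have d0 : 0 < y - t by rewrite subr_gt0.
near=> d => x; rewrite inE => /orP[/eqP->|]; last by move: x; near: d.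
rewrite negb_and -!leNgt; apply/orP; right.
by rewrite -lerBrDl; apply: ltW; near: d; exact: nbhs_right_lt.
Unshelve. all: by end_near. Qed.

Lemma near_avoid_left (s : seq R) t :
  \forall d \near 0^'+, forall x, x \in s -> ~~ (t - d < x < t).
Proof.
elim: s => [|y s IH]; first by near=> d.
have [ty|yt] := leP t y.
  near=> d => x; rewrite inE => /orP[/eqP->|]; last by move: x; near: d.
  by rewrite [y < t]ltNge ty andbF.
have d0 : 0 < t - y by rewrite subr_gt0.
near=> d => x; rewrite inE => /orP[/eqP->|]; last by move: x; near: d.
rewrite negb_and -!leNgt; apply/orP; left.
rewrite lerBrDl -lerBrDr; apply: ltW; near: d; exact: nbhs_right_lt.
Unshelve. all: by end_near. Qed.

Lemma pl_rslope l f t : pl_on l f -> 0 <= t < l -> exists m, has_rslope f t m.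
Proof.
move=> [s hs] /andP[t0 tl].
have d0 : 0 < l - t by rewrite subr_gt0.
near (0 : R)^'+ => d.
have dp : 0 < d by near: d; exact: nbhs_right_gt.
have [||||m hm] := hs t (t + d).
- by [].
- by rewrite lerDl ltW.
- by rewrite -lerBrDl ltW//; near: d; exact: nbhs_right_lt.
- near: d; exact: near_avoid_right.
exists m; near=> h; rewrite hm; first by rewrite addrAC subrr add0r.
rewrite lerDl lerD2l; apply/andP; split; apply: ltW; near: h.
  exact: nbhs_right_gt.
exact: nbhs_right_lt.
Unshelve. all: by end_near. Qed.

Lemma pl_lslope l f t : pl_on l f -> 0 < t <= l -> exists m, has_lslope f t m.
Proof.
move=> [s hs] /andP[t0 tl].
near (0 : R)^'+ => d.
have dp : 0 < d by near: d; exact: nbhs_right_gt.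
have dt : t - d <= t by rewrite gerBl ltW.
have [||||m hm] := hs (t - d) t.
- by rewrite subr_ge0 ltW//; near: d; exact: nbhs_right_lt.
- by [].
- by [].
- near: d; exact: near_avoid_left.
exists m; near=> h.
have hd : h <= d by apply: ltW; near: h; exact: nbhs_right_lt.
have h0 : 0 <= h by apply: ltW; near: h; exact: nbhs_right_gt.
rewrite hm; last by rewrite gerBl h0 lerD2l lerN2 hd.
rewrite (hm t); last by rewrite dt lexx.
by rewrite -[RHS]addrA -mulrBr (addrAC t).
Unshelve. all: by end_near. Qed.

Lemma rslopeB l f1 f2 t : pl_on l f1 -> pl_on l f2 -> 0 <= t < l ->
  rslope (f1 \- f2) t = rslope f1 t - rslope f2 t.
Proof.
move=> p1 p2 tl; have [m1 h1] := pl_rslope p1 tl.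
have [m2 h2] := pl_rslope p2 tl.
by rewrite (rslopeP h1) (rslopeP h2) (rslopeP (has_rslopeB h1 h2)).
Qed.

Lemma lslopeB l f1 f2 t : pl_on l f1 -> pl_on l f2 -> 0 < t <= l ->
  lslope (f1 \- f2) t = lslope f1 t - lslope f2 t.
Proof.
move=> p1 p2 tl; have [m1 h1] := pl_lslope p1 tl.
have [m2 h2] := pl_lslope p2 tl.
by rewrite (lslopeP h1) (lslopeP h2) (lslopeP (has_lslopeB h1 h2)).
Qed.

Lemma rslope0 t : rslope (fun=> 0) t = 0.
Proof. by apply: rslopeP; near=> h; rewrite mul0r addr0.
Unshelve. all: by end_near. Qed.

Lemma lslope0 t : lslope (fun=> 0) t = 0.
Proof. by apply: lslopeP; near=> h; rewrite mul0r subr0.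
Unshelve. all: by end_near. Qed.

End PiecewiseLinear.

(** * Metric graphs, divisors and the Picard group *)

(* A model: loops and multiple edges are allowed, and the orientation of the
   edges is auxiliary. *)
Record metric_graph (R : realType) := MetricGraph {
  vert : finType;
  edge : finType;
  src : edge -> vert;
  tgt : edge -> vert;
  len : edge -> {posnum R} }.

Section Divisors.
Variables (R : realType) (G : metric_graph R).

(* A point is a vertex or a pair (e, t) in the interior of an edge, at distance
   [t] from [src e]. *)
Definition point : choiceType :=
  (vert G + {x : edge G * R | 0 < x.2 < (len x.1)%:num})%type.

Definition edge_point (e : edge G) (t : R) : point :=
  if t <= 0 then inl (src e)
  else if insub (e, t) is Some x then inr x else inl (tgt e).

Definition on_edge (phi : point -> R) (e : edge G) (t : R) : R :=
  phi (edge_point e t).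

Definition pl_edges (c : edge G -> R -> R) : Prop :=
  forall e, pl_on (len e)%:num (c e).

(* Sum of the incoming slopes at [p] of a family of functions on the edges. *)
Definition incoming (c : edge G -> R -> R) (p : point) : int :=
  match p with
  | inl v => \sum_(e | tgt e == v) lslope (c e) (len e)%:num
             - \sum_(e | src e == v) rslope (c e) 0
  | inr x => lslope (c (val x).1) (val x).2 - rslope (c (val x).1) (val x).2
  end.

Definition PL (phi : point -> R) : Prop := pl_edges (on_edge phi).

Definition ord (phi : point -> R) (p : point) : int :=
  incoming (on_edge phi) p.

Local Notation divisor := {freeg point / int}.

Definition principal : {pred divisor} := fun D =>
  `[< exists phi, PL phi /\ forall p, coeff p D = ord phi p >].

Lemma incomingB c1 c2 p : pl_edges c1 -> pl_edges c2 ->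
  incoming (fun e => c1 e \- c2 e) p = incoming c1 p - incoming c2 p.
Proof.
move=> h1 h2; case: p => [v|[[e t] /= et]] /=; last first.
  case/andP: et => t0 tl.
  rewrite (lslopeB (h1 e) (h2 e)) ?t0 ?ltW//.
  rewrite (rslopeB (h1 e) (h2 e)) ?ltW//.
  by rewrite !opprD addrACA.
rewrite (eq_bigr _ (fun e _ => lslopeB (h1 e) (h2 e) _)); last first.
  by move=> e _; rewrite lexx andbT.
rewrite [X in _ - X](eq_bigr _ (fun e _ => rslopeB (h1 e) (h2 e) _)).
  by rewrite !sumrB !opprD addrACA.
by move=> e _; rewrite lexx /=.
Qed.

Lemma principal_zmod_closed : zmod_closed principal.
Proof.
split=> [|D1 D2 /asboolP[f1 [pl1 e1]] /asboolP[f2 [pl2 e2]]].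
  apply/asboolP; exists (fun=> 0); split=> [e|p]; first exact: pl_on0.
  rewrite coeff0 /ord; case: p => [v|[[e t] /= _]]; rewrite /incoming /=.
    by rewrite !big1 ?subrr// => e _; rewrite ?rslope0 ?lslope0.
  by rewrite rslope0 lslope0 subrr.
apply/asboolP; exists (f1 \- f2); split=> [e|p]; first exact: pl_onB.
by rewrite coeffB e1 e2 -incomingB.
Qed.

HB.instance Definition _ :=
  GRing.isZmodClosed.Build {freeg point / int} principal principal_zmod_closed.

Definition Pic : Type := Quotient.quot principal.
HB.instance Definition _ := GRing.Zmodule.on Pic.

Definition cls (D : divisor) : Pic := (\pi_(Quotient.quot principal) D)%qT.

Lemma clsP (D E : divisor) : cls D = cls E <-> D - E \in principal.
Proof.
rewrite /cls; split=> [h|]; first by rewrite Quotient.idealrBE; apply/eqP.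
by rewrite Quotient.idealrBE => /eqP.
Qed.

Lemma clsB (D E : divisor) : cls (D - E) = cls D - cls E.
Proof. exact: (raddfB (\pi_(Quotient.quot principal))%qT). Qed.

Definition effective (D : divisor) : Prop := forall p, 0 <= coeff p D.

Definition rank_ge (D : divisor) (r : nat) : Prop :=
  forall E, effective E -> deg E = r%:Z ->
  exists2 E', effective E' & cls (D - E) = cls E'.

(* The rank: the default value -1 is taken exactly when no [r] qualifies. *)
Definition rk (D : divisor) : int :=
  xget (-1) [set k : int | exists r : nat,
    [/\ k = r%:Z, rank_ge D r & forall s, rank_ge D s -> (s <= r)%N]].

Definition valence (v : vert G) : nat :=
  (#|[set e | src e == v]| + #|[set e | tgt e == v]|)%N.

Definition canonical : divisor :=
  \sum_(v : vert G) << ((valence v)%:Z - 2) *g (inl v : point) >>.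

(** ** The real torus structure of the Picard group *)

(* Pic^0 carries the torus structure of H^0(Omega)^* / H_1(G, Z), to which it
   is identified by the Abel-Jacobi map (integrate the harmonic 1-forms along a
   1-chain with a given boundary). *)

Definition harmonic (w : edge G -> R) : Prop := forall v : vert G,
  \sum_(e | tgt e == v) w e = \sum_(e | src e == v) w e.

Definition cycle (z : edge G -> int) : Prop := forall v : vert G,
  \sum_(e | tgt e == v) z e = \sum_(e | src e == v) z e.

Definition cycle_int (z : edge G -> int) (w : edge G -> R) : R :=
  \sum_e w e * ((z e)%:~R * (len e)%:num).

(* An integral 1-chain is encoded by primitives of its coefficients: on the edge
   [e], its multiplicity at [t] is the slope of [c e] at [t].  The functions
   [c e] need not agree at the vertices.  Its boundary is [incoming c]. *)
Definition chain_int (c : edge G -> R -> R) (w : edge G -> R) : R :=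
  \sum_e w e * (c e (len e)%:num - c e 0).

(* [l], as a functional on harmonic 1-forms, is one of the lifts of the
   Abel-Jacobi image of [D]. *)
Definition abel_jacobi (D : divisor) (l : (edge G -> R) -> R) : Prop :=
  exists c : edge G -> R -> R,
    [/\ pl_edges c, forall p, coeff p D = incoming c p
      & forall w, harmonic w -> chain_int c w = l w].

(* Translated subtori of dimension [k]: the translates of the images in
   H^0(Omega)^* / H_1(G, Z) of the subspaces spanned by [k] independent
   elements of the lattice H_1(G, Z). *)
Definition translated_subtorus (k : nat) (T : set Pic) : Prop :=
  exists (D0 : divisor) (z : 'I_k -> edge G -> int),
    [/\ forall i, cycle (z i),
        forall x : 'I_k -> R, (forall e, \sum_i x i * (z i e)%:~R = 0) ->
          forall i, x i = 0
      & T = [set cls D | D in [set D | exists x : 'I_k -> R,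
          abel_jacobi (D - D0) (fun w => \sum_i x i * cycle_int (z i) w)]]].

(* [S] is a finite union of translated subtori, the largest of dimension [k]. *)
Definition has_dim (S : set Pic) (k : nat) : Prop :=
  exists F : set (set Pic),
    [/\ finite_set F,
        forall T, F T -> exists2 j, (j <= k)%N & translated_subtorus j T,
        exists2 T, F T & translated_subtorus k T
      & S = \bigcup_(T in F) T].

Definition has_codim1 (S T : set Pic) : Prop :=
  exists k, has_dim S k /\ has_dim T k.+1.

Definition maximal_in (F : set (set Pic)) (T : set Pic) : Prop :=
  F T /\ forall T', F T' -> T `<=` T' -> T' = T.

Definition codim1_chain (F : set (set Pic)) (T T' : set Pic) : Prop :=
  exists (m : nat) (c : nat -> set Pic),
    [/\ c 0%N = T, c m = T', forall i, (i <= m)%N -> maximal_in F (c i)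
      & forall i, (i < m)%N -> has_codim1 (c i `&` c i.+1) (c i) /\
                               has_codim1 (c i `&` c i.+1) (c i.+1)].

(* The maximal members do not depend on the choice of the finite family [F]
   with union [V]: they are the maximal translated subtori contained in [V]. *)
Definition connected_in_codim1 (V : set Pic) : Prop :=
  exists F : set (set Pic),
    [/\ finite_set F, forall T, F T -> exists k, translated_subtorus k T,
        V = \bigcup_(T in F) T
      & forall T T', maximal_in F T -> maximal_in F T' -> codim1_chain F T T'].

End Divisors.

Notation divisor G := {freeg (point G) / int}.

(** * Loops of loops and their antipodal covers *)

(* [n] is the number of loops, so that the genus is [n + 1]; ['I_n], with the
   cyclic predecessor [ord_pred], stands for Z/nZ.  [loop_len j b] is the length
   of one of the two edges of the [j]th loop and [bridge_len j] that of the edge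
   from the (j-1)st to the [j]th loop. *)
Record loop_of_loops (R : realType) (n : nat) := LoopOfLoops {
  loop_len : 'I_n -> bool -> {posnum R};
  bridge_len : 'I_n -> {posnum R} }.

Section LoopOfLoops.
Variables (R : realType) (n : nat).
Implicit Type L : loop_of_loops R n.

(* Vertices: v_j = inl j and w_j = inr j.  Edges: the two edges inl (j, b) of
   the [j]th loop join v_j to w_j, and inr j joins w_(j-1) to v_j. *)
Definition lol_graph L : metric_graph R :=
  @MetricGraph R ('I_n + 'I_n)%type (('I_n * bool) + 'I_n)%type
    (fun e => match e with
              | inl (j, _) => inl j
              | inr j => inr (ord_pred j) end)
    (fun e => match e with
              | inl (j, _) => inr j
              | inr j => inl j end)
    (fun e => match e with
              | inl (j, b) => loop_len L j b
              | inr j => bridge_len L j end).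

(* Every loop has torsion order 2. *)
Definition two_uniform L : Prop :=
  forall j, (loop_len L j true)%:num = (loop_len L j false)%:num.

(* Reduction Z/2nZ -> Z/nZ, and the shift by [n] on Z/2nZ. *)
Definition reduce_idx (j : 'I_(n + n)) : 'I_n :=
  match fintype.split j with inl i => i | inr i => i end.

Definition shift_idx (j : 'I_(n + n)) : 'I_(n + n) :=
  match fintype.split j with inl i => rshift n i | inr i => lshift n i end.

Definition antipodal_cover L : loop_of_loops R (n + n) :=
  LoopOfLoops (fun j b => loop_len L (reduce_idx j) b)
              (fun j => bridge_len L (reduce_idx j)).

End LoopOfLoops.

Section Indices.
Variable n : nat.
Implicit Types i j : 'I_(n + n).

Lemma reduce_idxE j : reduce_idx j = (j %% n)%N :> nat.
Proof.
rewrite /reduce_idx; case: splitP => i ->; first by rewrite modn_small.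
by rewrite modnDl modn_small.
Qed.

Lemma shift_idxE j : shift_idx j = ((j + n) %% (n + n))%N :> nat.
Proof.
rewrite /shift_idx; case: splitP => i -> /=.
  by rewrite modn_small addnC// ltn_add2l.
by rewrite addnAC modnDl modn_small// ltn_addr.
Qed.

Lemma reduce_shift j : reduce_idx (shift_idx j) = reduce_idx j.
Proof.
rewrite /reduce_idx /shift_idx; case: (fintype.split j) => i.
  by rewrite (unsplitK (inr i : 'I_n + 'I_n)).
by rewrite (unsplitK (inl i : 'I_n + 'I_n)).
Qed.

Lemma reduceP i j : reduce_idx i = reduce_idx j -> j = i \/ j = shift_idx i.
Proof.
rewrite /reduce_idx /shift_idx -{2}(splitK i) -{2 3}(splitK j).
by case: (fintype.split i) => a; case: (fintype.split j) => b ->; [left|right|right|left].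
Qed.

Lemma reduce_pred j : reduce_idx (ord_pred j) = ord_pred (reduce_idx j).
Proof.
apply: val_inj; rewrite /= reduce_idxE /= reduce_idxE.
have n0 : (0 < n)%N by case: (n) j => [[]|].
rewrite modn_dvdm ?dvdn_addr// -!subn1 -!addnBA ?addn_gt0 ?n0//.
by rewrite addnCA modnDl modnDml.
Qed.

End Indices.

Section AntipodalCover.
Variables (R : realType) (n : nat) (L : loop_of_loops R n).
Local Notation X := (lol_graph L).
Local Notation Y := (lol_graph (antipodal_cover L)).

Definition map_vert (A B : Type) (f : A -> B) (v : A + A) : B + B :=
  match v with inl j => inl (f j) | inr j => inr (f j) end.

Definition map_edge (A B : Type) (f : A -> B) (e : (A * bool) + A) :
    (B * bool) + B :=
  match e with inl (j, b) => inl (f j, b) | inr j => inr (f j) end.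

Lemma proj_len (e : edge Y) :
  len (map_edge (@reduce_idx n) e : edge X) = len e.
Proof. by case: e => [[]|]. Qed.

Lemma antipode_len (e : edge Y) :
  len (map_edge (@shift_idx n) e : edge Y) = len e.
Proof. by case: e => [[j b]|j]; rewrite /= reduce_shift. Qed.

Lemma proj_subproof (x : edge Y * R) : 0 < x.2 < (len x.1)%:num ->
  0 < x.2 < (len (map_edge (@reduce_idx n) x.1 : edge X))%:num.
Proof. by rewrite proj_len. Qed.

Lemma antipode_subproof (x : edge Y * R) : 0 < x.2 < (len x.1)%:num ->
  0 < x.2 < (len (map_edge (@shift_idx n) x.1 : edge Y))%:num.
Proof. by rewrite antipode_len. Qed.

(* The quotient map by the antipodal involution (see [projP]). *)
Definition proj (p : point Y) : point X :=
  match p with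
  | inl v => inl (map_vert (@reduce_idx n) v : vert X)
  | inr x => inr (exist _ (map_edge (@reduce_idx n) (val x).1, (val x).2)
                        (proj_subproof (valP x)))
  end.

Definition antipode (p : point Y) : point Y :=
  match p with
  | inl v => inl (map_vert (@shift_idx n) v : vert Y)
  | inr x => inr (exist _ (map_edge (@shift_idx n) (val x).1, (val x).2)
                        (antipode_subproof (valP x)))
  end.

Definition norm (D : divisor Y) : divisor X :=
  \sum_(p <- dom D) << coeff p D *g proj p >>.

Definition prym_brill_noether (r : nat) : set (Pic Y) :=
  [set cls D | D in [set D : divisor Y |
    [/\ cls (norm D) = cls (canonical X), r%:Z <= rk D
      & (rk D = r%:Z %[mod 2])%Z]]].

Lemma map_vertP (v w : vert Y) :
  map_vert (@reduce_idx n) v = map_vert (@reduce_idx n) w <->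
  w = v \/ w = map_vert (@shift_idx n) v.
Proof.
case: v w => v [] w /=; split=> //; try by case.
- by case=> /reduceP[]->; [left|right].
- by case=> -[->]; rewrite ?reduce_shift.
- by case=> /reduceP[]->; [left|right].
- by case=> -[->]; rewrite ?reduce_shift.
Qed.

Lemma map_edgeP (d e : edge Y) :
  map_edge (@reduce_idx n) d = map_edge (@reduce_idx n) e <->
  e = d \/ e = map_edge (@shift_idx n) d.
Proof.
case: d e => [[d b]|d] [[e a]|e] /=; split=> //; try by case.
- by case=> /reduceP[]-> ->; [left|right].
- by case=> -[-> ->]; rewrite ?reduce_shift.
- by case=> /reduceP[]->; [left|right].
- by case=> -[->]; rewrite ?reduce_shift.
Qed.

Lemma projP (p q : point Y) : proj p = proj q <-> q = p \/ q = antipode p.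
Proof.
case: p q => [v|[[d t] dt]] [w|[[e u] eu]] /=; split=> //; try by case.
- by case=> /map_vertP[]->; [left|right].
- by move=> h; congr inl; apply/map_vertP; case: h => -[->]; [left|right].
- move=> [h1 h2]; case/map_edgeP: h1 => h.
    by left; congr inr; apply: val_inj => /=; rewrite h h2.
  by right; congr inr; apply: val_inj => /=; rewrite h h2.
- move=> h; congr inr; apply: val_inj => /=.
  suff [h1 ->] : (e = d \/ e = map_edge (@shift_idx n) d) /\ u = t.
    by move/map_edgeP: h1 => ->.
  by case: h => -[-> ->]; split=> //; [left|right].
Qed.

Lemma proj_src (e : edge Y) :
  src (map_edge (@reduce_idx n) e : edge X) = map_vert (@reduce_idx n) (src e).
Proof. by case: e => [[]|j] //=; rewrite reduce_pred. Qed.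

Lemma proj_tgt (e : edge Y) :
  tgt (map_edge (@reduce_idx n) e : edge X) = map_vert (@reduce_idx n) (tgt e).
Proof. by case: e => [[]|]. Qed.

End AntipodalCover.

Arguments prym_brill_noether {R n} L r.

(* Main.v *)
From HB Require Import structures.
From mathcomp Require Import all_boot all_order all_algebra.
From mathcomp.multinomials Require Import freeg.
From mathcomp Require Import all_classical all_reals interval_inference.
From mathcomp Require Import topology normedtype.
From mathcomp Require Import zify ring lra.
Require Import Defs.

(* By the Abel-Jacobi theorem a class on a loop of loops is determined by its
   degree, an angle in R/2Z on each loop (half a loop having length 1) and a
   position on the circle obtained by identifying the two edges of every loop,
   all taken modulo one turn around the graph.  In these terms the classes with
   norm [K] form two real tori with coordinates (eps, x), where eps is in {0, 1}
   and x in (R/2Z)^n, n = g - 1.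

   The rank at (eps, x) only depends on the parities of the integral x_j.  On a
   loop where the coordinate is not integral an effective representative has a
   chip in the interior, and where it is integral the number of chips beyond the
   loop is constrained modulo 2; asking for one chip at every other change of
   parity (read cyclically on the cover) overdetermines the position of the
   divisor.  Conversely, for M the set of the changes, E plus its conjugate under
   the exchange of the edges of the loops, plus one chip on each loop outside of
   M, plus a conjugate pair adjusting the position, is a representative that
   contains any given E of degree #|M| - 1.  Thus the rank is the number of
   changes minus 1, except that it is 1 or -1 when there is no change; the value
   1, attained when the constant parity is even, is an application of the
   intermediate value theorem.

   Hence for r >= 2 the locus is the union of the tori on which the coordinates
   with index in some M, of cardinal r + 1, alternate as c, c + 1, c, ... and for
   r = 1 it is the union of the tori on which some coordinate is even.  Replacing
   an element of M by the preceding index crosses a stratum of codimension 1, so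
   that every M is linked to the initial segment; shifting the initial segment to
   the right, which is possible as r + 1 < n, and bringing it back changes c. *)

(** Equal edge lengths make the exchange of the two edges of a loop an isometry, so a conjugate pair
    of chips has even total angle on every loop and contributes only its position: this is what
    absorbs a prescribed divisor. Two values of [eps] occur because a turn around the base lifts to
    half a turn of the cover, so that the parity of the number of base turns survives. The upper
    bound is a rounding argument. Parities confine the excess of chips over loops to two consecutive
    values on every loop. Summed over antipodal loops, with coordinates [x j] and [eps - x j], these
    windows determine the position with an error strictly below two turns of the base, strictly
    because the bridges have positive length; the discrepancy is an even number of turns, hence
    zero. The outcome is an equation between integers that fixes a residue modulo 4. Each chip of
    the test divisor can be put on either of two antipodal loops, and moving one alters the equation
    by 2, so it can be violated. Without changes of parity no such chip exists, and the constant
    parity decides. *)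

Set Implicit Arguments.
Unset Strict Implicit.
Unset Printing Implicit Defensive.

Import Order.TTheory GRing.Theory Num.Theory.
Import numFieldNormedType.Exports.
Local Open Scope classical_set_scope.
Local Open Scope ring_scope.

(** * Integration by parts on a metric graph *)

Section Evaluation.
Variables (R : realDomainType) (K : choiceType).
Implicit Types (D E : {freeg K / int}) (f g : K -> R).

Definition ev f D : R := \sum_(p <- dom D) (coeff p D)%:~R * f p.

Lemma ev_sub f D (s : seq K) : uniq s -> {subset dom D <= s} ->
  ev f D = \sum_(p <- s) (coeff p D)%:~R * f p.
Proof.
move=> us sub; rewrite (bigID (mem (dom D))) /= [X in _ + X]big1 ?addr0; last first.
  by move=> p /coeff_outdom ->; rewrite mul0r.
rewrite -big_filter /ev; apply: perm_big; apply: uniq_perm.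
- exact: uniq_dom.
- exact: filter_uniq.
by move=> p; rewrite mem_filter; case: (boolP (p \in dom D)) => /= [/sub ->|]; rewrite ?andbT ?andbF.
Qed.

Lemma evB f D E : ev f (D - E) = ev f D - ev f E.
Proof.
pose s := undup (dom D ++ dom E).
have us : uniq s by exact: undup_uniq.
rewrite !(@ev_sub f _ s)//.
- by rewrite -sumrB; apply: eq_bigr => p _; rewrite coeffB intrB mulrBl.
- by move=> p pE; rewrite mem_undup mem_cat pE orbT.
- by move=> p pD; rewrite mem_undup mem_cat pD.
- by move=> p pDE; rewrite mem_undup; exact: domB pDE.
Qed.

HB.instance Definition _ f := GRing.isAdditive.Build {freeg K / int} R (ev f) (evB f).

Lemma evD f D E : ev f (D + E) = ev f D + ev f E.
Proof. exact: raddfD. Qed.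

Lemma evU f k p : ev f << k *g p >> = k%:~R * f p.
Proof.
rewrite (@ev_sub f _ [:: p])// ?big_seq1 ?coeffU ?eqxx ?mulr1//.
by move=> q; rewrite mem_dom coeffU inE; case: (eqVneq p q) => //; rewrite mulr0 eqxx.
Qed.

Lemma ev_eq f g D : (forall p, p \in dom D -> f p = g p) -> ev f D = ev g D.
Proof. by move=> fg; apply: eq_big_seq => p /fg ->. Qed.

Lemma evfD f g D : ev (fun p => f p + g p) D = ev f D + ev g D.
Proof. by rewrite /ev -big_split; apply: eq_bigr => p _; rewrite mulrDr. Qed.

Lemma evfB f g D : ev (fun p => f p - g p) D = ev f D - ev g D.
Proof. by rewrite /ev -sumrB; apply: eq_bigr => p _; rewrite mulrBr. Qed.

Lemma evfZ k f D : ev (fun p => k * f p) D = k * ev f D.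
Proof. by rewrite /ev mulr_sumr; apply: eq_bigr => p _; rewrite mulrCA. Qed.

Lemma evf_sum (I : Type) (r : seq I) (P : pred I) (F : I -> K -> R) D :
  ev (fun p => \sum_(i <- r | P i) F i p) D = \sum_(i <- r | P i) ev (F i) D.
Proof.
by rewrite /ev exchange_big /=; apply: eq_bigr => p _; rewrite mulr_sumr.
Qed.

Lemma ev_deg D : ev (fun=> 1) D = (deg D)%:~R.
Proof.
rewrite -[in RHS](freeg_sumE D) raddf_sum /= rmorph_sum /=.
by apply: eq_bigr => p _; rewrite degU mulr1.
Qed.

Lemma ev_le f g D : (forall p, 0 <= coeff p D) -> (forall p, f p <= g p) ->
  ev f D <= ev g D.
Proof. by move=> D0 fg; apply: ler_sum => p _; rewrite ler_wpM2l// ler0z. Qed.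

Definition evz (c : K -> int) D : int := \sum_(p <- dom D) coeff p D * c p.

Lemma evzE c D : (evz c D)%:~R = ev (fun p => (c p)%:~R) D.
Proof. by rewrite rmorph_sum; apply: eq_bigr => p _; rewrite /= intrM. Qed.

End Evaluation.

Section Intervals.
Variable R : realType.
Implicit Types (f c : R -> R) (l t : R) (m : int).

Lemma affine_slopes c a b m : a < b ->
  (forall x, a <= x <= b -> c x = c a + m%:~R * (x - a)) ->
  [/\ rslope c a = m, lslope c b = m &
   forall t, a < t < b -> lslope c t = m /\ rslope c t = m].
Proof.
move=> ab h.
have hr t : a <= t < b -> rslope c t = m.
  move=> /andP[at_ tb]; apply: rslopeP.
  have d0 : 0 < b - t by rewrite subr_gt0.
  near=> h'.
  have h0 : 0 < h' by near: h'; exact: nbhs_right_gt.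
  have hd : h' < b - t by near: h'; exact: nbhs_right_lt.
  rewrite (h (t + h')); last lra.
  by rewrite (h t); [ring|lra].
have hl t : a < t <= b -> lslope c t = m.
  move=> /andP[at_ tb]; apply: lslopeP.
  have d0 : 0 < t - a by rewrite subr_gt0.
  near=> h'.
  have h0 : 0 < h' by near: h'; exact: nbhs_right_gt.
  have hd : h' < t - a by near: h'; exact: nbhs_right_lt.
  rewrite (h (t - h')); last lra.
  by rewrite (h t); [ring|lra].
split; first by apply: hr; rewrite lexx.
  by apply: hl; rewrite ab lexx.
by move=> t /andP[at_ tb]; split; [apply: hl|apply: hr]; rewrite ?at_ ?tb ltW.
Unshelve. all: by end_near. Qed.

Lemma count_lt (T : eqType) (P Q : pred T) (s : seq T) x :
  {subset P <= Q} -> x \in s -> Q x -> ~~ P x -> (count P s < count Q s)%N.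
Proof.
move=> PQ; elim: s => // y s IH; rewrite inE => /orP[/eqP <-|xs] Qx Px /=.
  by rewrite Qx (negbTE Px) add0n add1n ltnS; apply: sub_count.
rewrite -addnS leq_add//; last exact: IH.
by case: (boolP (P y)) => // /PQ; rewrite -topredE /= => ->.
Qed.

(** Induction on the number of break points of [c] strictly between [a] and [b]: the interval is cut
    at one of them, and the boundary terms created there combine into the summand of that point. *)
Lemma interval_by_parts l c al be : pl_on l c ->
  forall (a b : R) (s : seq R), 0 <= a -> a < b -> b <= l -> uniq s ->
  (forall t, t \in s -> a < t < b) ->
  (forall t, a < t < b -> t \notin s -> lslope c t = rslope c t) ->
  \sum_(t <- s) (lslope c t - rslope c t)%:~R * (al + be * t) =
  (rslope c a)%:~R * (al + be * a) - (lslope c b)%:~R * (al + be * b)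
  + be * (c b - c a).
Proof.
move=> [bs hbs] a b s; have [n] := ubnP (count (fun x => a < x < b) bs).
elim: n a b s => // n IH a b s cn a0 ab bl us sab hs.
have [/hasP[x xbs /andP[ax xb]]|/hasPn nb] := boolP (has (fun x => a < x < b) bs); last first.
  have [||m hm] := hbs a b a0 _ bl; [exact: ltW|by []|].
  have [-> -> h] := affine_slopes ab hm.
  rewrite big1_seq; first by rewrite (hm b) ?lexx ?ltW//; ring.
  by move=> t /andP[_ /sab /h [-> ->]]; rewrite subrr mul0r.
pose s1 := [seq t <- s | t < x]; pose s2 := [seq t <- s | x < t].
have e1 := IH a x s1.
have e2 := IH x b s2.
rewrite (bigID (fun t => t < x)) /= -big_filter -/s1 e1//; last first.
- move=> t /andP[at_ tx]; rewrite mem_filter tx /= => ts; apply: hs => //.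
  by rewrite at_ (lt_trans tx).
- by move=> t; rewrite mem_filter => /andP[tx /sab /andP[-> _]].
- exact: filter_uniq.
- by rewrite ltW// (lt_le_trans xb).
- rewrite -ltnS (leq_trans _ cn)// ltnS; apply: (@count_lt _ _ _ _ x) => //=.
  + by move=> y /andP[ay yx]; rewrite unfold_in /= ay (lt_trans yx).
  + by rewrite ax xb.
  + by rewrite ltxx andbF.
have -> : \sum_(t <- s | ~~ (t < x)) (lslope c t - rslope c t)%:~R * (al + be * t) =
  (lslope c x - rslope c x)%:~R * (al + be * x) +
  \sum_(t <- s2) (lslope c t - rslope c t)%:~R * (al + be * t).
  (* A listed break point need not be a genuine one: if it is missing from [s], the slopes agree
     there by [hs]. *)
  have [xs|xs] := boolP (x \in s).
    rewrite -big_filter (bigD1_seq x) ?mem_filter ?ltxx ?filter_uniq//=.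
    congr (_ + _); rewrite !big_filter big_filter_cond.
    by apply: eq_bigl => t; rewrite -leNgt lt_neqAle andbC eq_sym.
  rewrite (hs x) ?ax// subrr mul0r add0r (big_filter s).
  rewrite big_seq_cond [RHS]big_seq_cond; apply: eq_bigl => t.
  by case: (boolP (t \in s)) => //= ts; rewrite -leNgt lt_neqAle; case: eqP => // e; rewrite e ts in xs.
rewrite e2//; last first.
- move=> t /andP[xt tb]; rewrite mem_filter xt /= => ts; apply: hs => //.
  by rewrite tb (lt_trans ax).
- by move=> t; rewrite mem_filter => /andP[tx /sab /andP[_ ->]]; rewrite tx.
- exact: filter_uniq.
- by rewrite (le_trans a0)// ltW.
- rewrite -ltnS (leq_trans _ cn)// ltnS; apply: (@count_lt _ _ _ _ x) => //=.
  + by move=> y /andP[xy yb]; rewrite unfold_in /= yb (lt_trans ax).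
  + by rewrite ax xb.
  + by rewrite ltxx.
by rewrite rmorphB /=; ring.
Qed.

End Intervals.

Section SlopeComparison.
Variable R : realType.
Implicit Types (f g : R -> R) (l t k : R).

Lemma pl_on_shift l f g k : (forall x, 0 <= x <= l -> f x = g x + k) ->
  pl_on l g -> pl_on l f.
Proof.
move=> fg [s hs]; exists s => a b a0 ab bl nb.
have [m hm] := hs a b a0 ab bl nb; exists m => x /andP[ax xb].
rewrite (fg x); last lra.
by rewrite (fg a); [rewrite (hm x); [ring|lra]|lra].
Qed.

Lemma rslope_shift l f g k t : (forall x, 0 <= x <= l -> f x = g x + k) ->
  pl_on l g -> 0 <= t < l -> rslope f t = rslope g t.
Proof.
move=> fg pg tl; have [m hm] := pl_rslope pg tl; rewrite (rslopeP hm).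
apply: rslopeP; have d0 : 0 < l - t by lra.
near=> h.
have h0 : 0 < h by near: h; exact: nbhs_right_gt.
have hd : h < l - t by near: h; exact: nbhs_right_lt.
have e : g (t + h) = g t + m%:~R * h by near: h.
by rewrite !fg; [rewrite e; ring|lra|lra].
Unshelve. all: by end_near. Qed.

Lemma lslope_shift l f g k t : (forall x, 0 <= x <= l -> f x = g x + k) ->
  pl_on l g -> 0 < t <= l -> lslope f t = lslope g t.
Proof.
move=> fg pg tl; have [m hm] := pl_lslope pg tl; rewrite (lslopeP hm).
apply: lslopeP; have d0 : 0 < t by lra.
near=> h.
have h0 : 0 < h by near: h; exact: nbhs_right_gt.
have hd : h < t by near: h; exact: nbhs_right_lt.
have e : g (t - h) = g t - m%:~R * h by near: h.
by rewrite !fg; [rewrite e; ring|lra|lra].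
Unshelve. all: by end_near. Qed.

Lemma linear_slopes l (m : int) : 0 < l ->
  let c := fun x : R => m%:~R * x in
  [/\ pl_on l c, rslope c 0 = m, lslope c l = m &
   forall t, 0 < t < l -> lslope c t = m /\ rslope c t = m].
Proof.
move=> l0 c; have hc a b x : a <= x <= b -> c x = c a + m%:~R * (x - a).
  by move=> _; rewrite /c; ring.
have [h1 h2 h3] := affine_slopes l0 (hc 0 l).
by split=> //; exists [::] => a b _ _ _ _; exists m => x /hc.
Qed.

(** As a primitive of a 1-chain, [Num.min x t] is the path from the source of an edge to its point
    at distance [t]. *)
Lemma truncation_slopes l t : 0 < t < l ->
  let c := fun x : R => Num.min x t in
  [/\ pl_on l c, rslope c 0 = 1, lslope c l = 0 &
   forall x, 0 < x < l -> lslope c x - rslope c x = (x == t)%:R].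
Proof.
move=> /andP[t0 tl] c.
have h1 a b : b <= t -> forall x, a <= x <= b -> c x = c a + 1%:~R * (x - a).
  by move=> bt x /andP[ax xb]; rewrite /c !min_l; [ring|lra|lra].
have h2 a b : t <= a -> forall x, a <= x <= b -> c x = c a + 0%:~R * (x - a).
  by move=> ta x /andP[ax xb]; rewrite /c !min_r; [ring|lra|lra].
have [s1 s2 s3] := affine_slopes t0 (h1 0 t (lexx t)).
have [s4 s5 s6] := affine_slopes tl (h2 t l (lexx t)).
split=> //.
  exists [:: t] => a b a0 ab bl /(_ t); rewrite inE eqxx => /(_ isT).
  rewrite negb_and -!leNgt => /orP[/h2|/h1] h; first by exists 0; apply: h.
  by exists 1; apply: h.
move=> x /andP[x0 xl]; have [xt|tx|->] := ltgtP x t.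
- by have [-> ->] := s3 x (introT andP (conj x0 xt)); rewrite subrr.
- by have [-> ->] := s6 x (introT andP (conj tx xl)); rewrite subrr.
- by rewrite s2 s4 subr0.
Qed.

End SlopeComparison.

(** * Boundaries of 1-chains and summation by parts on the graph *)

Section Chains.
Variables (R : realType) (G : metric_graph R).
Local Notation div := (divisor G).
Implicit Types (D : div) (c : edge G -> R -> R) (w : edge G -> R).

Lemma len_gt0 (e : edge G) : 0 < (len e)%:num :> R.
Proof. by []. Qed.

(** Boundaries of integral 1-chains; closure under subtraction lets a divisor of degree 0 be treated
    as a sum of paths. *)
Definition chained : {pred div} := fun D =>
  `[< exists c, pl_edges c /\ forall p, coeff p D = incoming c p >].

Lemma incoming_slopes (z : edge G -> int) (p : point G) :
  incoming (fun e x => (z e)%:~R * x) p =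
  match p with
  | inl v => \sum_(e | tgt e == v) z e - \sum_(e | src e == v) z e
  | inr _ => 0
  end.
Proof.
case: p => [v|[[e t] /= et]] /=.
  congr (_ - _); apply: eq_bigr => e _;
  by have [_ h1 h2 _] := linear_slopes (z e) (len_gt0 e).
have [_ _ _ h] := linear_slopes (z e) (len_gt0 e).
by have [-> ->] := h _ et; rewrite subrr.
Qed.

Lemma pl_edges_slopes (z : edge G -> int) : pl_edges (fun e x => (z e)%:~R * x).
Proof. by move=> e; have [] := linear_slopes (z e) (len_gt0 e). Qed.

Lemma chained_zmod_closed : zmod_closed chained.
Proof.
split=> [|D1 D2 /asboolP[c1 [pl1 e1]] /asboolP[c2 [pl2 e2]]].
  apply/asboolP; exists (fun e x => 0%:~R * x); split.
    exact: (pl_edges_slopes (fun=> 0)).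
  move=> p; rewrite (incoming_slopes (fun=> 0)) coeff0.
  by case: p => // v; rewrite !big1.
apply/asboolP; exists (fun e => c1 e \- c2 e); split=> [e|p]; first exact: pl_onB.
by rewrite coeffB e1 e2 incomingB.
Qed.

HB.instance Definition _ :=
  GRing.isZmodClosed.Build div chained chained_zmod_closed.

Lemma chained_edge (e0 : edge G) :
  << (inl (tgt e0) : point G) >> - << (inl (src e0) : point G) >> \in chained.
Proof.
apply/asboolP; exists (fun e x => ((e == e0)%:R : int)%:~R * x); split.
  exact: (pl_edges_slopes (fun e => (e == e0)%:R)).
move=> p; rewrite (incoming_slopes (fun e => (e == e0)%:R)) coeffB !coeffU !mul1r.
have E (P : pred (edge G)) : \sum_(e | P e) (e == e0)%:R = (P e0)%:R :> int.
  rewrite big_mkcond (bigD1 e0)//= eqxx big1 ?addr0; first by case: (P e0).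
  by move=> e /negbTE ->; case: (P e).
by case: p => [v|x] /=; rewrite ?E ?subrr.
Qed.

Lemma chained_interior (x : {x : edge G * R | 0 < x.2 < (len x.1)%:num}) :
  << (inr x : point G) >> - << (inl (src (val x).1) : point G) >> \in chained.
Proof.
case: x => [[e0 t0] /= h0].
pose c e x := if e == e0 then Num.min x t0 else 0%:~R * x.
have [p0 r0 l0 i0] := truncation_slopes h0.
have z e := linear_slopes 0 (len_gt0 e).
apply/asboolP; exists c; split.
  move=> e; rewrite /c; case: eqP => [->//|_]; by have [] := z e.
move=> p; rewrite coeffB !coeffU !mul1r.
have El (P : pred (edge G)) : \sum_(e | P e) lslope (c e) (len e)%:num = 0 :> int.
  rewrite big1// => e _; rewrite /c; case: eqP => [->//|_]; by have [] := z e.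
have Er (P : pred (edge G)) : \sum_(e | P e) rslope (c e) 0 = (P e0)%:R :> int.
  rewrite big_mkcond (bigD1 e0)//= big1 ?addr0.
    by rewrite /c eqxx r0; case: (P e0).
  move=> e /negbTE ne; case: (P e) => //; rewrite /c ne; by have [] := z e.
case: p => [v|[[e t] /= et]] /=; first by rewrite El Er !sub0r.
rewrite subr0 /c; case: (eqVneq e e0) => [ee|ne]; last first.
  have [_ _ _ h] := z e; have [-> ->] := h _ et; rewrite subrr.
  by case: eqP => // -[] /esym/eqP; rewrite (negbTE ne).
rewrite i0; last by rewrite -ee.
congr (nat_of_bool _)%:R; rewrite eq_sym.
by apply/eqP/eqP => [[_ ->]//|tt]; congr inr; apply: val_inj; rewrite /= ee tt.
Qed.

(** No continuity at the targets of the edges is required, so that multivalued coordinates, cut at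
    some edge ends, are covered. *)
Definition weight (h : vert G -> R) (s : edge G -> R) (p : point G) : R :=
  match p with
  | inl v => h v
  | inr x => h (src (val x).1) + s (val x).1 * (val x).2
  end.

(* Summation by parts on the graph; the last sum accounts for the failure of
   the weight to extend continuously to the ends of the edges. *)
Lemma chain_by_parts c D h s : pl_edges c -> (forall p, coeff p D = incoming c p) ->
  ev (weight h s) D = \sum_e s e * (c e (len e)%:num - c e 0)
   - \sum_e (lslope (c e) (len e)%:num)%:~R *
       (h (src e) + s e * (len e)%:num - h (tgt e)).
Proof.
move=> plc hD.
pose l2 := pmap (fun p : point G => if p is inr x then Some x else None) (dom D).
have ml2 x : (x \in l2) = ((inr x : point G) \in dom D).
  rewrite mem_pmap; apply/mapP/idP => [[[v|y] yD // [->]]//|xD].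
  by exists (inr x).
have ul2 : uniq l2.
  apply: (@pmap_uniq _ _ _ (fun x => inr x : point G)); last exact: uniq_dom.
  by move=> [v|x] //=.
pose l := [seq (inl v : point G) | v <- enum (vert G)] ++
          [seq (inr x : point G) | x <- l2].
rewrite (@ev_sub _ _ _ _ l); first last.
- move=> [v|x] pD; rewrite mem_cat; first by rewrite map_f ?mem_enum.
  by rewrite [X in _ || X]map_f ?orbT// ml2.
- rewrite cat_uniq !map_inj_uniq ?enum_uniq ?ul2; try by move=> ? ? [].
  rewrite -enumT enum_uniq andbT; apply/hasPn => _ /mapP[x _ ->].
  by apply/mapP => -[].
rewrite big_cat !big_map /=.
have -> : \sum_(v : vert G) (coeff (inl v) D)%:~R * h v =
  \sum_e ((lslope (c e) (len e)%:num)%:~R * h (tgt e)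
          - (rslope (c e) 0)%:~R * h (src e)).
  rewrite sumrB; under eq_bigr do rewrite hD /= rmorphB /= mulrBl.
  rewrite sumrB; congr (_ - _).
    rewrite [RHS](partition_big (@tgt R G) xpredT)//=; apply: eq_bigr => v _.
    rewrite rmorph_sum /= mulr_suml; apply: eq_bigr => e /eqP ->//.
  rewrite [RHS](partition_big (@src R G) xpredT)//=; apply: eq_bigr => v _.
  rewrite rmorph_sum /= mulr_suml; apply: eq_bigr => e /eqP ->//.
rewrite (partition_big (fun x : {x : edge G * R | 0 < x.2 < (len x.1)%:num} =>
  (val x).1) xpredT)//= -!big_split -sumrB /=; apply: eq_bigr => e _.
pose se := [seq (val x).2 | x <- l2 & (val x).1 == e].
have -> : \sum_(x <- l2 | (val x).1 == e) (coeff (inr x) D)%:~R *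
    (h (src (val x).1) + s (val x).1 * (val x).2) =
  \sum_(t <- se) (lslope (c e) t - rslope (c e) t)%:~R * (h (src e) + s e * t).
  rewrite big_map big_filter; apply: eq_bigr => x /eqP ex.
  by rewrite hD /= ex.
rewrite (interval_by_parts (h (src e)) (s e) (plc e) (lexx 0)
  (len_gt0 e) (lexx _)).
- by ring.
- rewrite map_inj_in_uniq ?filter_uniq// => x y.
  rewrite !mem_filter => /andP[/eqP xe _] /andP[/eqP ye _] xy.
  apply: val_inj; move: xe ye xy => /=.
  by case: (sval x) (sval y) => [? ?] [? ?] /= -> -> ->.
- move=> t /mapP[[[e' t'] /= ht]]; rewrite mem_filter /= => /andP[/eqP ee' _] ->.
  by rewrite -ee'.
move=> t et nt; apply/eqP; rewrite -subr_eq0; apply/eqP.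
pose x : {x : edge G * R | 0 < x.2 < (len x.1)%:num} := exist _ (e, t) et.
have : inr x \notin dom D.
  apply: contra nt; rewrite -ml2 => xl.
  by apply/mapP; exists x; rewrite // mem_filter xl eqxx.
by move/coeff_outdom; rewrite hD.
Qed.

Lemma on_edge_weight (h : vert G -> R) (f : {x : edge G * R | 0 < x.2 < (len x.1)%:num} -> R)
   (e : edge G) (t : R) (k : R -> R) :
  (forall x, f x = k (val x).2 \/ (val x).1 <> e) ->
  k 0 = h (src e) -> k (len e)%:num = h (tgt e) -> 0 <= t <= (len e)%:num ->
  on_edge (fun p : point G => match p with inl v => h v | inr x => f x end) e t = k t.
Proof.
move=> fk k0 k1 /andP[t0 tl]; rewrite /on_edge /edge_point.
case: leP => [t0'|t0']; first by have -> : t = 0 by lra.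
case: insubP => [x xt /= xe|/=]; last first.
  by rewrite t0' /= -leNgt => lt; have -> : t = (len e)%:num by lra.
have {}xe : sval x = (e, t) by exact: xe.
by have [->|] := fk x; rewrite /= xe.
Qed.

Lemma principal_chain D : D \in @principal R G ->
  exists c, [/\ pl_edges c, forall p, coeff p D = incoming c p &
    exists h : vert G -> R, forall e, c e (len e)%:num - c e 0 = h (tgt e) - h (src e)].
Proof.
move=> /asboolP[phi [pl e]]; exists (on_edge phi); split=> //.
exists (fun v => phi (inl v)) => x; rewrite /on_edge /edge_point lexx.
rewrite leNgt len_gt0 /=; congr (phi _ - _).
by case: insubP => // y; rewrite /= ltxx andbF.
Qed.

(** Translating each [c e] by a constant leaves its slopes unchanged, and exactness of the
    increments lets the translates match at the vertices. *)
Lemma chain_principal D c (h : vert G -> R) : pl_edges c ->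
  (forall p, coeff p D = incoming c p) ->
  (forall e, c e (len e)%:num - c e 0 = h (tgt e) - h (src e)) ->
  D \in @principal R G.
Proof.
move=> plc hD hh; apply/asboolP.
pose phi := (fun p : point G => match p with inl v => h v
  | inr x => c (val x).1 (val x).2 + (h (src (val x).1) - c (val x).1 0) end).
have E e x : 0 <= x <= (len e)%:num ->
    on_edge phi e x = c e x + (h (src e) - c e 0).
  move=> xe; apply: (on_edge_weight (k := fun x => c e x + (h (src e) - c e 0))) => //.
  - move=> y; have [<-|/eqP] := eqVneq (val y).1 e; by [left|right].
  - by ring.
  - by have := hh e; lra.
exists phi; split=> [e|p]; first exact: pl_on_shift (E e) (plc e).
rewrite hD /ord; case: p => [v|[[e t] /= et]] /=.
  congr (_ - _); apply: eq_bigr => e _; apply/esym.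
    by apply: (lslope_shift (E e) (plc e)); rewrite lexx len_gt0.
  by apply: (rslope_shift (E e) (plc e)); rewrite lexx len_gt0.
congr (_ - _); apply/esym.
  by apply: (lslope_shift (E e) (plc e)); case/andP: et => -> /ltW ->.
by apply: (rslope_shift (E e) (plc e)); case/andP: et => /ltW -> ->.
Qed.

Lemma chain_int_exact c (h : vert G -> R) w : harmonic w ->
  (forall e, c e (len e)%:num - c e 0 = h (tgt e) - h (src e)) -> chain_int c w = 0.
Proof.
move=> hw hc; rewrite /chain_int.
under eq_bigr do rewrite hc mulrBr.
rewrite sumrB (partition_big (@tgt R G) xpredT)//= [X in _ - X](partition_big (@src R G) xpredT)//=.
rewrite -sumrB big1// => v _.
have E1 : \sum_(e | tgt e == v) w e * h (tgt e) = (\sum_(e | tgt e == v) w e) * h v.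
  by rewrite mulr_suml; apply: eq_bigr => e /eqP ->.
have E2 : \sum_(e | src e == v) w e * h (src e) = (\sum_(e | src e == v) w e) * h v.
  by rewrite mulr_suml; apply: eq_bigr => e /eqP ->.
by rewrite E1 E2 hw subrr.
Qed.

End Chains.

(** * The Picard group of a loop of loops *)

Section LoopOfLoopsPicard.
Variables (R : realType) (N : nat) (L : loop_of_loops R N).
Hypothesis N0 : (0 < N)%N.
Hypothesis hU : two_uniform L.
Local Notation Y := (lol_graph L).
Implicit Types (i j : 'I_N) (D : divisor Y) (w : edge Y -> R).

Definition ll j : R := (loop_len L j true)%:num.
Definition bl j : R := (bridge_len L j)%:num.

Lemma ll_gt0 j : 0 < ll j. Proof. by rewrite /ll. Qed.
Lemma bl_gt0 j : 0 < bl j. Proof. by rewrite /bl. Qed.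

Lemma len_loop i b : (len (inl (i, b) : edge Y))%:num = ll i.
Proof. by case: b => //=; rewrite -hU. Qed.

Lemma len_bridge i : (len (inr i : edge Y))%:num = bl i.
Proof. by []. Qed.

Lemma sum_edge (F : edge Y -> R) :
  \sum_e F e = \sum_j (F (inl (j, true)) + F (inl (j, false))) + \sum_j F (inr j).
Proof.
rewrite big_sumType /=; congr (_ + _).
rewrite (eq_bigr (fun p => F (inl (p.1, p.2)))); last by case.
rewrite -(pair_bigA _ (fun j b => F (inl (j, b)))) /=.
by apply: eq_bigr => j _; rewrite big_bool.
Qed.

Lemma ord_predE i : ord_pred i = (if i == 0 :> nat then N.-1 else i.-1) :> nat.
Proof.
case: i => [[|i] iN] /=; first by rewrite add0n modn_small// prednK.
by rewrite modnDr modn_small// ltnW.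
Qed.

(* [kap j] measures how far a point has travelled through the [j]th loop, and
   [rho j] through the [j]th bridge, when going around from the vertex v_0. *)
Definition loop_pos j (v : vert Y) : R :=
  match v with inl i => (j < i)%N%:R | inr i => (j <= i)%N%:R end.
Definition bridge_pos j (v : vert Y) : R :=
  match v with inl i => (0 < j <= i)%N%:R | inr i => (0 < j <= i)%N%:R end.

Definition kap j : point Y -> R := weight (loop_pos j)
  (fun e => match e with inl (i, _) => (i == j)%:R / ll j | inr _ => 0 end).
Definition rho j : point Y -> R := weight (bridge_pos j)
  (fun e => match e with inl _ => 0 | inr i => (i == j)%:R / bl j end).
(** Normalised so that each edge of the loop, that is half of it, has integral 1 or -1. *)
Definition om j (e : edge Y) : R :=
  match e with inl (i, b) => (i == j)%:R * (if b then 1 else - 1) / ll j | inr _ => 0 end.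
(* Angular coordinate on the [j]th loop. *)
Definition th j : point Y -> R := weight (loop_pos j) (om j).
(* Coordinate on the quotient circle of the involution exchanging the edges of
   each loop; as this quotient dilates the bridges, they count twice. *)
Definition et (p : point Y) : R :=
  \sum_j ll j * kap j p + \sum_j 2 * bl j * rho j p.
Definition Lam : R := \sum_j ll j + \sum_j 2 * bl j.
(** Pullback of the unit form of the quotient circle: the dilation of the bridges gives the value 2,
    which balances the two edges of a loop at each vertex. *)
Definition eta (e : edge Y) : R := match e with inl _ => 1 | inr _ => 2 end.

Lemma Lam_gt0 : 0 < Lam.
Proof.
rewrite /Lam ltr_wpDl//; first by apply: sumr_ge0 => i _; rewrite ltW ?ll_gt0.
rewrite (bigD1 (Ordinal N0))//= ltr_pwDl ?mulr_gt0 ?bl_gt0//.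
by apply: sumr_ge0 => i _; rewrite mulr_ge0// ltW ?bl_gt0.
Qed.

Lemma sum_delta (F : 'I_N -> R) i : \sum_j F j * (i == j)%:R = F i.
Proof.
rewrite (bigD1 i)//= eqxx mulr1 big1 ?addr0// => j /negbTE.
by rewrite eq_sym => ->; rewrite mulr0.
Qed.

(** The cut is at the end of the bridge into [v_0], the only bridge along which the coordinates jump
    by a full turn. *)
Lemma loop_pos_bridge j i :
  loop_pos j (inr (ord_pred i)) - loop_pos j (inl i) = (i == 0%N :> nat)%:R.
Proof.
rewrite /loop_pos ord_predE; case: i => [[|i] iN] /=; last by rewrite ltnS subrr.
by rewrite -ltnS prednK// ltn_ord subr0.
Qed.

Lemma bridge_pos_bridge j i :
  bridge_pos j (inr (ord_pred i)) + (i == j)%:R - bridge_pos j (inl i) =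
  (i == 0%N :> nat)%:R.
Proof.
rewrite /bridge_pos ord_predE -val_eqE; case: i j => [[|i] iN] [[|j] jN] //=.
- by rewrite add0r subr0.
- by rewrite -ltnS prednK// jN addr0 subr0.
- by rewrite add0r subr0.
rewrite eqSS eq_sym [(j.+1 <= i.+1)%N]leq_eqVlt eqSS ltnS.
by case: (ltngtP j i) => /= _; ring.
Qed.

Lemma loop_pos_loop j i : loop_pos j (inr i) - loop_pos j (inl i) = (i == j)%:R.
Proof.
rewrite /loop_pos -val_eqE /= leq_eqVlt eq_sym.
by case: (ltngtP i j) => /= _; ring.
Qed.

(** For [s = -1] the jump is -2: along the second edge the angle arrives at -1 instead of 1, which
    is the reason for counting angles modulo 2. *)
Lemma loop_defect j i s :
  loop_pos j (inl i) + (i == j)%:R * s / ll j * ll i - loop_pos j (inr i) =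
  (s - 1) * (i == j)%:R.
Proof.
rewrite -(subrK (loop_pos j (inl i)) (loop_pos j (inr i))) loop_pos_loop.
case: eqP => [->|_] /=; last by ring.
by field; rewrite gt_eqF ?ll_gt0.
Qed.

Section ChainData.
Variables (D : divisor Y) (c : edge Y -> R -> R).
Hypotheses (plc : pl_edges c) (hD : forall p, coeff p D = incoming c p).

Let incr (e : edge Y) : R := c e (len e)%:num - c e 0.
(** Multiplicity of the chain where it crosses the cut; the sum has the single index 0. *)
Let turns : int := \sum_(i : 'I_N | i == 0%N :> nat) lslope (c (inr i)) (bl i).

Let turnsE (F : 'I_N -> R) :
  (forall i, F i = (lslope (c (inr i)) (bl i))%:~R * (i == 0%N :> nat)%:R) ->
  \sum_i F i = turns%:~R.
Proof.
move=> FE; rewrite rmorph_sum /= [RHS]big_mkcond /=; apply: eq_bigr => i _.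
by rewrite FE; case: eqP; rewrite ?mulr1 ?mulr0.
Qed.

Lemma ev_kap j : ev (kap j) D =
  (incr (inl (j, true)) + incr (inl (j, false))) / ll j - turns%:~R.
Proof.
rewrite (chain_by_parts _ _ plc hD) !sum_edge; congr (_ - _).
  rewrite [X in _ + X]big1 ?addr0; last by move=> i _; rewrite mul0r.
  rewrite -[RHS](sum_delta (fun j => (incr (inl (j, true)) + incr (inl (j, false))) / ll j) j).
  apply: eq_bigr => i _; rewrite eq_sym; case: eqP => [->|_]; last by rewrite !mul0r mulr0 addr0.
  by rewrite /incr; ring.
rewrite big1 ?add0r; last first.
  move=> i _; rewrite !len_loop /= -[(i == j)%:R]mulr1 (loop_defect j i 1).
  by rewrite subrr mul0r !mulr0 addr0.
apply: turnsE => i; rewrite mul0r addr0; congr (_ * _); exact: loop_pos_bridge.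
Qed.

Lemma ev_rho j : ev (rho j) D = incr (inr j) / bl j - turns%:~R.
Proof.
rewrite (chain_by_parts _ _ plc hD) !sum_edge; congr (_ - _).
  rewrite big1 ?add0r; last by move=> i _; rewrite !mul0r addr0.
  rewrite -[RHS](sum_delta (fun j => incr (inr j) / bl j) j).
  apply: eq_bigr => i _; rewrite eq_sym; case: eqP => [->|_]; last by rewrite !mul0r mulr0.
  by rewrite /incr; ring.
rewrite big1 ?add0r; last first.
  by move=> i _; rewrite !mul0r !addr0 /= subrr !mulr0 addr0.
apply: turnsE => i; congr (_ * _); rewrite -(bridge_pos_bridge j i) len_bridge.
congr (_ + _ - _); case: eqP => [->|_]; last by rewrite !mul0r.
by rewrite mul1r mulVf ?gt_eqF ?bl_gt0.
Qed.

Lemma ev_th j : ev (th j) D = chain_int c (om j) +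
  2 * (lslope (c (inl (j, false))) (ll j))%:~R - turns%:~R.
Proof.
rewrite (chain_by_parts _ _ plc hD) -addrA; congr (_ + _).
rewrite sum_edge opprD; congr (_ + _); last first.
  congr (- _); apply: turnsE => i; rewrite mul0r addr0; congr (_ * _).
  exact: loop_pos_bridge.
rewrite -[RHS](sum_delta (fun j => 2 * (lslope (c (inl (j, false))) (ll j))%:~R) j) -sumrN.
apply: eq_bigr => i _; rewrite !len_loop /=.
rewrite (loop_defect j i 1) (loop_defect j i (-1)).
by case: (eqVneq i j) => [->|_] /=; ring.
Qed.

Lemma ev_et : ev et D = chain_int c eta - turns%:~R * Lam.
Proof.
rewrite evfD !evf_sum /chain_int sum_edge.
under eq_bigr do rewrite evfZ ev_kap.
under [X in _ + X]eq_bigr do rewrite evfZ ev_rho.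
rewrite /Lam mulrDr opprD addrACA -/incr; congr (_ + _).
  rewrite mulr_sumr -sumrB; apply: eq_bigr => j _.
  have := ll_gt0 j; set l := ll j => l0; have ln : l != 0 by rewrite gt_eqF.
  by rewrite /incr /=; field.
rewrite mulr_sumr -sumrB; apply: eq_bigr => j _.
have := bl_gt0 j; set l := bl j => l0; have ln : l != 0 by rewrite gt_eqF.
by rewrite /incr /=; field.
Qed.

Lemma ev_deg0 : deg D = 0.
Proof.
apply: (@intr_inj R); rewrite -ev_deg.
rewrite (@ev_eq _ _ _ (weight (fun=> 1) (fun=> 0))).
  rewrite (chain_by_parts _ _ plc hD) !big1 ?subr0// => e _.
    by rewrite mul0r addr0 subrr mulr0.
  by rewrite mul0r.
by move=> [v|x] _ //=; rewrite mul0r addr0.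
Qed.

End ChainData.

End LoopOfLoopsPicard.

(** * The Abel-Jacobi map in explicit coordinates *)

Section AbelJacobi.
Variables (R : realType) (N : nat) (L : loop_of_loops R N).
Hypothesis N0 : (0 < N)%N.
Hypothesis hU : two_uniform L.
Local Notation Y := (lol_graph L).
Local Notation ll := (ll L).
Local Notation bl := (bl L).
Local Notation om := (@om R N L).
Local Notation eta := (@eta R N L).
Local Notation Lam := (Lam L).
Implicit Types (i j : 'I_N) (D : divisor Y) (w : edge Y -> R).

Lemma sum_tgt (T : nmodType) (F : edge Y -> T) (v : vert Y) :
  \sum_(e | tgt e == v) F e =
  match v with
  | inl i => F (inr i)
  | inr i => F (inl (i, true)) + F (inl (i, false))
  end.
Proof.
rewrite big_sumType /=; case: v => i.
  rewrite big1 ?add0r; last by case=> j b.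
  by rewrite (big_pred1 i)// => j; rewrite /= eq_sym.
rewrite [X in _ + X]big1 ?addr0//.
rewrite (eq_bigl (fun p => (p.1 == i) && true)); last by case=> j b; rewrite andbT.
rewrite (eq_bigr (fun p => F (inl (p.1, p.2)))); last by case.
rewrite -(pair_big (fun j => j == i) xpredT (fun j b => F (inl (j, b)))) /=.
by rewrite (big_pred1 i)//= big_bool.
Qed.

Lemma sum_src (T : nmodType) (F : edge Y -> T) (v : vert Y) :
  \sum_(e | src e == v) F e =
  match v with
  | inl i => F (inl (i, true)) + F (inl (i, false))
  | inr i => F (inr (ordS i))
  end.
Proof.
rewrite big_sumType /=; case: v => i; last first.
  rewrite big1 ?add0r; last by case=> j b.
  rewrite (big_pred1 (ordS i))// => j /=.
  by apply/eqP/eqP => [[<-]|->]; rewrite ?ord_predK ?ordSK.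
rewrite [X in _ + X]big1 ?addr0//.
rewrite (eq_bigl (fun p => (p.1 == i) && true)); last by case=> j b; rewrite andbT.
rewrite (eq_bigr (fun p => F (inl (p.1, p.2)))); last by case.
rewrite -(pair_big (fun j => j == i) xpredT (fun j b => F (inl (j, b)))) /=.
by rewrite (big_pred1 i)//= big_bool.
Qed.

Lemma harmonic_om j : harmonic (om j).
Proof. by case=> i; rewrite sum_tgt sum_src /=; ring. Qed.

Lemma harmonic_eta : harmonic eta.
Proof. by case=> i; rewrite sum_tgt sum_src. Qed.

Definition om_coef w j : R := (w (inl (j, true)) - w (inl (j, false))) * ll j / 2.
Definition eta_coef w : R := w (inr (Ordinal N0)) / 2.

Lemma harmonic_bridge w i : harmonic w -> w (inr i) = 2 * eta_coef w.
Proof.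
move=> hw; have step k : w (inr (ord_pred k)) = w (inr k).
  have := hw (inl (ord_pred k)); have := hw (inr (ord_pred k)).
  by rewrite !sum_tgt !sum_src ord_predK => -> ->.
rewrite /eta_coef mulrC divfK//.
case: i => k; elim: k => [|k IH] kN; first by congr (w (inr _)); apply: ord_inj.
rewrite -step -(IH (ltnW kN)); congr (w (inr _)); apply: ord_inj.
by rewrite ord_predE.
Qed.

(** Conservation at the vertices makes the flow through the bridges constant; on a loop the sum of
    the two values is this flow and only their difference is free. *)
Lemma harmonic_span w e : harmonic w ->
  w e = \sum_j om_coef w j * om j e + eta_coef w * eta e.
Proof.
move=> hw; case: e => [[i b]|i]; last first.
  by rewrite big1 ?add0r ?(harmonic_bridge i hw) 1?mulrC// => j _; rewrite mulr0.
have := hw (inl i); rewrite sum_tgt sum_src (harmonic_bridge i hw) => e.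
have -> : \sum_j om_coef w j * om j (inl (i, b)) =
  (if b then 1 else -1) * (w (inl (i, true)) - w (inl (i, false))) / 2.
  rewrite -[RHS](sum_delta (fun j => (if b then 1 else -1) *
    (w (inl (j, true)) - w (inl (j, false))) / 2) i).
  apply: eq_bigr => j _; rewrite /om_coef /=; case: eqP => _; last first.
    by rewrite !mul0r !mulr0.
  rewrite mul1r mulr1; move: (if b then _ else _) => s.
  by field; rewrite gt_eqF ?ll_gt0.
by rewrite mulr1; case: b; lra.
Qed.

(** [abel_jacobi] accepts any function [l]; this is the linearity that reduces its condition to the
    values on the basis [om j], [eta]. *)
Definition spanned (l : (edge Y -> R) -> R) : Prop := forall w, harmonic w ->
  l w = \sum_j om_coef w j * l (om j) + eta_coef w * l eta.

Lemma spanned_chain c : spanned (chain_int c).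
Proof.
move=> w hw; rewrite /chain_int.
under eq_bigr do rewrite (harmonic_span _ hw) mulrDl.
rewrite big_split /=; congr (_ + _); last first.
  by rewrite mulr_sumr; apply: eq_bigr => e _; rewrite mulrA.
under eq_bigr do rewrite mulr_suml.
rewrite exchange_big /=; apply: eq_bigr => j _.
by rewrite mulr_sumr; apply: eq_bigr => e _; rewrite mulrA.
Qed.

Lemma spanned_cycle z : spanned (cycle_int z).
Proof.
move=> w hw; rewrite /cycle_int.
under eq_bigr do rewrite (harmonic_span _ hw) mulrDl.
rewrite big_split /=; congr (_ + _); last first.
  by rewrite mulr_sumr; apply: eq_bigr => e _; rewrite mulrA.
under eq_bigr do rewrite mulr_suml.
rewrite exchange_big /=; apply: eq_bigr => j _.
by rewrite mulr_sumr; apply: eq_bigr => e _; rewrite mulrA.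
Qed.

Lemma spanned_sum k (x : 'I_k -> R) (l : 'I_k -> (edge Y -> R) -> R) :
  (forall q, spanned (l q)) -> spanned (fun w => \sum_q x q * l q w).
Proof.
move=> hl w hw; rewrite [X in _ = _ + X]mulr_sumr.
under eq_bigr do rewrite hl//.
under [in RHS]eq_bigr do rewrite mulr_sumr.
rewrite exchange_big -big_split /=; apply: eq_bigr => q _.
rewrite mulrDr mulr_sumr; congr (_ + _); last by rewrite mulrCA.
by apply: eq_bigr => j _; rewrite mulrCA.
Qed.

(* The homology basis dual to the forms [om j] and [eta]. *)
Definition loop_cycle j (e : edge Y) : int :=
  match e with inl (i, b) => (i == j)%:R * (if b then 1 else -1) | inr _ => 0 end.
Definition round_cycle (e : edge Y) : int :=
  match e with inl (_, b) => (b : nat)%:Z | inr _ => 1 end.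

Lemma cycle_loop_cycle j : cycle (loop_cycle j).
Proof. by case=> i; rewrite sum_tgt sum_src /=; ring. Qed.

Lemma cycle_round_cycle : cycle round_cycle.
Proof. by case=> i; rewrite sum_tgt sum_src. Qed.

Lemma cycle_int_loop_om j i : cycle_int (loop_cycle j) (om i) = 2 * (i == j)%:R.
Proof.
rewrite /cycle_int sum_edge [X in _ + X]big1 ?addr0; last by move=> k _; rewrite mul0r.
rewrite -[in RHS](eq_sym j) -[RHS](sum_delta (fun i => 2 * (j == i)%:R) i).
apply: eq_bigr => k _; rewrite !len_loop// /= !intrM.
case: (eqVneq k i) => [->|_]; last by rewrite !mul0r addr0 mulr0.
rewrite (eq_sym j); case: (i == j); last by rewrite !mul0r !mulr0 addr0 mul0r.
by rewrite /= intrN; field; rewrite gt_eqF ?ll_gt0.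
Qed.

Lemma cycle_int_loop_eta j : cycle_int (loop_cycle j) eta = 0.
Proof.
rewrite /cycle_int sum_edge [X in _ + X]big1 ?addr0; last by move=> k _; rewrite mul0r mulr0.
by rewrite big1// => k _; rewrite !len_loop// /= !intrM intrN; ring.
Qed.

Lemma cycle_int_round_om i : cycle_int round_cycle (om i) = 1.
Proof.
rewrite /cycle_int sum_edge [X in _ + X]big1 ?addr0; last by move=> k _; rewrite mul0r.
rewrite -[RHS](sum_delta (fun i => 1) i).
apply: eq_bigr => k _; rewrite !len_loop// /=.
case: (eqVneq k i) => [->|_] /=; last by ring.
by field; rewrite gt_eqF ?ll_gt0.
Qed.

Lemma cycle_int_round_eta : cycle_int round_cycle eta = Lam.
Proof.
rewrite /cycle_int sum_edge; congr (_ + _); apply: eq_bigr => k _.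
  by rewrite !len_loop// /=; ring.
by rewrite /= len_bridge; ring.
Qed.

Lemma chained_vertex (v : vert Y) :
  << (inl v : point Y) >> - << (inl (inl (Ordinal N0)) : point Y) >> \in @chained R Y.
Proof.
have sub (p q r : point Y) : << p >> - << q >> \in @chained R Y ->
  << q >> - << r >> \in @chained R Y -> << p >> - << r >> \in @chained R Y.
  by move=> h1 h2; have := rpredD h1 h2; rewrite addrA subrK.
have loop i := chained_edge (inl (i, true) : edge Y).
have vi i : << (inl (inl i) : point Y) >> - << (inl (inl (Ordinal N0)) : point Y) >>
    \in @chained R Y.
  case: i => k; elim: k => [|k IH] kN.
    have -> : Ordinal kN = Ordinal N0 by apply: ord_inj.
    by rewrite subrr rpred0.
  apply: (fun h => sub _ _ _ h (IH (ltnW kN))).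
  apply: (fun h => sub _ _ _ h (loop (Ordinal (ltnW kN)))).
  have := chained_edge (inr (Ordinal kN) : edge Y) => /=.
  by rewrite (_ : ord_pred _ = Ordinal (ltnW kN))//; apply: ord_inj; rewrite ord_predE.
case: v => i; first exact: vi.
exact: sub (loop i) (vi i).
Qed.

Lemma chained_deg0 D : deg D = 0 -> D \in @chained R Y.
Proof.
move=> D0; pose o : point Y := inl (inl (Ordinal N0)).
have -> : D = \sum_(p <- dom D) (<< p >> - << o >>) *~ coeff p D.
  under eq_bigr do rewrite mulrzBl [<< _ >> *~ _]freegU_mulz intz.
  rewrite sumrB freeg_sumE -mulrz_sumr.
  suff -> : \sum_(p <- dom D) coeff p D = deg D by rewrite D0 subr0.
  rewrite -[in RHS](freeg_sumE D) raddf_sum; apply: eq_bigr => p _.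
  by rewrite /= degU.
apply: rpred_sum => -[v|x] _; apply: rpredMz; first exact: chained_vertex.
have := rpredD (chained_interior x) (chained_vertex (src (val x).1)).
by rewrite addrA subrK.
Qed.

Lemma add_cycle D (c : edge Y -> R -> R) (z : edge Y -> int) : pl_edges c ->
  (forall p, coeff p D = incoming c p) -> cycle z ->
  exists c', [/\ pl_edges c', forall p, coeff p D = incoming c' p &
    forall w, chain_int c' w = chain_int c w + cycle_int z w].
Proof.
move=> plc hD hz; have pz := pl_edges_slopes (fun e => - z e).
exists (fun e => c e \- (fun x => (- z e)%:~R * x)); split.
- by move=> e; apply: pl_onB.
- move=> p; rewrite (incomingB p plc pz) -hD incoming_slopes.
  case: p => [v|x]; last by rewrite subr0.
  by rewrite !sumrN hz opprK addNr subr0.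
- move=> w; rewrite /chain_int /cycle_int -big_split; apply: eq_bigr => e _ /=.
  by rewrite mulr0 intrN; ring.
Qed.

(** These are the periods: twice the unit vectors, from the loops, and the vector with all angles 1
    and position [Lam], from one turn around the graph. *)
Lemma cycle_comb (m : 'I_N -> int) (k : int) :
  exists z, [/\ cycle z, forall j, cycle_int z (om j) = 2 * (m j)%:~R + k%:~R
    & cycle_int z eta = k%:~R * Lam].
Proof.
exists (fun e => \sum_j m j * loop_cycle j e + k * round_cycle e).
have E w : cycle_int (fun e => \sum_j m j * loop_cycle j e + k * round_cycle e) w =
  \sum_j (m j)%:~R * cycle_int (loop_cycle j) w + k%:~R * cycle_int round_cycle w.
  rewrite /cycle_int mulr_sumr; under [in RHS]eq_bigr do rewrite mulr_sumr.
  rewrite exchange_big -big_split; apply: eq_bigr => e _ /=.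
  rewrite rmorphD rmorph_sum /= mulrDl mulrDr mulr_suml mulr_sumr; congr (_ + _).
    by apply: eq_bigr => j _; rewrite intrM; ring.
  by rewrite intrM; ring.
split.
- move=> v; rewrite !big_split /= -!mulr_sumr cycle_round_cycle; congr (_ + _).
  rewrite exchange_big [RHS]exchange_big; apply: eq_bigr => j _.
  by rewrite -!mulr_sumr cycle_loop_cycle.
- move=> j; rewrite E cycle_int_round_om mulr1; congr (_ + _).
  rewrite -[RHS](sum_delta (fun j => 2 * (m j)%:~R) j).
  by apply: eq_bigr => i _; rewrite cycle_int_loop_om (eq_sym j); case: eqP => [->|_] /=; ring.
- rewrite E cycle_int_round_eta big1 ?add0r// => j _.
  by rewrite cycle_int_loop_eta mulr0.
Qed.

(** The integers record the jumps of the coordinates along a chain with boundary [D]: [m] those at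
    the ends of the second edges of the loops, [k] those at the cut. Adding cycles to the chain
    realises all other values. *)
Lemma abel_jacobiP D l : spanned l -> abel_jacobi D l <->
  deg D = 0 /\ exists (m : 'I_N -> int) (k : int),
  (forall j, ev (@th R N L j) D = l (om j) + 2 * (m j)%:~R + k%:~R) /\
  ev (@et R N L) D = l eta + k%:~R * Lam.
Proof.
move=> hl; split.
  move=> [c [plc hD hc]]; split; first exact: ev_deg0 plc hD.
  exists (fun j => lslope (c (inl (j, false))) (ll j)).
  exists (- \sum_(i : 'I_N | i == 0%N :> nat) lslope (c (inr i)) (bl i)).
  rewrite -(hc _ harmonic_eta) (ev_et hU plc hD) intrN mulNr; split=> // j.
  by rewrite -(hc _ (harmonic_om j)) (ev_th hU plc hD).
move=> [D0 [m [k [hm hk]]]].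
have /asboolP[c [plc hD]] := chained_deg0 D0.
pose t : int := \sum_(i : 'I_N | i == 0%N :> nat) lslope (c (inr i)) (bl i).
pose s j := lslope (c (inl (j, false))) (ll j).
(* The cycle trades the jumps [s] and [- t] of the arbitrary chain [c] for the prescribed [m] and
   [k]. *)
have [z [hz zo ze]] := cycle_comb (fun j => s j - m j) (- (k + t)).
have [c' [plc' hD' hc']] := add_cycle plc hD hz.
exists c'; split=> // w hw; rewrite spanned_chain// hl//; congr (_ + _ * _).
  apply: eq_bigr => j _; congr (_ * _); rewrite hc' zo.
  have := hm j; rewrite (ev_th hU plc hD) -/t -/(s j).
  by rewrite !(intrB, intrN, intrD); lra.
rewrite hc' ze; have := hk; rewrite (ev_et hU plc hD) -/t.
by rewrite !(intrN, intrD) => e; rewrite mulNr mulrDl; lra.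
Qed.

Lemma principalP D : D \in @principal R Y <-> abel_jacobi D (fun=> 0).
Proof.
split=> [/principal_chain[c [plc hD [h hh]]]|[c [plc hD hc]]].
  by exists c; split=> // w hw; apply: chain_int_exact hw hh.
pose d (e : edge Y) := c e (len e)%:num - c e 0.
(* Candidate potential: the increments met on the way from [v_0] through the edges [true]. The other
   edges give the same values by [dl], and the turn closes up by [dt]. *)
pose h (v : vert Y) : R := \sum_j d (inl (j, true)) * loop_pos j v +
            \sum_j d (inr j) * bridge_pos j v.
apply: (@chain_principal _ _ _ _ h plc hD) => e; rewrite -/(d e); move: e.
have dl i : d (inl (i, false)) = d (inl (i, true)).
  have := hc _ (harmonic_om i); rewrite /chain_int sum_edge.
  rewrite [X in _ + X]big1 ?addr0; last by move=> j _; rewrite mul0r.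
  rewrite (_ : \sum_j _ = \sum_j (d (inl (j, true)) - d (inl (j, false))) / ll j * (i == j)%:R).
    rewrite (bigD1 i)//= eqxx mulr1 big1 ?addr0; last first.
      by move=> j /negbTE; rewrite eq_sym => ->; rewrite mulr0.
    move/eqP; rewrite mulf_eq0 invr_eq0 [ll i == 0]gt_eqF ?ll_gt0// orbF subr_eq0.
    by move/eqP ->.
  by apply: eq_bigr => j _; rewrite /d /= (eq_sym i); case: eqP => [->|_] /=; ring.
have dt : \sum_j d (inl (j, true)) + \sum_j d (inr j) = 0.
  have := hc _ harmonic_eta; rewrite /chain_int sum_edge => e.
  apply: (@mulfI _ 2) => //; rewrite mulr0 -[RHS]e mulrDr !mulr_sumr.
  congr (_ + _); apply: eq_bigr => j _; rewrite -!/(d _)//.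
  by rewrite dl /eta; ring.
move=> [[i b]|i].
  rewrite [tgt _]/= [src _]/=.
  have -> : d (inl (i, b)) = d (inl (i, true)) by case: b; rewrite ?dl.
  rewrite /h opprD addrACA [X in _ + X](_ : _ = 0) ?addr0; last exact: subrr.
  rewrite -sumrB.
  rewrite -[LHS](sum_delta (fun j => d (inl (j, true))) i).
  by apply: eq_bigr => j _; rewrite -mulrBr loop_pos_loop.
rewrite [tgt _]/= [src _]/= /h opprD addrACA -!sumrB.
rewrite (eq_bigr (fun j => - (i == 0%N :> nat)%:R * d (inl (j, true)))); last first.
  by move=> j _; rewrite -(loop_pos_bridge L j); ring.
rewrite [X in _ + X](eq_bigr (fun j => d (inr j) * (i == j)%:R
    + - (i == 0%N :> nat)%:R * d (inr j))); last first.
  by move=> j _; rewrite -(bridge_pos_bridge L j); ring.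
rewrite big_split /= -!mulr_sumr addrCA -mulrDr dt mulr0 addr0.
by rewrite (@sum_delta R N (fun j => d (inr j))).
Qed.

End AbelJacobi.

Section ClassData.
Variables (R : realType) (N : nat) (L : loop_of_loops R N).
Hypothesis N0 : (0 < N)%N.
Hypothesis hU : two_uniform L.
Local Notation Y := (lol_graph L).
Implicit Types (i j : 'I_N) (D E : divisor Y).

Lemma cls_eqP D E : cls D = cls E <-> deg D = deg E /\
  exists (m : 'I_N -> int) (k : int),
  (forall j, ev (th j) D = ev (th j) E + 2 * (m j)%:~R + k%:~R) /\
  ev (@et R N L) D = ev (@et R N L) E + k%:~R * Lam L.
Proof.
have s0 : spanned N0 (fun _ : edge Y -> R => 0).
  by move=> w _; rewrite big1 ?mulr0 ?addr0// => j _; rewrite mulr0.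
rewrite clsP principalP// (abel_jacobiP hU _ s0).
have ED f : ev f (D - E) = ev f D - ev f E by rewrite raddfB.
split=> -[D0 [m [k [hm hk]]]]; (split; last exists m, k; first last; first split).
- by move=> j; have := hm j; rewrite ED; lra.
- by have := hk; rewrite ED; lra.
- by apply/eqP; rewrite -subr_eq0 -degB D0.
- by move=> j; rewrite ED hm; ring.
- by rewrite ED hk; ring.
- by rewrite degB D0 subrr.
Qed.

Lemma sum_vert (T : nmodType) (F : vert Y -> T) :
  \sum_v F v = \sum_i F (inl i) + \sum_i F (inr i).
Proof. by rewrite big_sumType. Qed.

Lemma valence3 (v : vert Y) : valence v = 3.
Proof.
have E (P : pred (edge Y)) : #|[set e | P e]| = (\sum_(e | P e) 1)%N.
  rewrite -sum1_card; apply: eq_bigl => e.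
  by apply/idP/idP; rewrite in_setE.
by rewrite /valence !E; have := sum_src (fun=> 1%N) v; have := sum_tgt (fun=> 1%N) v;
  case: v => v -> ->.
Qed.

Lemma ev_canonical f : ev f (canonical Y) = \sum_(v : vert Y) f (inl v) :> R.
Proof.
rewrite raddf_sum; apply: eq_bigr => v _ /=.
by rewrite evU valence3 mul1r.
Qed.

Lemma deg_canonical : deg (canonical Y) = (N + N)%N%:Z.
Proof.
rewrite raddf_sum sum_vert /=; under eq_bigr do rewrite degU valence3.
under [X in _ + X]eq_bigr do rewrite degU valence3.
rewrite !sumr_const card_ord -mulrnDr (_ : 3%:Z - 2 = 1)//; exact: natz.
Qed.

Lemma sum_geq k : \sum_(i < N) (k <= i)%N%:R = (N - k)%N%:R :> R.
Proof.
rewrite -natr_sum; congr (_%:R).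
elim: (N) => [|M IH]; first by rewrite big_ord0.
by rewrite big_ord_recr /= IH; case: (leqP k M) => kM; [rewrite subSn ?addn1|move: kM; lia].
Qed.

Lemma sum_gtn j : \sum_(i < N) (j < i)%N%:R = N%:R - 1 - j%:R :> R.
Proof. by rewrite sum_geq natrB// -natr1; ring. Qed.

Lemma ev_kap_canonical j : ev (kap j) (canonical Y) = 2 * (N%:R - 1 - j%:R) + 1.
Proof. by rewrite ev_canonical sum_vert /= sum_gtn sum_geq natrB 1?ltnW//; ring. Qed.

Lemma ev_rho_canonical j : (0 < j)%N ->
  ev (rho j) (canonical Y) = 2 * (N%:R - j%:R).
Proof.
move=> j0; have := ev_kap_canonical j; rewrite !ev_canonical !sum_vert /= j0 /=.
rewrite (_ : \sum_(i < N) (j < i)%N%:R = \sum_(i < N) (j <= i)%N%:R - 1 :> R) => [|]; first by lra.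
rewrite (bigD1 j)//= [in RHS](bigD1 j)//= ltnn leqnn add0r addrAC subrr add0r.
by apply: eq_bigr => i ij; rewrite ltn_neqAle eq_sym ij.
Qed.

Lemma ev_rho_canonical0 j : j = 0%N :> nat -> ev (rho j) (canonical Y) = 0.
Proof. by move=> j0; rewrite ev_canonical sum_vert /= j0 !big1 ?addr0. Qed.

Lemma ev_th_canonical j : ev (th j) (canonical Y) = 2 * (N%:R - 1 - j%:R) + 1.
Proof. by rewrite -ev_kap_canonical !ev_canonical. Qed.

End ClassData.

(** * The fibre of the norm *)

Section Norm.
Variables (R : realType) (n : nat) (L : loop_of_loops R n).
Hypothesis n0 : (0 < n)%N.
Hypothesis hU : two_uniform L.
Local Notation X := (lol_graph L).
Local Notation C := (antipodal_cover L).
Local Notation Y := (lol_graph (antipodal_cover L)).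
Implicit Types (j : 'I_n) (i : 'I_(n + n)) (D E : divisor Y).

Lemma cover_gt0 : (0 < n + n)%N. Proof. by rewrite addn_gt0 n0. Qed.

Lemma two_uniform_cover : two_uniform C.
Proof. by move=> i; exact: hU. Qed.

Lemma reduce_lshift j : reduce_idx (lshift n j) = j.
Proof. by rewrite /reduce_idx (unsplitK (inl j : 'I_n + 'I_n)). Qed.

Lemma reduce_rshift j : reduce_idx (rshift n j) = j.
Proof. by rewrite /reduce_idx (unsplitK (inr j : 'I_n + 'I_n)). Qed.

(** Number of turns around the base already completed along one turn of the cover; by this amount
    the coordinates of a projection fall short of the sum of the two lifted ones. *)
Definition half (v : vert Y) : int :=
  match v with inl i => (n <= i)%N%:Z | inr i => (n <= i)%N%:Z end.

Definition half_of (p : point Y) : int :=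
  match p with inl v => half v | inr x => half (src (val x).1) end.

Lemma weight_proj (h : vert X -> R) (s : edge X -> R) (h1 h2 : vert Y -> R)
    (s1 s2 : edge Y -> R) (p : point Y) :
  (forall v, h (map_vert (@reduce_idx n) v) = h1 v + h2 v - (half v)%:~R) ->
  (forall e, s (map_edge (@reduce_idx n) e) = s1 e + s2 e) ->
  weight h s (proj p) = weight h1 s1 p + weight h2 s2 p - (half_of p)%:~R.
Proof.
move=> hh hs; case: p => [v|[[e t] /= et]]; first exact: hh.
change (h (src (map_edge (@reduce_idx n) e : edge X)) +
  s (map_edge (@reduce_idx n) e) * t = h1 (src e) + s1 e * t +
  (h2 (src e) + s2 e * t) - (half (src e))%:~R).
by rewrite proj_src hh hs; ring.
Qed.

Lemma reduce_idx_eq j i :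
  (reduce_idx i == j)%:R = (i == lshift n j)%:R + (i == rshift n j)%:R :> R.
Proof.
rewrite -(splitK i); case: (fintype.split i) => k /=.
  by rewrite reduce_lshift (inj_eq (@lshift_inj _ _)) eq_lrshift addr0.
by rewrite reduce_rshift (inj_eq (@rshift_inj _ _)) eq_rlshift add0r.
Qed.

Lemma ll_cover i : ll C i = ll L (reduce_idx i). Proof. by []. Qed.
Lemma bl_cover i : bl C i = bl L (reduce_idx i). Proof. by []. Qed.

Lemma om_proj j (e : edge Y) :
  om j (map_edge (@reduce_idx n) e : edge X) = om (lshift n j) e + om (rshift n j) e.
Proof.
case: e => [[i b]|i] /=; last by rewrite addr0.
by rewrite reduce_idx_eq !ll_cover reduce_lshift reduce_rshift; ring.
Qed.

Lemma nat_bool_eq (a b c d : bool) : (a + d = b + c)%N ->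
  a%:R = b%:R + c%:R - d%:Z%:~R :> R.
Proof. by move=> e; apply: (addIr (d%:R)); rewrite subrK -!natrD e. Qed.

Lemma loop_pos_proj j (v : vert Y) :
  loop_pos j (map_vert (@reduce_idx n) v : vert X) =
  loop_pos (lshift n j) v + loop_pos (rshift n j) v - (half v)%:~R :> R.
Proof.
have jn := ltn_ord j; case: v => i /=; rewrite -(splitK i);
  case: (fintype.split i) => k /=; rewrite ?reduce_lshift ?reduce_rshift;
  have kn := ltn_ord k; apply: nat_bool_eq; move: jn kn; lia.
Qed.

Lemma bridge_pos_proj j (v : vert Y) :
  bridge_pos j (map_vert (@reduce_idx n) v : vert X) =
  bridge_pos (lshift n j) v + bridge_pos (rshift n j) v - (half v)%:~R :> R.
Proof.
have jn := ltn_ord j; case: v => i /=; rewrite -(splitK i);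
  case: (fintype.split i) => k /=; rewrite ?reduce_lshift ?reduce_rshift;
  have kn := ltn_ord k; apply: nat_bool_eq; move: jn kn; lia.
Qed.

Lemma th_proj j p : th j (proj p) = th (lshift n j) p + th (rshift n j) p - (half_of p)%:~R.
Proof. exact: weight_proj (loop_pos_proj j) (om_proj j). Qed.

Lemma kap_proj j p : kap j (proj p) = kap (lshift n j) p + kap (rshift n j) p - (half_of p)%:~R.
Proof.
apply: weight_proj (loop_pos_proj j) _ => -[[i b]|i] /=; last by rewrite addr0.
by rewrite reduce_idx_eq !ll_cover reduce_lshift reduce_rshift; ring.
Qed.

Lemma rho_proj j p : rho j (proj p) = rho (lshift n j) p + rho (rshift n j) p - (half_of p)%:~R.
Proof.
apply: weight_proj (bridge_pos_proj j) _ => -[[i b]|i] /=; first by rewrite addr0.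
by rewrite reduce_idx_eq !bl_cover reduce_lshift reduce_rshift; ring.
Qed.

Lemma Lam_cover : Lam C = 2 * Lam L.
Proof.
rewrite /Lam !big_split_ord /=.
under eq_bigr do rewrite ll_cover reduce_lshift.
under [X in _ + X + _]eq_bigr do rewrite ll_cover reduce_rshift.
under [X in _ + (X + _)]eq_bigr do rewrite bl_cover reduce_lshift.
under [X in _ + (_ + X)]eq_bigr do rewrite bl_cover reduce_rshift.
by ring.
Qed.

Lemma et_proj p : @et R n L (proj p) = @et R _ C p - (half_of p)%:~R * Lam L.
Proof.
rewrite /et !big_split_ord /=.
under eq_bigr do rewrite kap_proj.
under [X in _ + X]eq_bigr do rewrite rho_proj.
under [in RHS]eq_bigr do rewrite ll_cover reduce_lshift.
under [X in _ = _ + X + _ - _]eq_bigr do rewrite ll_cover reduce_rshift.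
under [X in _ = _ + (X + _) - _]eq_bigr do rewrite bl_cover reduce_lshift.
under [X in _ = _ + (_ + X) - _]eq_bigr do rewrite bl_cover reduce_rshift.
under eq_bigr do rewrite mulrBr mulrDr.
under [X in _ + X]eq_bigr do rewrite mulrBr mulrDr.
rewrite !sumrB !big_split /= /Lam mulrDr !mulr_sumr.
under [X in _ - X + _ = _]eq_bigr do rewrite mulrC.
under [X in _ + (_ - X) = _]eq_bigr do rewrite mulrC.
by ring.
Qed.

Lemma ev_norm f D : ev f (norm D) = ev (fun p => f (proj p)) D :> R.
Proof. by rewrite raddf_sum; apply: eq_bigr => p _; rewrite /= evU. Qed.

Lemma deg_norm D : deg (norm D) = deg D.
Proof.
rewrite -[in RHS](freeg_sumE D) !raddf_sum; apply: eq_bigr => p _.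
by rewrite /= !degU.
Qed.

Lemma ev_th_norm j D : ev (th j) (norm D) =
  ev (th (lshift n j)) D + ev (th (rshift n j)) D - (evz half_of D)%:~R.
Proof. by rewrite ev_norm evzE -evfD -evfB; apply: ev_eq => p _; exact: th_proj. Qed.

Lemma ev_et_norm D : ev (@et R n L) (norm D) =
  ev (@et R _ C) D - (evz half_of D)%:~R * Lam L.
Proof.
rewrite ev_norm evzE mulrC -evfZ -evfB; apply: ev_eq => p _.
by rewrite et_proj mulrC.
Qed.

Definition canon_et : R := ev (@et R n L) (canonical X).

(* The coordinate of a class of the fibre of the norm over the canonical class
   on the [i]th loop, measured from the position it has when each later loop
   carries exactly one chip. *)
Definition coord (eps : bool) (x : 'I_n -> R) i : R :=
  match fintype.split i with inl j => x j | inr j => eps%:R - x j end.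

Lemma coord_lshift eps x j : coord eps x (lshift n j) = x j.
Proof. by rewrite /coord (unsplitK (inl j : 'I_n + 'I_n)). Qed.

Lemma coord_rshift eps x j : coord eps x (rshift n j) = eps%:R - x j.
Proof. by rewrite /coord (unsplitK (inr j : 'I_n + 'I_n)). Qed.

(** The reference angles [2n - 1 - i] of two antipodal loops add up to the canonical angle of their
    image plus [n - 1], whence the shift of the position; [k] counts turns of the cover. *)
Definition at_coord (eps : bool) (x : 'I_n -> R) D : Prop :=
  deg D = (n + n)%N%:Z /\ exists (m : 'I_(n + n) -> int) (k : int),
  (forall i, ev (th i) D =
     (n + n)%:R - 1 - i%:R + coord eps x i + 2 * (m i)%:~R + k%:~R) /\
  ev (@et R _ C) D = canon_et + (n%:R - 1 + eps%:R) * Lam L + k%:~R * Lam C.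

Lemma at_coord_cls eps x D E : at_coord eps x D ->
  (cls D = cls E <-> at_coord eps x E).
Proof.
move=> [dD [m [k [hm hk]]]]; rewrite (cls_eqP cover_gt0 two_uniform_cover).
split=> [[dE [m' [k' [hm' hk']]]]|[dE [m' [k' [hm' hk']]]]].
  split; first by rewrite -dE.
  exists (fun i => m i - m' i), (k - k'); split=> [i|].
    by have := hm i; rewrite hm' !intrB; lra.
  by move: hk; rewrite hk' intrB; lra.
split; first by rewrite dD dE.
exists (fun i => m i - m' i), (k - k'); split=> [i|].
  by rewrite hm hm' !intrB; ring.
by rewrite hk hk' intrB; ring.
Qed.

Lemma normP D : cls (norm D) = cls (canonical X) <-> exists eps x, at_coord eps x D.
Proof.
rewrite (cls_eqP n0 hU) deg_norm deg_canonical//; split.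
  move=> [dD [m [k [hm hk]]]].
  (* [k + h] counts turns of the base. Beyond the shift [n - 1], two of them make a turn of the
     cover: [q] is the number of these and [eps] the remainder. *)
  pose h := evz half_of D; pose q := ((k + h - n%:Z + 1) %/ 2)%Z.
  pose eps : bool := ((k + h - n%:Z + 1) %% 2)%Z == 1.
  have E : k + h = n%:Z - 1 + eps%:Z + 2 * q.
    rewrite /q /eps; set z := k + h - n%:Z + 1.
    have := divz_eq z 2; have := modz_ge0 z (isT : 2 != 0 :> int).
    have := ltz_pmod z (isT : 0 < 2 :> int).
    rewrite /z; case: eqP => /=; lia.
  pose x j := ev (th (lshift n j)) D - (2 * n%:R - 1 - j%:R) - q%:~R.
  exists eps, x; split=> //.
  (* The first half needs no correction, since [x] is defined by the actual angles there. *)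
  exists (fun i => match fintype.split i with inl _ => 0 | inr j => m j end), q.
  have ER : k%:~R + h%:~R = n%:R - 1 + eps%:R + 2 * q%:~R :> R.
    by rewrite -intrD E !(intrD, intrM, intrB).
  split=> [i|]; last first.
    have := hk; rewrite ev_et_norm -/h Lam_cover -/canon_et => hk'.
    apply: (addIr (- h%:~R * Lam L)); rewrite mulNr hk'.
    have -> : k%:~R = n%:R - 1 + eps%:R + 2 * q%:~R - h%:~R :> R by rewrite -ER; ring.
    by ring.
  rewrite -(splitK i); case: (fintype.split i) => j /=.
    by rewrite coord_lshift (unsplitK (inl j : 'I_n + 'I_n)) /x natrD; ring.
  rewrite coord_rshift (unsplitK (inr j : 'I_n + 'I_n)) /x !natrD.
  have := hm j; rewrite ev_th_norm ev_th_canonical// -/h => hj.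
  have -> : eps%:R = k%:~R + h%:~R - (n%:R - 1) - 2 * q%:~R :> R by rewrite ER; ring.
  by lra.
move=> [eps [x [dD [m [k [hm hk]]]]]]; split=> //.
exists (fun j => m (lshift n j) + m (rshift n j)), (n%:Z - 1 + eps%:Z + 2 * k - evz half_of D).
split=> [j|].
  rewrite ev_th_norm !hm ev_th_canonical// coord_lshift coord_rshift /= !natrD.
  by rewrite !(intrD, intrB, intrM); ring.
by rewrite ev_et_norm hk Lam_cover -/canon_et !(intrD, intrB, intrM); ring.
Qed.

End Norm.

(** * Upper bounds on the rank *)

Section ChipCounting.
Variables (R : realType) (N : nat) (L : loop_of_loops R N).
Hypothesis hU : two_uniform L.
Local Notation Y := (lol_graph L).
Implicit Types (i j : 'I_N) (D E G : divisor Y) (p : point Y).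

(* The loops with index less than [entered p] (resp. [passed p]) are those that
   a path from v_0 to p going around the graph enters (resp. leaves). *)
Definition entered p : nat :=
  match p with
  | inl (inl i) => i
  | inl (inr i) => i.+1
  | inr x => match (val x).1 with inl (i, _) => i.+1 | inr i => (ord_pred i).+1 end
  end.
Definition passed p : nat :=
  match p with
  | inl (inl i) => i
  | inl (inr i) => i.+1
  | inr x => match (val x).1 with inl (i, _) => i | inr i => (ord_pred i).+1 end
  end.

Lemma passed_entered p : (passed p <= entered p <= (passed p).+1)%N.
Proof. by case: p => [[i|i]|[[[[i b]|i] t] /= h]] /=; lia. Qed.

Lemma frac_bounds (t l : R) : 0 < t < l -> 0 < t / l < 1.
Proof.
move=> /andP[t0 tl]; have l0 : 0 < l by lra.
by rewrite divr_gt0//= ltr_pdivrMr// mul1r.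
Qed.

Lemma leq_neq_lt j i : j != i -> (j <= i)%N = (j < i)%N.
Proof. by move=> ji; rewrite [RHS]ltn_neqAle ji. Qed.

Lemma kap_bounds j p : (j < passed p)%N%:R <= kap j p <= (j < entered p)%N%:R.
Proof.
case: p => [[i|i]|[[[[i b]|i] t] /= h]] //=; rewrite ?lexx//; last first.
  by rewrite mul0r addr0 ltnS lexx.
have {}h : 0 < t < ll L i by rewrite -(len_loop hU i b).
have := frac_bounds h; rewrite mulrAC ltnS; case: (eqVneq i j) => [->|ij].
  by rewrite ltnn leqnn mul1r /=; lra.
by rewrite !mul0r addr0 (@leq_neq_lt j i) ?lexx// eq_sym.
Qed.

Lemma rho_bounds j p : (0 < j)%N ->
  (j < entered p)%N%:R <= rho j p <= (j <= passed p)%N%:R.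
Proof.
move=> j0; case: p => [[i|i]|[[[[i b]|i] t] /= h]] //=; rewrite ?j0 /= ?mul0r ?addr0 ?lexx //.
- by rewrite andbT ler_nat; case: (ltngtP j i).
- by rewrite ler_nat; case: (leqP j i) => // /leqW ->.
have {}h : 0 < t < bl L i by [].
have := frac_bounds h; rewrite mulrAC ltnS [((i + N).-1 %% N)%N](ord_predE i).
case: (eqVneq i j) => [->|ij] /=; last first.
  rewrite !mul0r addr0 lexx => _; rewrite ler_nat.
  by move: (if _ then _ else _) => m; case: (leqP j m) => // /leqW ->.
by rewrite gtn_eqF//= prednK// leqnn mul1r [(j <= j.-1)%N]leqNgt ltn_predL j0 /=; lra.
Qed.

Lemma rho0_bounds j p : j = 0%N :> nat ->
  0 <= rho j p <= (N <= passed p)%N%:R.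
Proof.
move=> j0; case: p => [[i|i]|[[[[i b]|i] t] /= h]] //=; rewrite ?j0 /= ?mul0r ?addr0 ?ler0n ?lexx//.
have {}h : 0 < t < bl L i by [].
have := frac_bounds h; rewrite add0r mulrAC [((i + N).-1 %% N)%N](ord_predE i).
case: (eqVneq i j) => [->|_]; rewrite ?j0 /=; last by rewrite !mul0r ler0n lexx.
have N0 := leq_ltn_trans (leq0n i) (ltn_ord i).
by rewrite prednK// leqnn mul1r /=; lra.
Qed.

Lemma th_outside j p : (j < entered p)%N = (j < passed p)%N ->
  th j p = (j < passed p)%N%:R.
Proof.
case: p => [[i|i]|[[[[i b]|i] t] /= h]] //=; last by rewrite mul0r addr0 ltnS.
rewrite ltnS; case: (eqVneq i j) => [->|_]; first by rewrite ltnn leqnn.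
by rewrite !mul0r addr0.
Qed.

Lemma th_inside j p : (j < entered p)%N -> ~~ (j < passed p)%N ->
  0 < `|th j p| < 1.
Proof.
case: p => [[i|i]|[[[[i b]|i] t] /= h]] //=; rewrite ?ltnS => h1; rewrite ?h1// => h2.
have {h1 h2} ij : i = j by apply: val_inj => /=; lia.
subst i; have {}h : 0 < t < ll L j by rewrite -(len_loop hU j b).
have := frac_bounds h; rewrite ltnn add0r eqxx mul1r mulrAC.
have E (x : R) : 0 < x < 1 -> 0 < `|x| < 1 by move=> /andP[x0 x1]; rewrite gtr0_norm// x0.
by case: b => /E; rewrite ?mul1r ?mulN1r ?mulNr ?normrN.
Qed.

(** A chip at [v_k] has not entered the loop and one at [w_k] has left it, so that
    [chips_in - chips_out] counts the chips in the interior of the two edges. *)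
Definition chips_in (k : nat) D : int := evz (fun p => (k < entered p)%N%:Z) D.
Definition chips_out (k : nat) D : int := evz (fun p => (k < passed p)%N%:Z) D.

Let inside j p : int := (j < entered p)%N%:Z - (j < passed p)%N%:Z.

Let inside01 j p : inside j p = 0 \/ inside j p = 1.
Proof.
rewrite /inside; have := passed_entered p.
case: (ltnP j (passed p)) => h1; case: (ltnP j (entered p)) => h2 h; try lia;
  by [left|right].
Qed.

Let chips_inside j D :
  chips_in j D - chips_out j D = \sum_(p <- dom D) coeff p D * inside j p.
Proof. by rewrite -sumrB; apply: eq_bigr => p _; rewrite mulrBr. Qed.

Let inside_ge0 j D p : effective D -> 0 <= coeff p D * inside j p.
Proof. by move=> D0; apply: mulr_ge0; [exact: D0|case: (inside01 j p) => ->]. Qed.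

Let th_inside0 j p : inside j p = 0 -> th j p = (j < passed p)%N%:R.
Proof.
move=> h; apply: th_outside; move: h; rewrite /inside => /eqP; rewrite subr_eq0.
by case: (j < entered p)%N; case: (j < passed p)%N.
Qed.

Lemma chips_out_le_in j D : effective D -> chips_out j D <= chips_in j D.
Proof.
move=> D0; rewrite -subr_ge0 chips_inside; apply: sumr_ge0 => p _.
exact: inside_ge0.
Qed.

Lemma ev_th_pure j D : effective D -> chips_in j D = chips_out j D ->
  ev (th j) D = (chips_out j D)%:~R :> R.
Proof.
move=> D0 /eqP; rewrite -subr_eq0 chips_inside psumr_eq0 => [/allP h|p _]; last exact: inside_ge0.
rewrite evzE; apply: ev_eq => p pD; rewrite th_inside0 ?pmulrn//.
by have := h p pD; rewrite mulf_eq0 -[coeff p D == 0]negbK -mem_dom pD => /eqP.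
Qed.

(** The interior chip has an angle of absolute value strictly between 0 and 1, and all other chips
    contribute integers. Two interior chips could compensate each other. *)
Lemma ev_th_single j D (z : int) : effective D ->
  chips_in j D = chips_out j D + 1 -> ev (th j) D <> z%:~R :> R.
Proof.
move=> D0 h ez.
have e1 : \sum_(p <- dom D) coeff p D * inside j p = 1 by rewrite -chips_inside h; lia.
have [p pD ip] : exists2 p, p \in dom D & inside j p = 1.
  have [/hasP[p pD /eqP ip]|/hasPn nh] := boolP (has (fun p => inside j p == 1) (dom D)).
    by exists p.
  move: e1; rewrite big1_seq// => p /= pD; have := nh p pD.
  by case: (inside01 j p) => -> //; rewrite mulr0.
have cp : 0 < coeff p D by rewrite lt_neqAle eq_sym -mem_dom pD D0.
have ge0 : 0 <= \sum_(q <- dom D | q != p) coeff q D * inside j q.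
  by apply: sumr_ge0 => q _; exact: inside_ge0.
move: e1; rewrite (bigD1_seq p) ?uniq_dom//= ip mulr1 => e1.
have [{}cp {}e1] : coeff p D = 1 /\
    \sum_(q <- dom D | q != p) coeff q D * inside j q = 0.
  by move: e1 cp ge0; move: (\sum_(_ <- _ | _) _) (coeff p D) => S c; lia.
move/eqP: e1.
rewrite psumr_eq0 => [/allP r0|q _]; last exact: inside_ge0.
have : ev (th j) D - (chips_out j D)%:~R = th j p.
  rewrite evzE -evfB /ev (bigD1_seq p) ?uniq_dom//= big1_seq ?addr0 => [|q /andP[qp qD]].
    rewrite cp mul1r; move: ip; rewrite /inside.
    by case: (j < passed p)%N; case: (j < entered p)%N => //= _; rewrite subr0.
  have := r0 q qD; rewrite qp /= mulf_eq0 -[coeff q D == 0]negbK -mem_dom qD => /eqP /th_inside0 ->.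
  by rewrite pmulrn subrr mulr0.
rewrite ez -intrB => e.
have /andP[] : 0 < `|th j p| < 1.
  apply: th_inside; move: ip; rewrite /inside;
  by case: (j < passed p)%N; case: (j < entered p)%N.
rewrite -e -intr_norm ltr0z -[1 : R]/(1%:~R) ltr_int => h0.
by rewrite -[1]add0r ltzD1 leNgt h0.
Qed.

Lemma coeff_evz (p : point Y) D : coeff p D = evz (fun q => (q == p)%:Z) D.
Proof.
have [pD|pD] := boolP (p \in dom D).
  rewrite /evz (bigD1_seq p) ?uniq_dom//= eqxx mulr1 big1 ?addr0// => q /negbTE ->.
  by rewrite mulr0.
rewrite (coeff_outdom pD) /evz big1_seq// => q /= qD.
by case: eqP => [e|_]; [rewrite -e qD in pD|rewrite mulr0].
Qed.

Lemma evz_le (f g h : point Y -> int) D : effective D ->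
  (forall p, f p + g p <= h p) -> evz f D + evz g D <= evz h D.
Proof.
move=> D0 fgh; rewrite -big_split; apply: ler_sum => p _ /=.
by rewrite -mulrDr ler_wpM2l.
Qed.

(** A chip at [v_j] has left the loop [i] without entering the loop [j]: this is how the chips of a
    test divisor push the level down. *)
Lemma chips_gap i j D : effective D -> j = i.+1 :> nat ->
  chips_in j D + coeff (inl (inl j)) D <= chips_out i D.
Proof.
move=> D0 ji; rewrite coeff_evz; apply: evz_le => // p.
have := passed_entered p; case: (eqVneq p (inl (inl j))) => [->|_] /=.
  by rewrite ltnn ji ltnSn.
by rewrite addr0 ji => h; rewrite lez_nat; case: (ltnP i.+1 (entered p)) => // ip;
  case: (ltnP i (passed p)) => //; lia.
Qed.

Lemma chips_close j D : effective D -> j = 0%N :> nat ->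
  chips_in j D + coeff (inl (inl j)) D <= deg D.
Proof.
move=> D0 j0; have -> : deg D = evz (fun=> 1) D.
  by apply: (@intr_inj R); rewrite -ev_deg evzE.
rewrite coeff_evz; apply: evz_le => // p.
case: (eqVneq p (inl (inl j))) => [->|_] /=; first by rewrite ltnn.
by rewrite addr0; case: (_ < _)%N.
Qed.

Lemma ev_kap_bounds j D : effective D ->
  (chips_out j D)%:~R <= ev (kap j) D <= (chips_in j D)%:~R.
Proof.
move=> D0; rewrite !evzE; apply/andP; split; apply: ev_le => // p;
by have /andP[] := kap_bounds j p; rewrite -!pmulrn.
Qed.

Lemma ev_rho_bounds i j D : effective D -> j = i.+1 :> nat ->
  (chips_in j D)%:~R <= ev (rho j) D <= (chips_out i D)%:~R.
Proof.
move=> D0 ji; have j0 : (0 < j)%N by rewrite ji.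
rewrite !evzE; apply/andP; split; apply: ev_le => // p;
by have /andP[] := rho_bounds p j0; rewrite -!pmulrn ?ji.
Qed.

Lemma ev_rho0_bounds i j D : effective D -> j = 0%N :> nat -> i.+1 = N ->
  0 <= ev (rho j) D <= (chips_out i D)%:~R.
Proof.
move=> D0 j0 iN; rewrite evzE; apply/andP; split.
  by apply: sumr_ge0 => p _; apply: mulr_ge0; [rewrite ler0z|have /andP[] := rho0_bounds p j0].
by apply: ev_le => // p; have /andP[] := rho0_bounds p j0; rewrite -!pmulrn iN.
Qed.

End ChipCounting.

(** * Propagation of levels around the cycle of loops *)

Section Levels.
Variables (N : nat) (em ep ch par : 'I_N -> int) (I : 'I_N -> Prop).
Variables (s : nat -> int) (e0 : int) (N0 : (0 < N)%N).

(* The two-sided bound propagates the level [e0] around the cycle, upwards from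
   the first loop and downwards from the last one. *)
Lemma level_bounds (last : 'I_N) : last.+1 = N -> s 0%N = 0 -> s N = 0 ->
  (forall i, ep i <= em i \/ I i /\ ep i = em i + 1 /\ exists q, ep i = par i + 2 * q) ->
  (forall i, I i -> ep i <= em i - 1 \/ ep i = em i + 1) ->
  (forall i j : 'I_N, j = i.+1 :> nat -> em j + ch j <= ep i) ->
  (forall j : 'I_N, j = 0%N :> nat -> em j + ch j <= ep last) ->
  (forall i, 0 <= ch i) ->
  (forall i : 'I_N, s i.+1 = s i \/ I i /\ (s i.+1 = s i + 1 \/ s i.+1 = s i - 1 /\ 1 <= ch i)) ->
  (forall i : 'I_N, I i -> exists q, par i = e0 + s i.+1 + 2 * q) ->
  ep last <= e0 <= ep last + 1 ->
  forall i : 'I_N, [/\ e0 + s i.+1 - 1 <= em i <= e0 + s i.+1 &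
    e0 + s i.+1 - 1 <= ep i <= e0 + s i.+1].
Proof.
move=> lastN s0 sN hloop hI hgap hclose hch hs hpar /andP[he1 he2].
(* Exceeding the bound would need an ascent starting from it, hence an integral coordinate, and the
   exit level would have the wrong parity by [hpar]. A downward step of [s] is paid for by the chip
   [ch i]. *)
have up (i : 'I_N) : em i + ch i <= e0 + s i -> em i <= e0 + s i.+1 /\ ep i <= e0 + s i.+1.
  move=> h; have := hch i; have := hs i.
  case: (hloop i) => [le|[Ii [e [q eq]]]].
    move=> [st|[Ii [st|[st c1]]]] c0; [split; lia|split; lia|].
    by case: (hI i Ii) => ?; split; lia.
  have [q' eq'] := hpar i Ii.
  by move=> [st|[_ [st|[st c1]]]] c0; split; lia.
have down (i : 'I_N) : e0 + s i.+1 - 1 <= ep i ->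
    e0 + s i.+1 - 1 <= em i /\ e0 + s i - 1 <= em i + ch i.
  move=> h; have := hch i; have := hs i.
  case: (hloop i) => [le|[Ii [e [q eq]]]].
    move=> [st|[Ii [st|[st c1]]]] c0; [split; lia| |split; lia].
    by split; lia.
  have [q' eq'] := hpar i Ii.
  by move=> [st|[_ [st|[st c1]]]] c0; split; lia.
have U k (kN : (k < N)%N) : em (Ordinal kN) <= e0 + s k.+1 /\ ep (Ordinal kN) <= e0 + s k.+1.
  elim: k kN => [|k IH] kN; apply: (up (Ordinal kN)) => /=.
    by have := hclose (Ordinal kN) erefl; rewrite s0; lia.
  have [_ h] := IH (ltnW kN); have := hgap (Ordinal (ltnW kN)) (Ordinal kN) erefl.
  by lia.
(* Here [k] is the distance to the last loop, where the bound is the hypothesis on [e0]. *)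
have W k : forall i : 'I_N, (i + k).+1 = N -> e0 + s i.+1 - 1 <= ep i.
  elim: k => [|k IH] i ik.
    have -> : i = last by apply: ord_inj; lia.
    by rewrite lastN sN; lia.
  have iN : (i.+1 < N)%N by lia.
  have hi : ((Ordinal iN : 'I_N) + k).+1 = N by rewrite /= addSnnS.
  have [_ h] := down _ (IH (Ordinal iN) hi).
  by have := hgap i (Ordinal iN) erefl; move: h => /=; lia.
move=> i; have hi : (i + (N - i.+1)).+1 = N by have := ltn_ord i; lia.
have w := W _ i hi; have [d _] := down i w.
have [] := U i (ltn_ord i); rewrite (_ : Ordinal _ = i); last exact: ord_inj.
by move=> u1 u2; split; apply/andP; split.
Qed.

End Levels.

Section ForcedLevels.
Variables (R : realType) (n : nat) (L : loop_of_loops R n).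
Hypothesis n0 : (0 < n)%N.
Hypothesis hU : two_uniform L.
Local Notation C := (antipodal_cover L).
Local Notation Y := (lol_graph (antipodal_cover L)).
Implicit Types (j : 'I_n) (i : 'I_(n + n)).
Variables (eps : bool) (x : 'I_n -> R) (G : divisor Y).
Variables (m : 'I_(n + n) -> int) (k : int).
Hypothesis G0 : effective G.
Hypothesis degG : deg G = (n + n)%N%:Z.
Hypothesis thG : forall i, ev (th i) G =
  (n + n)%:R - 1 - i%:R + coord eps x i + 2 * (m i)%:~R + k%:~R.

(* Number of chips beyond a point minus the number of loops beyond it, just
   before and just after the [i]th loop. *)
Definition level_in (D : divisor Y) i : int := chips_in i D - (n + n)%N%:Z + i%:Z.
Definition level_out (D : divisor Y) i : int := chips_out i D - (n + n)%N%:Z + 1 + i%:Z.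

Let hUC : two_uniform C := two_uniform_cover hU.
Let par i : int := Num.floor (coord eps x i) + k.
Let I i : Prop := coord eps x i \is a Num.int.

Let th_level i : ev (th i) G =
  ((n + n)%N%:Z - 1 - i%:Z + 2 * m i + k)%:~R + coord eps x i.
Proof. by rewrite thG !(intrD, intrB, intrM); ring. Qed.

Let level_pure i : level_out G i = level_in G i + 1 -> I i /\ exists q, level_out G i = par i + 2 * q.
Proof.
rewrite /level_out /level_in => h; have e : chips_in i G = chips_out i G by lia.
have := ev_th_pure G0 e; rewrite th_level => e2.
have e3 : coord eps x i = (chips_out i G - ((n + n)%N%:Z - 1 - i%:Z + 2 * m i + k))%:~R.
  by rewrite intrB -e2; ring.
split; first by rewrite /I e3 rpred_int.
exists (m i); rewrite /par e3 intrKfloor; lia.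
Qed.

Lemma level_step i : level_out G i <= level_in G i + 1.
Proof. by have := chips_out_le_in i G0; rewrite /level_out /level_in; lia. Qed.

(** The level can only be preserved by exactly one chip in the interior, and this makes the angle
    nonintegral. *)
Lemma level_step_int i : I i ->
  level_out G i <= level_in G i - 1 \/ level_out G i = level_in G i + 1.
Proof.
move=> Ii; have := level_step i; rewrite le_eqVlt => /orP[/eqP|]; first by right.
rewrite ltzD1 le_eqVlt => /orP[/eqP h|]; last by left; lia.
have e : chips_in i G = chips_out i G + 1 by move: h; rewrite /level_out /level_in; lia.
move: Ii; rewrite /I => /intrP[z ez].
case: (@ev_th_single _ _ _ hUC i G ((n + n)%N%:Z - 1 - i%:Z + 2 * m i + k + z) G0 e).
by rewrite th_level ez -intrD.
Qed.

Lemma levels (s : nat -> int) (e0 : int) (last : 'I_(n + n)) : last.+1 = (n + n)%N ->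
  s 0%N = 0 -> s (n + n)%N = 0 ->
  (forall i, s i.+1 = s i \/ coord eps x i \is a Num.int /\
    (s i.+1 = s i + 1 \/ s i.+1 = s i - 1 /\ 1 <= coeff (inl (inl i)) G)) ->
  (forall i, coord eps x i \is a Num.int ->
    exists q, Num.floor (coord eps x i) + k = e0 + s i.+1 + 2 * q) ->
  level_out G last <= e0 <= level_out G last + 1 ->
  forall i, [/\ e0 + s i.+1 - 1 <= level_in G i <= e0 + s i.+1 &
    e0 + s i.+1 - 1 <= level_out G i <= e0 + s i.+1].
Proof.
move=> hl s0 sN hs hp he.
apply: (@level_bounds _ (level_in G) (level_out G) (fun i => coeff (inl (inl i)) G)
  par I s e0 (cover_gt0 n0) last) => //.
- move=> i; have := level_step i; rewrite le_eqVlt => /orP[/eqP h|]; last by left; lia.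
  by right; have [] := level_pure h.
- exact: level_step_int.
- move=> i j ij; have := chips_gap G0 ij; rewrite /level_in /level_out ij; lia.
- move=> j j0; have := chips_close G0 j0; rewrite degG /level_in /level_out j0.
  have : 0 <= chips_out last G.
    by apply: sumr_ge0 => p _; rewrite mulr_ge0// G0.
  by move: hl; lia.
Qed.

Hypothesis etG : ev (@et R _ C) G =
  canon_et L + (n%:R - 1 + eps%:R) * Lam L + k%:~R * Lam C.

(** Weighting the windows of [levels] by the lengths computes the position, which [etG] prescribes.
    The two results differ by [d] turns of the base, where [d] is even and of absolute value less
    than 2. *)
Lemma forced_level (s : nat -> int) (e0 S t : int) (last : 'I_(n + n)) :
  last.+1 = (n + n)%N -> s 0%N = 0 -> S = eps%:Z + 2 * t ->
  (forall d, (d <= n)%N -> s (n + d)%N = S - s d) ->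
  (forall i, s i.+1 = s i \/ coord eps x i \is a Num.int /\
    (s i.+1 = s i + 1 \/ s i.+1 = s i - 1 /\ 1 <= coeff (inl (inl i)) G)) ->
  (forall i, coord eps x i \is a Num.int ->
    exists q, Num.floor (coord eps x i) + k = e0 + s i.+1 + 2 * q) ->
  level_out G last <= e0 <= level_out G last + 1 ->
  S + 2 * e0 = eps%:Z + 2 * k.
Proof.
move=> hl s0 St hS hs hp he.
have sn : s n = S by have := hS 0%N isT; rewrite addn0 s0 subr0.
have sN : s (n + n)%N = 0 by rewrite hS// sn subrr.
have lev := levels hl s0 sN hs hp he.
have K i : ((n + n)%N%:Z - 1 - i%:Z + e0 + s i.+1 - 1)%:~R <= ev (kap i) G
    <= ((n + n)%N%:Z - i%:Z + e0 + s i.+1)%:~R.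
  have /andP[k1 k2] := ev_kap_bounds hUC i G0.
  have [/andP[l1 l2] /andP[l3 l4]] := lev i.
  apply/andP; split; [apply: le_trans k1|apply: (le_trans k2)]; rewrite ler_int;
  by move: l1 l2 l3 l4; rewrite /level_in /level_out; lia.
(* Number of loops beyond the bridge; the bridge into [v_0] comes at the end of the turn, with no
   loop beyond it. *)
pose base i : int := if i == 0%N :> nat then 0 else (n + n)%N%:Z - i%:Z.
have P i : (base i + e0 + s i.+1 - 1)%:~R <= ev (rho i) G <= (base i + e0 + s i)%:~R.
  have [/andP[l1 l2] /andP[l3 l4]] := lev i; rewrite /base.
  have [i0|i0] := eqVneq (i : nat) 0%N.
    have /andP[k1 k2] := ev_rho0_bounds G0 i0 hl.
    apply/andP; split; [apply: le_trans k1; rewrite lerz0|apply: (le_trans k2); rewrite ler_int].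
      have cin : chips_in i G <= (n + n)%N%:Z.
        by rewrite -degG (le_trans _ (chips_close G0 i0))// lerDl; exact: G0.
      by move: l1 cin; rewrite /level_in i0; lia.
    by have [_ /andP[]] := lev last; rewrite hl sN i0 s0 /level_out; lia.
  have im : (i.-1 < n + n)%N by rewrite (leq_ltn_trans (leq_pred _) (ltn_ord i)).
  have e : i = (Ordinal im).+1 :> nat by rewrite /= prednK// lt0n.
  have /andP[k1 k2] := ev_rho_bounds G0 e.
  apply/andP; split; [apply: le_trans k1|apply: (le_trans k2)]; rewrite ler_int.
    by move: l1; rewrite /level_in; lia.
  have [_ /andP[_]] := lev (Ordinal im); rewrite -e /level_out /=.
  by move: i0 => /eqP; lia.
have := etG; rewrite evfD !evf_sum.
under eq_bigr do rewrite evfZ.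
under [X in _ + X]eq_bigr do rewrite evfZ.
rewrite !big_split_ord /=.
have ecan : canon_et L = \sum_j ll L j * (2 * (n%:R - 1 - j%:R) + 1) +
    \sum_j 2 * bl L j * (if j == 0%N :> nat then 0 else 2 * (n%:R - j%:R)).
  rewrite /canon_et evfD !evf_sum; congr (_ + _); apply: eq_bigr => j _; rewrite evfZ.
    by rewrite ev_kap_canonical.
  by case: eqP => [j0|/eqP j0]; [rewrite ev_rho_canonical0|rewrite ev_rho_canonical// lt0n].
rewrite ecan Lam_cover => e.
pose sg : R := (2 * e0 + S)%:~R.
have KS j : 2 * (n%:R - 1 - j%:R) + 1 + (n%:R - 1) + sg - 2 <=
    ev (kap (lshift n j)) G + ev (kap (rshift n j)) G <=
    2 * (n%:R - 1 - j%:R) + 1 + (n%:R - 1) + sg + 2.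
  have /andP[l1 l2] := K (lshift n j); have /andP[r1 r2] := K (rshift n j).
  have hr : s (n + j.+1)%N = S - s j.+1 by rewrite hS.
  move: l1 l2 r1 r2; rewrite /= -[(n + j).+1]addnS hr /sg.
  by rewrite !(intrD, intrB, intrM) -!pmulrn !natrD; lra.
(* The window of a single bridge has width [1 + s i - s i.+1]; these differences cancel on antipodal
   bridges, which leaves an error of 1, against 2 on the loops. *)
have PS j : (if j == 0%N :> nat then 0 else 2 * (n%:R - j%:R)) + (n%:R - 1) + sg - 1 <=
    ev (rho (lshift n j)) G + ev (rho (rshift n j)) G <=
    (if j == 0%N :> nat then 0 else 2 * (n%:R - j%:R)) + (n%:R - 1) + sg + 1.
  have /andP[l1 l2] := P (lshift n j); have /andP[r1 r2] := P (rshift n j).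
  have hr : s (n + j.+1)%N = S - s j.+1 by rewrite hS.
  have hr' : s (n + j)%N = S - s j by rewrite hS// ltnW.
  move: l1 l2 r1 r2; rewrite /base /= -[(n + j).+1]addnS hr hr' /sg addn_eq0 (gtn_eqF n0) /=.
  by case: eqP => [->|_]; rewrite !(intrD, intrB, intrM) -!pmulrn !natrD; lra.
pose d : int := eps%:Z + 2 * k - 2 * e0 - S.
have dl : d%:~R = eps%:R + 2 * k%:~R - sg by rewrite /sg !(intrD, intrB, intrM); ring.
have bl0 : 0 < \sum_j 2 * bl L j.
  rewrite (bigD1 (Ordinal n0))//= ltr_pwDl ?mulr_gt0 ?bl_gt0//.
  by apply: sumr_ge0 => j _; rewrite mulr_ge0// ltW ?bl_gt0.
have El : \sum_j ll C (lshift n j) * ev (kap (lshift n j)) G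
    + \sum_j ll C (rshift n j) * ev (kap (rshift n j)) G =
  \sum_j ll L j * (ev (kap (lshift n j)) G + ev (kap (rshift n j)) G).
  rewrite -big_split; apply: eq_bigr => j _ /=.
  by rewrite !ll_cover reduce_lshift reduce_rshift mulrDr.
have Eb : \sum_j 2 * bl C (lshift n j) * ev (rho (lshift n j)) G
    + \sum_j 2 * bl C (rshift n j) * ev (rho (rshift n j)) G =
  \sum_j 2 * bl L j * (ev (rho (lshift n j)) G + ev (rho (rshift n j)) G).
  rewrite -big_split; apply: eq_bigr => j _ /=.
  by rewrite !bl_cover reduce_lshift reduce_rshift mulrDr.
have wsum (w K' b : 'I_n -> R) (c : R) : \sum_j w j * (K' j - (b j + c)) =
    \sum_j w j * K' j - \sum_j w j * b j - (\sum_j w j) * c.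
  by rewrite mulr_suml -!sumrB; apply: eq_bigr => j _; ring.
have dLam : d%:~R * Lam L =
    \sum_j ll L j * (ev (kap (lshift n j)) G + ev (kap (rshift n j)) G
       - (2 * (n%:R - 1 - j%:R) + 1 + (n%:R - 1 + sg))) +
    \sum_j 2 * bl L j * (ev (rho (lshift n j)) G + ev (rho (rshift n j)) G
       - ((if j == 0%N :> nat then 0 else 2 * (n%:R - j%:R)) + (n%:R - 1 + sg))).
  rewrite El Eb in e; rewrite (wsum (ll L)) (wsum (fun j => 2 * bl L j)) dl.
  move/(canRL (addrK _)): e => ->.
  by rewrite /Lam; ring.
have ub : d%:~R * Lam L <= 2 * (\sum_j ll L j) + \sum_j 2 * bl L j.
  rewrite dLam mulr_sumr lerD//; apply: ler_sum => j _.
    by rewrite mulrC ler_pM2r ?ll_gt0//; have /andP[_] := KS j; lra.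
  by rewrite -[leRHS]mulr1 ler_pM2l ?mulr_gt0 ?bl_gt0//; have /andP[_] := PS j; lra.
have lb : - (2 * (\sum_j ll L j) + \sum_j 2 * bl L j) <= d%:~R * Lam L.
  rewrite dLam mulr_sumr opprD -!sumrN lerD//; apply: ler_sum => j _.
    by rewrite mulrC -mulrN ler_pM2l ?ll_gt0//; have /andP[+ _] := KS j; lra.
  by rewrite -[X in - X]mulr1 -mulrN ler_pM2l ?mulr_gt0 ?bl_gt0//; have /andP[+ _] := PS j; lra.
have Lam0 : 0 < Lam L.
  by rewrite /Lam ltr_wpDl// sumr_ge0// => j _; rewrite ltW ?ll_gt0.
(* Strict because the bridges, of positive total length by [bl0], contribute only half of the
   allowed error. *)
have d2 : d < 2.
  rewrite -(ltr_int R) -(ltr_pM2r Lam0) (le_lt_trans ub)// /Lam mulrDr ltrD2l.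
  by rewrite ltr_pMl// ltr1n.
have d2' : - 2 < d.
  rewrite -(ltr_int R) -(ltr_pM2r Lam0) (lt_le_trans _ lb)// /Lam intrN mulNr ltrN2.
  by rewrite mulrDr ltrD2l ltr_pMl// ltr1n.
by move: d2 d2' St; rewrite /d; lia.
Qed.

End ForcedLevels.

Section RankBasics.
Variables (R : realType) (G : metric_graph R).
Implicit Types D E F : divisor G.

Lemma effectiveD D E : effective D -> effective E -> effective (D + E).
Proof. by move=> hD hE p; rewrite coeffD addr_ge0. Qed.

Lemma effective_point (k : int) (p : point G) : 0 <= k -> effective << k *g p >>.
Proof. by move=> k0 q; rewrite coeffU mulr_ge0// ler0z. Qed.

Lemma effective_sum (I : Type) (r : seq I) (P : pred I) (F : I -> divisor G) :
  (forall i, P i -> effective (F i)) -> effective (\sum_(i <- r | P i) F i).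
Proof.
move=> h; apply: (@big_ind _ (@effective R G)); last exact: h.
  by move=> p; rewrite coeff0.
by move=> D E; exact: effectiveD.
Qed.

Lemma clsB_eq D E F : cls (D - E) = cls F <-> cls D = cls (E + F).
Proof. by rewrite !clsP opprD addrA. Qed.

Lemma rank_ge_le D (r s : nat) (p : point G) : (r <= s)%N -> rank_ge D s -> rank_ge D r.
Proof.
move=> rs hs E E0 dE; pose Z := << (s - r)%N%:Z *g p >> : divisor G.
have Z0 : effective Z by exact: effective_point.
have [||F F0 /clsB_eq hF] := hs (E + Z); first exact: effectiveD.
  by rewrite degD dE degU; lia.
exists (Z + F); first exact: effectiveD.
by apply/clsB_eq; rewrite hF addrA.
Qed.

Lemma rank_geP D (r : nat) : rank_ge D r <-> forall E, effective E -> deg E = r%:Z ->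
  exists2 F, effective F & cls D = cls (E + F).
Proof.
by split=> h E E0 dE; have [F F0 hF] := h E E0 dE; exists F => //; apply/clsB_eq.
Qed.

Lemma rk_eq D (r : nat) : rank_ge D r -> (forall s, rank_ge D s -> (s <= r)%N) -> rk D = r%:Z.
Proof.
move=> hr hm; rewrite /rk; case: xgetP => [k _ [s [-> hs hms]]|/(_ r%:Z)]; last first.
  by case; exists r.
by congr (_%:Z); apply/eqP; rewrite eqn_leq hm// hms.
Qed.

Lemma rkP D : 0 <= rk D -> exists r : nat,
  [/\ rk D = r%:Z, rank_ge D r & forall s, rank_ge D s -> (s <= r)%N].
Proof. by rewrite /rk; case: xgetP => [k _|]. Qed.

End RankBasics.

Section LoopPoints.
Variables (R : realType) (N : nat) (L : loop_of_loops R N).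
Hypothesis hU : two_uniform L.
Local Notation Y := (lol_graph L).

Lemma loop_point (i : 'I_N) (b : bool) (t : R) : 0 < t < 1 ->
  exists p : point Y, [/\ entered p = i.+1, passed p = i,
    forall j, th j p = (j < i)%N%:R + (i == j)%:R * (if b then t else - t),
    forall j, kap j p = (j < i)%N%:R + (i == j)%:R * t &
    forall j, rho j p = (0 < j <= i)%N%:R].
Proof.
move=> t01; have h : 0 < t * ll L i < (len (inl (i, b) : edge Y))%:num.
  rewrite len_loop// mulr_gt0 ?ll_gt0//=; first by rewrite gtr_pMl ?ll_gt0; lra.
  by lra.
have ln : ll L i != 0 by rewrite gt_eqF ?ll_gt0.
exists (inr (exist (fun x : edge Y * R => 0 < x.2 < (len x.1)%:num)
  (inl (i, b), t * ll L i) h)); split=> //= j.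
- case: (eqVneq i j) => [<-|_]; last by rewrite !mul0r.
  by case: b {h}; congr (_ + _); field.
- case: (eqVneq i j) => [<-|_]; last by rewrite !mul0r.
  by congr (_ + _); field.
- by rewrite mul0r addr0.
Qed.

End LoopPoints.

Definition oddz (z : int) : bool := odd `|z|%N.

Lemma oddzP z : exists q, z = (oddz z)%:Z + 2 * q.
Proof.
rewrite /oddz; case: z => m /=; last first.
  exists (- (m.+1./2)%:Z - (odd m.+1)%:Z); have := odd_double_half m.+1.
  by rewrite -muln2 NegzE /=; lia.
by exists (m./2)%:Z; have := odd_double_half m; rewrite -muln2; lia.
Qed.

Lemma even_step (lo c : int) : exists e0 t0, lo <= e0 <= lo + 1 /\ e0 = c + 2 * t0.
Proof.
have [q e] := oddzP (lo - c); exists (lo + (oddz (lo - c))%:Z), (q + (oddz (lo - c))%:Z).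
by split; case: (oddz _) e; lia.
Qed.

Definition changes (y : nat -> bool) (k : nat) : nat := (\sum_(0 <= l < k) (y l.+1 != y l))%N.

Lemma changesS y k : changes y k.+1 = (changes y k + (y k.+1 != y k))%N.
Proof. by rewrite /changes big_nat_recr. Qed.

Lemma changes_odd y k : y k = y 0%N (+) odd (changes y k).
Proof.
elim: k => [|k IH]; first by rewrite /changes big_nil addbF.
by rewrite changesS oddD addbA -IH; case: (y k.+1); case: (y k).
Qed.

(** * The upper bound given by the changes of parity *)

Section UpperBound.
Variables (R : realType) (n : nat) (L : loop_of_loops R n).
Hypothesis n0 : (0 < n)%N.
Hypothesis hU : two_uniform L.
Local Notation C := (antipodal_cover L).
Local Notation Y := (lol_graph (antipodal_cover L)).
Implicit Types (j : 'I_n) (i : 'I_(n + n)) (D : divisor Y).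

(* The parities of the integral coordinates, extended to all the loops by
   repeating the last integral one. *)
Definition filling (eps : bool) (x : 'I_n -> R) (y : nat -> bool) : Prop :=
  [/\ forall j, x j \is a Num.int -> y j.+1 = oddz (Num.floor (x j)),
      forall j, x j \isn't a Num.int -> y j.+1 = y j & y n = y 0%N (+) eps].

(** Past an integral coordinate the filling forgets its starting value: a run from [false] gives the
    value at [n], and a second run started at that value plus [eps] closes up. *)
Lemma filling_exists eps x j0 : x j0 \is a Num.int -> exists y, filling eps x y.
Proof.
move=> x0; pose y := fix y (b : bool) (k : nat) : bool := if k is l.+1 then
  (if insub l is Some j then if x j \is a Num.int then oddz (Num.floor (x j)) else y b l
   else y b l) else b.
have yS b j : y b j.+1 = if x j \is a Num.int then oddz (Num.floor (x j)) else y b j.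
  by rewrite /= valK.
have yb b b' k : (j0 < k)%N -> (k <= n)%N -> y b k = y b' k.
  elim: k => // k IH; rewrite ltnS leq_eqVlt => /orP[/eqP <-|jk] kn.
    by rewrite !(yS _ j0) x0.
  have := yS b (Ordinal kn); have := yS b' (Ordinal kn) => /= -> ->.
  by rewrite IH// ltnW.
exists (y (y false n (+) eps)); split=> [j xj|j /negbTE xj|].
- by rewrite yS xj.
- by rewrite yS xj.
- by rewrite (yb _ false) ?ltn_ord// addbK.
Qed.

Lemma coord_int eps (x : 'I_n -> R) i : coord eps x i \is a Num.int =
  (x (reduce_idx i) \is a Num.int).
Proof.
rewrite -(splitK i); case: (fintype.split i) => j /=.
  by rewrite coord_lshift reduce_lshift.
by rewrite coord_rshift reduce_rshift rpredBl// natr_int.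
Qed.

Lemma floor_coord_rshift eps (x : 'I_n -> R) j : x j \is a Num.int ->
  Num.floor (coord eps x (rshift n j)) = eps%:Z - Num.floor (x j).
Proof.
by move=> /intrP[z e]; rewrite coord_rshift e pmulrn -intrB !intrKfloor.
Qed.

Lemma last_index : exists l : 'I_(n + n), l.+1 = (n + n)%N.
Proof.
have h : ((n + n).-1 < n + n)%N by rewrite prednK// addn_gt0 n0.
by exists (Ordinal h); rewrite /= prednK// addn_gt0 n0.
Qed.

(** The test divisor makes the level step down at each change on one sheet and up on the other.
    [forced_level] then gives the congruence [S + 2 * y 0 = eps] modulo 4, where [S] is the total
    step over the first half; the signs of the steps are chosen to violate it. *)
Lemma not_rank_ge_changes eps x D y : at_coord eps x D -> filling eps x y ->
  (changes y n = 0%N -> y 0%N) -> ~ rank_ge D (changes y n).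
Proof.
move=> hD [y1 y2 y3] ya /rank_geP hr; set a := changes y n in hr ya.
have pa : eps = odd a.
  by have := changes_odd y n; rewrite y3 -/a => /addbI.
(* [z] tells whether stepping down at all changes of the first half would satisfy the congruence; if
   so, the first step is reversed, which moves [S] by 2. *)
pose z : bool := ((- a%:Z - eps%:Z + 2 * (y 0%N)%:Z) %% 4)%Z == 0.
pose s0 (k : nat) : int := - (changes y k)%:Z + (if z && (0 < changes y k)%N then 2 else 0).
pose S := s0 n.
pose s (d : nat) : int := if (d <= n)%N then s0 d else S - s0 (d - n)%N.
have s00 : s0 0%N = 0 by rewrite /s0 /changes big_nil andbF.
have sl k : (k <= n)%N -> s k = s0 k by rewrite /s => ->.
have sr k : s (n + k)%N = S - s0 k.
  by rewrite /s; case: k => [|k]; rewrite ?addn0 ?leqnn ?s00 ?subr0//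
    leqNgt addnS ltnS leq_addr /= -addnS addKn.
have s0step k : y k.+1 = y k -> s0 k.+1 = s0 k.
  by move=> e; rewrite /s0 changesS e eqxx addn0.
have s0step' k : y k.+1 != y k -> s0 k.+1 = s0 k + 1 \/ s0 k.+1 = s0 k - 1.
  move=> e; rewrite /s0 changesS e addn1 /=; case: (boolP z) => _ /=; case: (changes y k) => [|c] /=; lia.
have s0par k : exists q, (y k)%:Z = (y 0%N)%:Z + s0 k + 2 * q.
  rewrite (changes_odd y k) /s0; have [q] := oddzP (changes y k).
  rewrite /oddz /= => e; case: (y 0%N); case: (odd _) e => e; case: (z && _);
  by [exists q; lia|exists (q - 1); lia|exists (q+1); lia|exists (q+2); lia].
have [t St] : exists t, S = eps%:Z + 2 * t.
  have [q] := oddzP a; rewrite /oddz /= -pa => e; rewrite /S /s0 -/a.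
  by case: (z && _); [exists (1 - q - eps%:Z)|exists (- q - eps%:Z)]; lia.
have ydiff j : y j.+1 != y j -> x j \is a Num.int.
  by move=> h; apply: contraNT h => /y2 ->.
(* Each chip is placed on the sheet where the level has to descend. *)
pose E : divisor Y := \sum_(j : 'I_n | y j.+1 != y j)
  << (inl (inl (if s0 j.+1 < s0 j then lshift n j else rshift n j)) : point Y) >>.
have E0 : effective E by apply: effective_sum => j _; exact: effective_point.
have dE : deg E = a%:Z.
  rewrite raddf_sum /=; under eq_bigr do rewrite degU.
  rewrite sumr_const -sum1_card /a /changes big_mkord [in RHS]big_mkcond /=.
  rewrite natz; congr (_%:Z).
  by rewrite [LHS]big_mkcond; apply: eq_bigr => j _; rewrite unfold_in; case: (_ != _).
have [F F0 hF] := hr E E0 dE; pose G := E + F.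
have G0 : effective G by exact: effectiveD.
have cE j : y j.+1 != y j ->
    1 <= coeff (inl (inl (if s0 j.+1 < s0 j then lshift n j else rshift n j))) G.
  move=> h; rewrite coeffD /E (bigD1 j)//=; set rest := \sum_(_ | _) _.
  have rest0 : effective rest by apply: effective_sum => j' _; exact: effective_point.
  by rewrite coeffD coeffU eqxx mulr1 -addrA lerDl addr_ge0.
have hG : at_coord eps x G by apply/(at_coord_cls n0 hU _ hD).
have [dG [m [k [thG etG]]]] := hG.
have [last hl] := last_index.
(* Only the parity of [e0] is imposed, and its window contains two consecutive integers. *)
have [e0 [t0 [he0 e0E]]] := even_step (level_out G last) ((y 0%N)%:Z + k).
have : S + 2 * e0 = eps%:Z + 2 * k.
  apply: (@forced_level _ _ _ n0 hU eps x G m k G0 dG thG etG s e0 S t last) => //.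
  - by move=> d dn; rewrite sr sl.
  - move=> i; rewrite coord_int -(splitK i); case: (fintype.split i) => j /=.
      rewrite reduce_lshift !sl//; last exact: ltnW.
      have [e|ne] := eqVneq (y j.+1) (y j); first by left; exact: s0step.
      right; split; first exact: ydiff.
      have [->|e] := s0step' _ ne; first by left.
      right; split=> //; have := cE j ne; rewrite e ltrBlDr ltrDl ltr01//.
    rewrite reduce_rshift -addnS !sr.
    have [e|ne] := eqVneq (y j.+1) (y j); first by left; rewrite s0step.
    right; split; first exact: ydiff.
    have [e|->] := s0step' _ ne; last by left; lia.
    right; split; first by rewrite e; lia.
    by have := cE j ne; rewrite e ltNge lerDl ler01.
  - move=> i; rewrite coord_int -(splitK i); case: (fintype.split i) => j /=.
      rewrite reduce_lshift coord_lshift sl// => xj.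
      have [q e1] := oddzP (Num.floor (x j)); have [q2] := s0par j.+1.
      rewrite y1// => e2; exists (q + q2 - t0); rewrite e0E; lia.
    rewrite reduce_rshift -addnS sr => xj; rewrite floor_coord_rshift//.
    have [q e1] := oddzP (Num.floor (x j)); have [q2] := s0par j.+1.
    rewrite y1// => e2; exists (- q - q2 - t0 - t - (y 0%N)%:Z + s0 j.+1 - s0 j.+1).
    by rewrite e0E St; lia.
move=> eS; have zE : z -> ((- a%:Z - eps%:Z + 2 * (y 0%N)%:Z) %% 4)%Z = 0 by move/eqP.
have znE : ~~ z -> ((- a%:Z - eps%:Z + 2 * (y 0%N)%:Z) %% 4)%Z <> 0 by move/eqP.
have eS' : (- a%:Z - eps%:Z + 2 * (y 0%N)%:Z) = - 4 * t0 - (if z && (0 < a)%N then 2 else 0).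
  by move: eS; rewrite /S /s0 -/a e0E; lia.
case: (boolP z) zE znE eS' => _ /= zE znE; last first.
  by move=> e; case: (znE isT); rewrite e; lia.
(* Without changes there is no step to reverse, but then [eps] is false and [y 0] is true, so that
   [z] cannot hold. *)
have := zE isT; case: (posnP a) => [a0|a1] /=.
  by move=> h; move: (ya a0) h; rewrite a0 pa a0 => ->.
by move=> h e; move: h; rewrite e; lia.
Qed.

End UpperBound.

(** * Upper bounds when the parity is constant or no coordinate is integral *)

Section DegenerateUpperBounds.
Variables (R : realType) (n : nat) (L : loop_of_loops R n).
Hypothesis n0 : (0 < n)%N.
Hypothesis hU : two_uniform L.
Local Notation C := (antipodal_cover L).
Local Notation Y := (lol_graph (antipodal_cover L)).
Implicit Types (j : 'I_n) (i : 'I_(n + n)) (D : divisor Y).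

Lemma evzUD (c : point Y -> int) (k : int) p D :
  evz c (<< k *g p >> + D) = k * c p + evz c D.
Proof.
by apply: (@intr_inj R); rewrite evzE raddfD /= evU intrD intrM evzE.
Qed.

(* Extra chips in the interior of a loop cannot be the only ones there when the
   angular coordinate is not integral. *)
Lemma level_drop i (k : nat) (p : point Y) (F : divisor Y) : effective F ->
  entered p = i.+1 -> passed p = i ->
  (forall q : int, ev (th i) F <> q%:~R) ->
  level_out (<< k%:Z *g p >> + F) i <= level_in (<< k%:Z *g p >> + F) i - k%:Z.
Proof.
move=> F0 pe pp nz.
have h : chips_out i F + 1 <= chips_in i F.
  have := chips_out_le_in i F0; rewrite le_eqVlt => /orP[/eqP e|]; last by rewrite lezD1.
  by case: (nz (chips_out i F)); apply: ev_th_pure.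
move: h; rewrite /level_in /level_out /chips_in /chips_out !evzUD pe pp ltnSn ltnn; lia.
Qed.

(** Two coincident chips inside a loop with integral coordinate force a third one there, so that the
    level falls by 2, more than the window allows when the parity is constant. *)
Lemma not_rank_ge2 eps x D y j0 : at_coord eps x D -> filling eps x y ->
  x j0 \is a Num.int -> changes y n = 0%N -> ~ rank_ge D 2.
Proof.
move=> hD [y1 y2 y3] x0 ch /rank_geP hr.
have yc k : (k <= n)%N -> y k = y 0%N.
  elim: k => // k IH kn; rewrite -(IH (ltnW kn)); apply/eqP/negPn/negP => ne.
  by move: ch; rewrite /changes big_mkord (bigD1 (Ordinal kn))//= ne.
have eps0 : eps = false by move: y3; rewrite yc// -{1}[y 0%N]addbF => /addbI.
(* Twice the angle has to be nonintegral, so that the remaining chips have a nonintegral angle on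
   this loop. *)
have t01 : 0 < (4%:R^-1 : R) < 1 by lra.
have [p [pe pp pth _ _]] := loop_point (two_uniform_cover hU) (lshift n j0) true t01.
have [||F F0 hF] := hr << 2%:Z *g p >>; [exact: effective_point|exact: degU|].
set G := << 2%:Z *g p >> + F in hF.
have G0 : effective G by apply: effectiveD => //; exact: effective_point.
have [dG [m [k [thG _]]]] : at_coord eps x G by apply/(at_coord_cls n0 hU _ hD).
have [last hl] := last_index n0.
have [e0 [t0 [he0 e0E]]] := even_step (level_out G last) ((y 0%N)%:Z + k).
have half_int (z : int) : (z%:~R : R) <> 2^-1.
  move=> e; have : ((2 * z)%:~R : R) = 1%:~R by rewrite intrM e mulfV.
  by move/intr_inj; lia.
have drop : level_out G (lshift n j0) <= level_in G (lshift n j0) - 2.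
  apply: level_drop => // q e; have /intrP[z ez] := x0.
  have := thG (lshift n j0); rewrite raddfD /= evU pth ltnn eqxx e coord_lshift ez.
  move=> e2; apply: (half_int ((n + n)%N%:Z - 1 - j0%:Z + z + 2 * m (lshift n j0) + k - q)).
  by rewrite !(intrD, intrB, intrM); move: e2 => /=; lra.
have bits i : coord eps x i \is a Num.int ->
    exists q, Num.floor (coord eps x i) + k = e0 + 0 + 2 * q.
  rewrite coord_int -(splitK i); case: (fintype.split i) => j /=.
    rewrite reduce_lshift coord_lshift => xj.
    have [q e1] := oddzP (Num.floor (x j)); have := y1 j xj.
    by rewrite yc ?ltn_ord// => e2; exists (q - t0); rewrite e0E e1 -e2; lia.
  rewrite reduce_rshift => xj; rewrite floor_coord_rshift// eps0.
  have [q e1] := oddzP (Num.floor (x j)); have := y1 j xj.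
  by rewrite yc ?ltn_ord// => e2; exists (- q - t0 - (y 0%N)%:Z); rewrite e0E e1 -e2; lia.
have [/andP[_ h1] /andP[h2 _]] := levels n0 hU G0 dG thG hl (s := fun=> 0) erefl erefl
  (fun _ => or_introl erefl) bits he0 (lshift n j0).
by move: drop h1 h2; lia.
Qed.

(** No parity is imposed on [e0]: both values of its window are legitimate, and together they force
    all levels to be equal. A chip that leaves a nonintegral remainder needs a companion in its
    loop, which makes the level drop. *)
Lemma not_rank_ge1 eps x D : at_coord eps x D ->
  (forall j, x j \isn't a Num.int) -> ~ rank_ge D 1.
Proof.
move=> hD xn /rank_geP hr; pose j0 := Ordinal n0.
have [t [t01 ht]] : exists t : R, 0 < t < 1 /\ x j0 - t \isn't a Num.int.
  have [/intrP[z ez]|h] := boolP (x j0 - 2^-1 \is a Num.int); last first.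
    by exists 2^-1; split=> //; lra.
  exists 4^-1; split; first by lra.
  apply/negP => /intrP[w ew]; have : ((4 * (w - z))%:~R : R) = 1%:~R.
    by rewrite intrM intrB -ez -ew; field.
  by move/intr_inj; lia.
have [p [pe pp pth _ _]] := loop_point (two_uniform_cover hU) (lshift n j0) true t01.
have [||F F0 hF] := hr << 1%:Z *g p >>; [exact: effective_point|exact: degU|].
set G := << 1%:Z *g p >> + F in hF.
have G0 : effective G by apply: effectiveD => //; exact: effective_point.
have [dG [m [k [thG _]]]] : at_coord eps x G by apply/(at_coord_cls n0 hU _ hD).
have [last hl] := last_index n0.
have drop : level_out G (lshift n j0) <= level_in G (lshift n j0) - 1.
  apply: level_drop => // q e; move/negP: ht; apply; apply/intrP.
  have := thG (lshift n j0); rewrite raddfD /= evU pth ltnn eqxx e coord_lshift => e2.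
  exists (q - ((n + n)%N%:Z - 1 - j0%:Z + 2 * m (lshift n j0) + k)).
  by rewrite !(intrD, intrB, intrM); move: e2 => /=; lra.
have lev (b : bool) : forall i, [/\ level_out G last + b%:Z + 0 - 1 <= level_in G i
    <= level_out G last + b%:Z + 0 & level_out G last + b%:Z + 0 - 1 <= level_out G i
    <= level_out G last + b%:Z + 0].
  apply: (levels n0 hU G0 dG thG hl (s := fun=> 0) erefl erefl (fun _ => or_introl erefl)).
    by move=> i; rewrite coord_int (negbTE (xn _)).
  by case: b; lia.
have [/andP[_ h1] _] := lev false (lshift n j0).
have [_ /andP[h2 _]] := lev true (lshift n j0).
by move: drop h1 h2 => /=; lia.
Qed.

End DegenerateUpperBounds.

(** * Lower bounds on the rank *)

Section DistanceToEven.
Variable R : realType.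
Implicit Types a b t v : R.

(* Distance to the set of even integers. *)
Definition dist2 t : R := `|t - 2 * (Num.floor ((t + 1) / 2))%:~R|.

Lemma dist2P t : 0 <= dist2 t <= 1 /\
  exists z : int, t = dist2 t + 2 * z%:~R \/ t = - dist2 t + 2 * z%:~R.
Proof.
rewrite /dist2; set f := Num.floor _.
have := floor_itv ((t + 1) / 2); rewrite -/f intrD => h.
have b : -1 <= t - 2 * f%:~R < 1 by lra.
split; first by rewrite normr_ge0 ler_norml; lra.
exists f; case: (leP 0 (t - 2 * f%:~R)) => s; [left; rewrite ger0_norm//|right; rewrite ltr0_norm//]; ring.
Qed.

Lemma dist2_le t (z : int) : dist2 t <= `|t - 2 * z%:~R|.
Proof.
have [/andP[d0 d1] [w e]] := dist2P t; set d := dist2 t in d0 d1 e *.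
have [-> | wz] := eqVneq z w.
  by case: e => ->; rewrite addrK ?normrN ger0_norm.
have h1 := ler_norm (t - 2 * z%:~R).
have h2 : - (t - 2 * z%:~R) <= `|t - 2 * z%:~R| by rewrite -normrN ler_norm.
have [zw|wz'] : (z%:~R + 1 <= w%:~R :> R) \/ (w%:~R + 1 <= z%:~R :> R).
  have one : (1 : R) = 1%:~R by [].
  by rewrite one -!intrD !ler_int; move/eqP: wz; lia.
- by case: e => e; lra.
- by case: e => e; lra.
Qed.

Lemma dist2_uniq t v (z : int) : 0 <= v <= 1 ->
  t = v + 2 * z%:~R \/ t = - v + 2 * z%:~R -> dist2 t = v.
Proof.
move=> /andP[v0 v1] h; apply/eqP; rewrite eq_le; apply/andP; split.
  apply: (le_trans (dist2_le t z)).
  by case: h => ->; rewrite addrK ?normrN ger0_norm.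
have [/andP[d0 d1] [w e]] := dist2P t; set d := dist2 t in d0 d1 e *.
have key (m : int) : d <= v -> v - d = 2 * m%:~R \/ v + d = 2 * m%:~R -> v <= d.
  move=> dv [] e1.
    have m0 : (m%:~R : R) = 0.
      have : (m%:~R : R) < 1%:~R by lra.
      have : (0%:~R : R) <= m%:~R by lra.
      by rewrite ler_int ltr_int => h1 h2; have -> : m = 0 by lia.
    by lra.
  have [m0|m1] : m = 0 \/ m = 1.
    have : (0%:~R : R) <= m%:~R by lra.
    have : (m%:~R : R) < 2%:~R by lra.
    by rewrite ler_int ltr_int; lia.
  - by rewrite m0 in e1; lra.
  by rewrite m1 in e1; lra.
have [dv|//] := orP (le_total d v).
case: h e => -> [] e.
- by apply: (key (w - z)); rewrite ?dv// rmorphB /=; left; lra.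
- by apply: (key (w - z)); rewrite ?dv// rmorphB /=; right; lra.
- by apply: (key (z - w)); rewrite ?dv// rmorphB /=; right; lra.
- by apply: (key (z - w)); rewrite ?dv// rmorphB /=; left; lra.
Qed.

Lemma dist2_shift t (z : int) : dist2 (t + 2 * z%:~R) = dist2 t.
Proof.
have [d01 [w e]] := dist2P t; apply: (dist2_uniq (z := w + z)) => //.
by rewrite intrD; case: e => e; [left|right]; lra.
Qed.

Lemma dist2N t : dist2 (- t) = dist2 t.
Proof.
have [d01 [w e]] := dist2P t; apply: (dist2_uniq (z := - w)) => //.
by rewrite intrN; case: e => e; [right|left]; lra.
Qed.

Lemma dist2_antipode t : dist2 (1 - t) = 1 - dist2 t.
Proof.
have [d01 [w e]] := dist2P t; case: e => e.
  by apply: (dist2_uniq (z := - w)); [lra|left; rewrite intrN; lra].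
by apply: (dist2_uniq (z := 1 - w)); [lra|right; rewrite intrB; lra].
Qed.

Lemma dist2_lipschitz a b : dist2 a - dist2 b <= `|a - b|.
Proof.
have [/andP[d0 d1] [w e]] := dist2P b.
have h : `|b - 2 * w%:~R| = dist2 b.
  have [e2|e2] : b - 2 * w%:~R = dist2 b \/ b - 2 * w%:~R = - dist2 b.
    by case: e => e; [left|right]; lra.
  - by rewrite e2 ger0_norm.
  by rewrite e2 normrN ger0_norm.
rewrite lerBlDr -h; apply: le_trans (dist2_le a w) _.
by apply: le_trans (ler_normD _ _); rewrite (_ : a - b + _ = a - 2 * w%:~R)//; ring.
Qed.

End DistanceToEven.

(** * Points at a prescribed position on the quotient circle *)

Section Positions.
Variables (R : realType) (N : nat) (L : loop_of_loops R N).
Hypothesis hU : two_uniform L.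
Local Notation Y := (lol_graph L).
Local Notation Lam := (Lam L).
Local Notation et := (@et R N L).
Implicit Types (i j k : 'I_N) (p : point Y) (z : R).

Definition vpos i : R := et (inl (inl i) : point Y).

Lemma vposE i : vpos i = et (inl (inl i) : point Y). Proof. by []. Qed.

Lemma natr_le (a b : bool) : (a -> b) -> a%:R <= b%:R :> R.
Proof. by case: a => [->|] //; rewrite ler0n. Qed.

Lemma et_le p q : (forall k, kap k p <= kap k q) -> (forall k, rho k p <= rho k q) ->
  et p <= et q.
Proof.
move=> hk hr; apply: lerD; apply: ler_sum => k _.
  by rewrite ler_wpM2l// ltW ?ll_gt0.
by rewrite ler_wpM2l// mulr_ge0// ltW ?bl_gt0.
Qed.

Lemma rho_ge0 k p : 0 <= rho k p.
Proof.
have [k0|k0] := posnP k; first by have /andP[] := rho0_bounds p k0.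
by have /andP[+ _] := rho_bounds p k0; apply: le_trans; rewrite ler0n.
Qed.

Lemma et_ge0 p : 0 <= et p.
Proof.
apply: addr_ge0; apply: sumr_ge0 => k _; apply: mulr_ge0.
- by rewrite ltW ?ll_gt0.
- by have /andP[+ _] := kap_bounds hU k p; apply: le_trans; rewrite ler0n.
- by rewrite mulr_ge0// ltW ?bl_gt0.
- exact: rho_ge0.
Qed.

Lemma et_le_Lam p : et p <= Lam.
Proof.
apply: lerD; apply: ler_sum => k _; rewrite -[leRHS]mulr1 ler_wpM2l//.
- by rewrite ltW ?ll_gt0.
- by have /andP[_ h] := kap_bounds hU k p; apply: le_trans h _; rewrite lern1 leq_b1.
- by rewrite mulr_ge0// ltW ?bl_gt0.
have [k0|k0] := posnP k; [have /andP[_ h] := rho0_bounds p k0|have /andP[_ h] := rho_bounds p k0];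
by apply: le_trans h _; rewrite lern1 leq_b1.
Qed.

Lemma et_w i : et (inl (inr i) : point Y) = vpos i + ll L i.
Proof.
apply/eqP; rewrite -subr_eq0 /vpos opprD addrA subr_eq0; apply/eqP.
rewrite /et opprD addrACA [X in _ + X](_ : _ = 0) ?addr0; last exact: subrr.
rewrite -sumrB (bigD1 i)//= leqnn ltnn big1 ?addr0 => [|j /negbTE ji].
  by rewrite mulr1 mulr0 subr0.
by rewrite -mulrBr [X in _ * X](_ : _ = 0) ?mulr0//; have := loop_pos_loop L j i;
  rewrite /= eq_sym ji.
Qed.

Lemma et_before p i : (entered p <= i)%N -> et p <= vpos i.
Proof.
move=> pi; have /andP[pp _] := passed_entered p; apply: et_le => k.
  have /andP[_ h] := kap_bounds hU k p; apply: le_trans h _; apply: natr_le => /=; lia.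
have [k0|k0] := posnP k.
  have /andP[_ h] := rho0_bounds p k0; apply: le_trans h _; apply: natr_le => /=.
  by have := ltn_ord i; lia.
have /andP[_ h] := rho_bounds p k0; apply: le_trans h _; apply: natr_le => /=; lia.
Qed.

Lemma et_after p i : (i < passed p)%N -> vpos i + ll L i <= et p.
Proof.
move=> pi; have /andP[pp _] := passed_entered p; rewrite -et_w; apply: et_le => k.
  have /andP[+ _] := kap_bounds hU k p; apply: le_trans; apply: natr_le => /=; lia.
have [k0|k0] := posnP k; first by rewrite /= k0 /=; exact: rho_ge0.
have /andP[+ _] := rho_bounds p k0; apply: le_trans; apply: natr_le => /=; lia.
Qed.

Lemma et_inside p i : (passed p <= i)%N -> (i < entered p)%N ->
  et p = vpos i + ll L i * kap i p.
Proof.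
move=> pi ip; have pp := passed_entered p.
have [ei e2] : entered p = i.+1 /\ passed p = i by lia.
have squeeze (a : R) (b : bool) : b%:R <= a <= b%:R -> a = b%:R.
  by move=> h; apply/eqP; rewrite eq_le andbC.
have hk k : k != i -> kap k p = (k < i)%N%:R.
  move=> ki; apply: squeeze; have := kap_bounds hU k p; rewrite ei e2 ltnS.
  by rewrite (leq_neq_lt ki).
have hr k : rho k p = (0 < k <= i)%N%:R.
  apply: squeeze; have [k0|k0] := posnP k.
    by have := rho0_bounds p k0; rewrite e2 k0 leqNgt ltn_ord.
  by have := rho_bounds p k0; rewrite ei e2 ltnS.
apply/eqP; rewrite addrC -subr_eq /vpos opprD addrACA.
rewrite [X in _ + X](_ : _ = 0) ?addr0; last first.
  by apply/eqP; rewrite subr_eq0; apply/eqP; apply: eq_bigr => k _; rewrite hr.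
rewrite -sumrB (bigD1 i)//= ltnn mulr0 subr0 big1 ?addr0// => k ki.
by rewrite hk// subrr.
Qed.

(* The common value of [kap i] at the points [p] with [et p = z]. *)
Definition clamp i z : R := Num.min (Num.max ((z - vpos i) / ll L i) 0) 1.

Lemma clamp0 i z : z <= vpos i -> clamp i z = 0.
Proof.
move=> zi; rewrite /clamp [Num.max _ _]max_r ?min_l//.
by rewrite pmulr_lle0 ?invr_gt0 ?ll_gt0// subr_le0.
Qed.

Lemma clamp1 i z : vpos i + ll L i <= z -> clamp i z = 1.
Proof.
move=> zi; rewrite /clamp min_r// le_max; apply/orP; left.
by rewrite ler_pdivlMr ?ll_gt0// mul1r; lra.
Qed.

Lemma clamp_mid i t : 0 <= t <= 1 -> clamp i (vpos i + ll L i * t) = t.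
Proof.
move=> /andP[t0 t1]; have l0 := ll_gt0 L i.
by rewrite /clamp addrAC subrr add0r mulrAC mulfV ?gt_eqF// mul1r max_l// min_l.
Qed.

Lemma kap_clamp i p : kap i p = clamp i (et p).
Proof.
have kb := kap_bounds hU i p; have pp := passed_entered p.
have [ip|pi] := ltnP i (passed p).
  rewrite clamp1 ?et_after//; apply/eqP; rewrite eq_le.
  by move: kb; rewrite ip (_ : (i < entered p)%N = true) 1?andbC//; lia.
have [ie|ei] := ltnP i (entered p); last first.
  rewrite clamp0 ?et_before//; apply/eqP; rewrite eq_le.
  by move: kb; rewrite !ltnNge ei pi andbC.
rewrite (et_inside pi ie) clamp_mid//; move: kb; rewrite ie ltnNge pi /=; lra.
Qed.

Lemma clamp_le i z z' : z <= z' -> clamp i z <= clamp i z'.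
Proof.
move=> zz; have : (z - vpos i) / ll L i <= (z' - vpos i) / ll L i.
  by rewrite ler_pM2r ?invr_gt0 ?ll_gt0// lerB.
rewrite /clamp /Num.min /Num.max; move: (_ / _) ((z' - _) / _) => a b ab.
case: (ltP a 0) => ?; case: (ltP b 0) => ?; case: ltP => ?; case: ltP => ?; lra.
Qed.

(** Except on a loop with [p] in its interior, the angle is 0 or 1 and equals its opposite modulo 2;
    one sign therefore serves all loops. *)
Lemma th_sign p : exists2 s : R, s = 1 \/ s = -1 &
  forall i, exists m : int, th i p = s * kap i p + 2 * m%:~R.
Proof.
have th_kap : (forall i, th i p = kap i p) -> exists2 s : R, s = 1 \/ s = -1 &
    forall i, exists m : int, th i p = s * kap i p + 2 * m%:~R.
  by move=> h; exists 1; [left|move=> i; exists 0; rewrite h; ring].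
case: p th_kap => [v|[[[[j b]|j] t] /= h]] th_kap; try exact: th_kap.
case: b h th_kap => h th_kap; first by apply: th_kap => i /=; rewrite mulr1.
exists (-1); first by right.
move=> i; exists (i < j)%N%:Z; rewrite /=.
by case: (eqVneq j i) => [->|_]; rewrite ?ltnn /= -?pmulrn; ring.
Qed.

Lemma et_step i : vpos i + ll L i + 2 * bl L (ordS i) =
  vpos (ordS i) + (ordS i == 0%N :> nat)%:R * Lam.
Proof.
have hl j : kap j (inl (inr i) : point Y) = kap j (inl (inl (ordS i)) : point Y) + (ordS i == 0%N :> nat)%:R.
  have := loop_pos_bridge L j (ordS i); rewrite ordSK => h.
  by rewrite -h [RHS]addrC subrK.
have hr j : rho j (inl (inr i) : point Y) = rho j (inl (inl (ordS i)) : point Y)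
    + (ordS i == 0%N :> nat)%:R - (ordS i == j)%:R.
  have := bridge_pos_bridge L j (ordS i); rewrite ordSK => h.
  by move: h; rewrite /rho /= => <-; ring.
rewrite -et_w /vpos /et /Lam.
under eq_bigr do rewrite hl mulrDr.
under [X in _ + X + _]eq_bigr do rewrite hr mulrBr mulrDr.
rewrite sumrB !big_split /= (sum_delta (fun j => 2 * bl L j)) -!mulr_suml; ring.
Qed.

Lemma bridge_point i t : 0 < t < 2 * bl L (ordS i) ->
  exists p : point Y, et p = vpos i + ll L i + t /\ forall j, th j p = kap j p.
Proof.
move=> h; have h' : 0 < t / 2 < (len (inr (ordS i) : edge Y))%:num.
  by rewrite len_bridge; move: (bl L (ordS i)) h => b /andP[t0 tb]; apply/andP; split; lra.
pose q : point Y := inr (exist (fun x : edge Y * R => 0 < x.2 < (len x.1)%:num)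
  (inr (ordS i), t / 2) h').
have kq j : kap j q = kap j (inl (inr i) : point Y).
  change (loop_pos j (inr (ord_pred (ordS i)) : vert Y) + 0 * (t / 2) =
    loop_pos j (inr i : vert Y)).
  by rewrite ordSK mul0r addr0.
have rq j : rho j q = rho j (inl (inr i) : point Y) + (ordS i == j)%:R / bl L j * (t / 2).
  change (bridge_pos j (inr (ord_pred (ordS i)) : vert Y) + (ordS i == j)%:R / bl L j * (t / 2) =
    bridge_pos j (inr i : vert Y) + (ordS i == j)%:R / bl L j * (t / 2)).
  by rewrite ordSK.
exists q; split=> //; rewrite -et_w /et.
under eq_bigr do rewrite kq.
rewrite [X in _ + X](eq_bigr (fun j => 2 * bl L j * rho j (inl (inr i) : point Y)
    + t * (ordS i == j)%:R)).
  by rewrite big_split /= (sum_delta (fun=> t)) addrA.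
move=> j _; rewrite rq mulrDr; congr (_ + _).
case: eqP => _; last by rewrite !mul0r !mulr0.
by rewrite mul1r mulr1; field; rewrite gt_eqF ?bl_gt0.
Qed.

Hypothesis N0 : (0 < N)%N.

Lemma vpos0 : vpos (Ordinal N0) = 0.
Proof.
rewrite /vpos /et !big1 ?addr0// => j _; rewrite /kap /rho /= ?mulr0//.
by rewrite leqn0 lt0n; case: eqP; rewrite ?mulr0.
Qed.

Lemma point_at z : 0 <= z < Lam ->
  exists p : point Y, et p = z /\ forall j, th j p = kap j p.
Proof.
move=> /andP[z0 zL].
have v0 : vpos (Ordinal N0) <= z.
  by rewrite vpos0.
(* The last loop starting at or before [z]: the position lies on it or on the bridge that
   follows. *)
case: (@arg_maxnP _ (Ordinal N0) (fun i => vpos i <= z) (fun i => i)) => // i vi imax.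
have [zw|wz] := leP z (vpos i + ll L i).
  have [e|ne] := eqVneq z (vpos i); first by exists (inl (inl i)).
  have [e|ne'] := eqVneq z (vpos i + ll L i); first by exists (inl (inr i)); rewrite et_w.
  have l0 := ll_gt0 L i.
  have t01 : 0 < (z - vpos i) / ll L i < 1.
    apply/andP; split; last by rewrite ltr_pdivrMr// mul1r ltrBlDl lt_neqAle ne'.
    by rewrite divr_gt0// subr_gt0 lt_neqAle eq_sym ne.
  have [p [pe pp pth pk _]] := loop_point hU i true t01.
  exists p; split; last by move=> j; rewrite pth pk.
  by rewrite (@et_inside p i) ?pe ?pp// pk ltnn eqxx add0r mul1r mulrC divfK ?gt_eqF// addrC subrK.
have [|p [ep tp]] := @bridge_point i (z - (vpos i + ll L i)); last first.
  by exists p; rewrite ep addrC subrK.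
rewrite subr_gt0 wz ltrBlDl et_step /=.
have [_|S0] := eqVneq (ordS i : nat) 0%N.
  by rewrite mul1r (lt_le_trans zL)// lerDr; exact: et_ge0.
rewrite mul0r addr0 ltNge; apply/negP => /imax /=.
by move: S0; rewrite /= ; have := ltn_ord i; rewrite leq_eqVlt => /orP[/eqP ->|h];
  rewrite ?modnn// modn_small// ltnn.
Qed.

End Positions.

(** * Divisors with prescribed angles and positions *)

Section LoopDivisors.
Variables (R : realType) (N : nat) (L : loop_of_loops R N).
Hypothesis hU : two_uniform L.
Local Notation Y := (lol_graph L).
Local Notation Lam := (Lam L).
Local Notation et := (@et R N L).
Local Notation vpos := (vpos L).
Local Notation ll := (ll L).
Local Notation clamp := (clamp L).
Implicit Types (i j k : 'I_N) (p : point Y) (z t : R).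

Lemma angle_point i t : exists p : point Y,
  [/\ forall j, j != i -> th j p = (j < i)%N%:R,
      exists m : int, th i p = t + 2 * m%:~R & et p = vpos i + ll i * dist2 t].
Proof.
have [/andP[d0 d1] [z e]] := dist2P t; set d := dist2 t in d0 d1 e *.
have l0 := ll_gt0 L i.
have [dz|nz] := eqVneq d 0.
  exists (inl (inl i)); split=> //; last by rewrite dz mulr0 addr0.
  by exists (- z); rewrite /= ltnn intrN /=; case: e; rewrite dz; lra.
have [d1'|n1] := eqVneq d 1.
  exists (inl (inr i)); split=> [j ji||]; last by rewrite et_w// d1' mulr1.
    by rewrite /= (leq_neq_lt ji).
  by case: e; rewrite d1' => e; [exists (- z)|exists (1 - z)];
    rewrite ?intrB ?intrN /= leqnn /=; lra.
have d01 : 0 < d < 1 by rewrite !lt_neqAle eq_sym nz d0 n1 d1.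
have [b [m eb]] : exists (b : bool) (m : int), (if b then d else - d) = t + 2 * m%:~R.
  by case: e => ->; [exists true|exists false]; exists (- z); rewrite intrN; ring.
have [p [pe pp pth pk _]] := loop_point hU i b d01.
exists p; split.
- by move=> j ji; rewrite pth eq_sym (negbTE ji) mul0r addr0.
- by exists m; rewrite pth ltnn eqxx add0r mul1r eb.
by rewrite (@et_inside _ _ _ hU p i) ?pe ?pp// pk ltnn eqxx add0r mul1r.
Qed.

(* One chip on each loop of [P], at a prescribed angle up to the jumps due to
   the chips beyond. *)
Lemma loops_divisor (P : pred 'I_N) (t : 'I_N -> R) : exists F : divisor Y,
  [/\ effective F, deg F = #|P|%:Z,
    forall i, P i -> exists m : int,
      ev (th i) F = t i + 2 * m%:~R + \sum_(j | P j) (i < j)%N%:R,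
    forall i, ~~ P i -> ev (th i) F = \sum_(j | P j) (i < j)%N%:R
    & ev et F = \sum_(i | P i) (vpos i + ll i * dist2 (t i))].
Proof.
have [p hp] := choice (fun i => angle_point i (t i)).
exists (\sum_(i | P i) << p i >>); have E f : ev f (\sum_(i | P i) << p i >>) = \sum_(i | P i) f (p i).
  by rewrite raddf_sum; apply: eq_bigr => i _; rewrite /= evU mul1r.
split.
- by apply: effective_sum => i _; exact: effective_point.
- by rewrite raddf_sum /=; under eq_bigr do rewrite degU; rewrite sumr_const natz.
- move=> i Pi; have [_ [m hm] _] := hp i; exists m; rewrite E (bigD1 i)//= hm.
  congr (_ + _); rewrite [in RHS](bigD1 i)//= ltnn add0r.
  by apply: eq_bigr => j /andP[_ ji]; have [h _ _] := hp j; rewrite h// eq_sym.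
- move=> i Pi; rewrite E; apply: eq_bigr => j Pj; have [h _ _] := hp j; rewrite h//.
  by apply: contraNneq Pi => ->.
- by rewrite E; apply: eq_bigr => i _; have [_ _ ->] := hp i.
Qed.

Lemma kap01 i p : 0 <= kap i p <= 1.
Proof.
have /andP[h1 h2] := kap_bounds hU i p; rewrite (le_trans _ h1) ?ler0n//=.
by apply: le_trans h2 _; rewrite lern1 leq_b1.
Qed.

Lemma dist2_th i p : dist2 (th i p) = kap i p.
Proof.
have [s hs h] := th_sign p; have [m hm] := h i.
apply: (dist2_uniq (z := m)); first exact: kap01.
by rewrite hm; case: hs => ->; [left|right]; rewrite ?mul1r ?mulN1r.
Qed.

Lemma passed_ltn p : (passed p < entered p)%N -> (passed p < N)%N.
Proof. by case: p => [[i|i]|[[[[i b]|i] t] /= h]] //=; rewrite ltnn. Qed.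

(* The conjugate of [p] under the involution exchanging the edges of the loops. *)
Lemma conjugate_point p : exists q : point Y, et q = et p /\
  forall i, exists m : int, th i p + th i q = 2 * m%:~R.
Proof.
have pp := passed_entered p; have [pe|pe] := eqVneq (entered p) (passed p).
  exists p; split=> // i; exists (i < passed p)%N%:Z.
  by rewrite th_outside ?pe// -pmulrn; ring.
have pe' : (passed p < entered p)%N by lia.
pose i := Ordinal (passed_ltn pe').
have [q [h1 [m h2] h3]] := angle_point i (- th i p).
exists q; split.
  by rewrite h3 dist2N dist2_th (@et_inside _ _ _ hU p i).
move=> j; have [->|ji] := eqVneq j i; first by exists m; rewrite h2; ring.
exists (j < i)%N%:Z; rewrite h1// th_outside -?pmulrn; first by ring.
have /eqP : (j : nat) <> passed p by move=> e; case/eqP: ji; apply: val_inj.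
by lia.
Qed.

Lemma conjugate_divisor (E : divisor Y) : effective E -> exists F : divisor Y,
  [/\ effective F, deg F = deg E &
    forall i, exists m : int, ev (th i) E + ev (th i) F = 2 * m%:~R].
Proof.
move=> E0; have [q hq] := choice conjugate_point.
pose F : divisor Y := \sum_(p <- dom E) << coeff p E *g q p >>.
have EF f : ev f F = ev (fun p => f (q p)) E.
  by rewrite raddf_sum; apply: eq_bigr => p _; rewrite /= evU.
exists F; split.
- by apply: effective_sum => p _; exact: effective_point.
- by apply: (@intr_inj R); rewrite -!ev_deg EF.
move=> i; have [m hm] := choice (fun p => (hq p).2 i).
exists (evz m E); rewrite EF -evfD evzE -evfZ; apply: ev_eq => p _; exact: hm.
Qed.

(* Continuation of [kap i] along a path going twice around the graph. *)
Definition clamp2 i z : R := clamp i z + clamp i (z - Lam).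

Lemma vpos_ge0 i : 0 <= vpos i. Proof. exact: et_ge0. Qed.
Lemma wpos_le i : vpos i + ll i <= Lam. Proof. by rewrite -et_w//; exact: et_le_Lam. Qed.

Lemma clamp2_low i z : z <= Lam -> clamp2 i z = clamp i z.
Proof.
by move=> zL; rewrite /clamp2 [X in _ + X]clamp0 ?addr0// (le_trans _ (vpos_ge0 i))// subr_le0.
Qed.

Lemma clamp2_high i z : Lam <= z -> clamp2 i z = 1 + clamp i (z - Lam).
Proof. by move=> zL; rewrite /clamp2 clamp1// (le_trans (wpos_le i)). Qed.

Lemma clamp2_kap i p : clamp2 i (et p) = kap i p.
Proof. by rewrite clamp2_low ?et_le_Lam// kap_clamp. Qed.

Lemma clamp2_kap1 i p : clamp2 i (et p + Lam) = 1 + kap i p.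
Proof. by rewrite clamp2_high ?addrK ?kap_clamp// lerDr et_ge0. Qed.

Hypothesis N0 : (0 < N)%N.

Lemma extended_point z : 0 <= z < 2 * Lam -> exists (p : point Y) (k : int),
  et p = z - k%:~R * Lam /\ forall j, th j p = clamp2 j z - k%:~R.
Proof.
move=> /andP[z0 z2]; have [zL|Lz] := ltP z Lam.
  have [|p [ep tp]] := point_at hU N0 (z := z); first by rewrite z0.
  exists p, 0; rewrite ep mul0r subr0; split=> // j.
  by rewrite tp subr0 -ep clamp2_kap.
have [|p [ep tp]] := point_at hU N0 (z := z - Lam); first by lra.
exists p, 1; rewrite ep mul1r; split=> // j.
have ez : z = et p + Lam by rewrite ep subrK.
by rewrite tp ez clamp2_kap1; ring.
Qed.

Lemma min_clamp i z :
  Num.min z (vpos i) + ll i * clamp i z = Num.min z (vpos i + ll i).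
Proof.
have l0 := ll_gt0 L i; have [zv|vz] := leP z (vpos i).
  by rewrite clamp0// mulr0 addr0 min_l//; lra.
have [zw|wz] := leP z (vpos i + ll i); last by rewrite clamp1 ?mulr1// ltW.
rewrite /clamp max_l ?divr_ge0; try lra.
rewrite min_l; last by rewrite ler_pdivrMr// mul1r; lra.
by field; rewrite gt_eqF.
Qed.

Lemma min_diff z z' a b : z <= z' -> a <= b ->
  Num.min z' a - Num.min z a <= Num.min z' b - Num.min z b.
Proof.
move=> zz ab; case: (leP z' a) => ?; case: (leP z a) => ?; case: (leP z' b) => ?;
case: (leP z b) => ?; lra.
Qed.

(** The loops occupy disjoint stretches of the circle, so that a motion from [z] to [z'] covers at
    most its own length of them. *)
Lemma clamp_sum z z' : z <= z' ->
  \sum_i ll i * (clamp i z' - clamp i z) <= Num.min z' Lam - Num.min z Lam.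
Proof.
(* The ceiling [M] is arbitrary because the induction lowers it to the start of the last loop
   considered. *)
move=> zz; suff H K : (K <= N)%N -> forall M, (forall i, (i < K)%N -> vpos i + ll i <= M) ->
    \sum_(i < N | (i < K)%N) ll i * (clamp i z' - clamp i z) <= Num.min z' M - Num.min z M.
  have := H N (leqnn N) Lam (fun i _ => wpos_le i).
  by rewrite (eq_bigl xpredT)// => i; rewrite ltn_ord.
elim: K => [|K IH] KN M hM.
  by rewrite big_pred0// subr_ge0; case: (leP z M) => ?; case: (leP z' M) => ?; lra.
pose k := Ordinal KN; rewrite (bigD1 k)//=.
rewrite (eq_bigl (fun i => (i < K)%N)); last first.
  by move=> i; rewrite -(inj_eq val_inj) /= ltnS ltn_neqAle andbC.
have := IH (ltnW KN) (vpos k) (fun i iK => et_after hU (p := inl (inl k)) iK).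
have := hM k (ltnSn K); have := min_clamp k z; have := min_clamp k z'.
move=> h1 h2 h3; have := min_diff zz h3; rewrite mulrBr; lra.
Qed.

Lemma clamp2_le i z z' : z <= z' -> clamp2 i z <= clamp2 i z'.
Proof. by move=> zz; apply: lerD; apply: clamp_le; rewrite ?lerB. Qed.

Lemma min_lipschitz z z' a : z <= z' -> Num.min z' a - Num.min z a <= z' - z.
Proof. by move=> zz; case: (leP z' a) => ?; case: (leP z a) => ?; lra. Qed.

Lemma min_max_sub z a : Num.min z a + Num.max (z - a) 0 = z.
Proof. by case: (leP z a) => ?; case: (leP (z - a) 0) => ?; lra. Qed.

Lemma clamp2_sum z z' : z <= z' ->
  \sum_i ll i * (clamp2 i z' - clamp2 i z) <= z' - z.
Proof.
move=> zz.
have pos i y : clamp i (y - Lam) = clamp i (Num.max (y - Lam) 0).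
  case: (leP 0 (y - Lam)) => [//|y0]; rewrite !clamp0 ?vpos_ge0//.
  by rewrite (le_trans (ltW y0)) ?vpos_ge0.
have -> : \sum_i ll i * (clamp2 i z' - clamp2 i z) =
    \sum_i ll i * (clamp i z' - clamp i z) +
    \sum_i ll i * (clamp i (Num.max (z' - Lam) 0) - clamp i (Num.max (z - Lam) 0)).
  by rewrite -big_split; apply: eq_bigr => i _ /=; rewrite -!pos /clamp2; ring.
have mm : Num.max (z - Lam) 0 <= Num.max (z' - Lam) 0.
  by case: (leP 0 (z - Lam)) => ?; case: (leP 0 (z' - Lam)) => ?; lra.
apply: (le_trans (lerD (clamp_sum zz) (clamp_sum mm))).
have := min_lipschitz Lam mm; have := min_max_sub z Lam; have := min_max_sub z' Lam; lra.
Qed.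

(** Conjugate points share their position, so each is put at half of [w] modulo [Lam]. The number of
    turns in the sum is then even, which keeps parities of angles intact. *)
Lemma conjugate_pair (w : R) : exists (q q' : point Y) (k : int),
  et q + et q' = w + 2 * k%:~R * Lam /\
  forall i, exists m : int, th i q + th i q' = 2 * m%:~R.
Proof.
have L0 := Lam_gt0 L N0; pose k := - Num.floor (w / 2 / Lam).
have [|q [eq _]] := point_at hU N0 (z := w / 2 + k%:~R * Lam).
  have := floor_itv (w / 2 / Lam); rewrite intrD ler_pdivlMr// ltr_pdivrMr// => /andP[h1 h2].
  by rewrite /k intrN mulNr; apply/andP; split; lra.
have [q' [eq' hq]] := conjugate_point q.
by exists q, q', k; rewrite eq' eq; split=> //; field.
Qed.

End LoopDivisors.

Lemma natr_parity (R : pzRingType) (a : nat) : a%:R = (odd a)%:R + 2 * (a./2)%:R :> R.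
Proof. by rewrite -natrM -natrD mul2n odd_double_half. Qed.

(** * The lower bound given by alternating coordinates *)

Section LowerBounds.
Variables (R : realType) (n : nat) (L : loop_of_loops R n).
Hypothesis n0 : (0 < n)%N.
Hypothesis hU : two_uniform L.
Local Notation C := (antipodal_cover L).
Local Notation Y := (lol_graph (antipodal_cover L)).
Local Notation et := (@et R _ C).
Implicit Types (j : 'I_n) (i : 'I_(n + n)) (D E F : divisor Y).

Let hUC : two_uniform C := two_uniform_cover hU.
Let N0 : (0 < n + n)%N := cover_gt0 n0.

Lemma sum_reduce (T : nmodType) (Q : pred 'I_n) (f : 'I_(n + n) -> T) :
  \sum_(i | Q (reduce_idx i)) f i = \sum_(j | Q j) (f (lshift n j) + f (rshift n j)).
Proof.
rewrite big_split_ord big_split; congr (_ + _); apply: eq_bigl => j /=.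
  by rewrite reduce_lshift.
by rewrite reduce_rshift.
Qed.

Lemma at_coordI eps x D (k : int) : deg D = (n + n)%N%:Z ->
  (forall i, exists m : int, ev (th i) D =
     (n + n)%:R - 1 - i%:R + coord eps x i + 2 * m%:~R + k%:~R) ->
  ev et D = canon_et L + (n%:R - 1 + eps%:R) * Lam L + k%:~R * Lam C ->
  at_coord eps x D.
Proof. by move=> dD /choice[m hm] hk; split=> //; exists m, k. Qed.

Lemma effective_deg1 E : effective E -> deg E = 1 -> exists p, E = << p >>.
Proof.
move=> E0 dE.
have dsum : \sum_(p <- dom E) coeff p E = 1.
  by rewrite -dE -[in RHS](freeg_sumE E) raddf_sum; apply: eq_bigr => p _; rewrite /= degU.
have [p pE] : exists p, p \in dom E.
  by case: (dom E) dsum => [|p s _]; [rewrite big_nil|exists p; rewrite mem_head].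
have pos q : q \in dom E -> 1 <= coeff q E.
  by rewrite mem_dom => nz; rewrite -gtz0_ge1 lt_neqAle eq_sym nz E0.
move: dsum; rewrite (bigD1_seq p) ?uniq_dom//= => dsum.
have rest0 : 0 <= \sum_(q <- dom E | q != p) coeff q E by apply: sumr_ge0 => q _; exact: E0.
have cp := pos p pE.
have [cp1 /eqP] : coeff p E = 1 /\ \sum_(q <- dom E | q != p) coeff q E = 0.
  by move: dsum rest0 cp; move: (\sum_(_ <- _ | _) _) (coeff p E) => S c; lia.
rewrite psumr_eq0 => [/allP r0|q _]; last exact: E0.
exists p; apply/eqP/freeg_eqP => q; rewrite coeffU mul1r.
have [<-|qp] := eqVneq p q; first by rewrite cp1.
apply: coeff_outdom; apply/negP => qE; have := r0 q qE.
by rewrite eq_sym qp /=; have := pos q qE; lia.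
Qed.

Definition index_in (M : {set 'I_n}) j : nat := (\sum_(k in M) (k < j)%N)%N.

Definition alternating (M : {set 'I_n}) (c : bool) (x : 'I_n -> R) : Prop :=
  forall j, j \in M -> exists q : int, x j = (c + index_in M j)%N%:R + 2 * q%:~R.

Lemma index_inC (M : {set 'I_n}) j : j \in M ->
  \sum_(k in M) (j < k)%N%:R = (#|M|%:R - 1 - (index_in M j)%:R : R).
Proof.
move=> jM; have : (\sum_(k in M) (j < k) + index_in M j + 1 = #|M|)%N.
  rewrite -sum1_card /index_in -big_split /= [in LHS](bigD1 j)//= [in RHS](bigD1 j)//=.
  rewrite ltnn addn1 add0n add1n; congr _.+1; apply: eq_bigr => k /andP[_ kj].
  by case: ltngtP kj => // /val_inj ->; rewrite eqxx.
by move=> <-; rewrite -natr_sum !natrD; ring.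
Qed.

Lemma rank_ge_alternating eps x D (M : {set 'I_n}) c : at_coord eps x D ->
  alternating M c x -> (0 < #|M|)%N -> eps = odd #|M| -> rank_ge D #|M|.-1.
Proof.
move=> hD hM M0 eM; apply/rank_geP => E E0 dE.
set a := #|M| in M0 eM dE *.
pose P i := reduce_idx i \notin M.
pose Sg i : R := \sum_(i' | P i') (i < i')%N%:R.
pose t i : R := (n + n)%:R - 1 - i%:R + coord eps x i.
pose e : R := canon_et L + (n%:R - 1 + eps%:R) * Lam L.
(* With this offset, on a loop over [M], the coordinate plus [k0] plus the number of loops over [M]
   lying beyond is even. *)
pose k0 : int := c%:Z + 1.
(* [Sg i] compensates for the chips of [F0] on later loops. *)
have [F0 [eF0 dF0 hP hnP etF0]] := loops_divisor hUC P (fun i => t i + k0%:~R - Sg i).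
have [E' [eE' dE' hE']] := conjugate_divisor hUC E0.
have [q [q' [k1 [eq hq]]]] := conjugate_pair hUC N0
  (e + k0%:~R * Lam C - ev et E - ev et E' - ev et F0).
pose F := E' + F0 + << q >> + << q' >>.
have EG f : ev f (E + F) = ev f E + ev f E' + ev f F0 + f q + f q'.
  by rewrite !raddfD /= !evU !mul1r !addrA.
exists F.
  by do !apply: effectiveD => //; exact: effective_point.
apply/(at_coord_cls n0 hU _ hD); apply: (@at_coordI _ _ _ (k0 + 2 * k1)).
(* Degrees: [2 * (a - 1)] for [E] and its conjugate, [n + n - 2 * a] for the loops off [M], and 2
   for the adjusting pair. *)
- have cP : (#|P| + 2 * a = n + n)%N.
    rewrite -sum1_card (sum_reduce (T := nat) [pred j | j \notin M] (fun=> 1%N)).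
    rewrite sum_nat_const; have := cardC (mem M); rewrite card_ord -/a.
    by rewrite (eq_card (B := [predC M]))//; lia.
  rewrite !degD !degU dE dE' dE dF0; move: cP M0; move: #|P| => b; lia.
- move=> i; have [m1 e1] := hE' i; have [m2 e2] := hq i; rewrite EG e1.
  have [Pi|nPi] := boolP (P i).
    have [m3 ->] := hP i Pi; exists (m1 + m2 + m3 - k1).
    rewrite -/(Sg i) !(intrD, intrB, intrM); move: e2; rewrite /t; lra.
  have Sgi : Sg i = (n + n)%:R - 1 - i%:R - \sum_(i' | ~~ P i') (i < i')%N%:R.
    have -> : (n + n)%:R - 1 - i%:R = \sum_(i' < n + n) (i < i')%N%:R :> R by rewrite sum_gtn.
    by rewrite (bigID P) /= addrK.
  rewrite hnP// -/(Sg i) Sgi.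
  have -> : \sum_(i' | ~~ P i') (i < i')%N%:R =
      \sum_(j in M) ((i < lshift n j)%N%:R + (i < rshift n j)%N%:R) :> R.
    rewrite -(sum_reduce (T := R) [pred j | j \in M] (fun i' => (i < i')%N%:R)).
    by apply: eq_bigl => i'; rewrite /P negbK.
  have aE : (a%:R : R) = eps%:R + 2 * (a./2)%:R.
    by rewrite eM -natr_parity.
  have [m3 e3] : exists m3 : int, coord eps x i + k0%:~R +
      \sum_(j in M) ((i < lshift n j)%N%:R + (i < rshift n j)%N%:R) = 2 * m3%:~R :> R.
    move: nPi; rewrite /P negbK; have [j [ij|ij]] : exists j, i = lshift n j \/ i = rshift n j.
    - by rewrite -(splitK i); case: (fintype.split i) => j; exists j; [left|right].
    - rewrite ij reduce_lshift coord_lshift => jM; have [q0 ->] := hM j jM.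
      exists (c%:Z + q0 + a%:Z); rewrite (eq_bigr (fun k : 'I_n => (j < k)%N%:R + 1)).
        rewrite big_split /= index_inC// sumr_const /k0 !natrD !(intrD) -!pmulrn; ring.
      by move=> k _ /=; rewrite ltn_addr.
    rewrite ij reduce_rshift coord_rshift => jM; have [q0 ->] := hM j jM.
    exists ((a./2)%:Z + eps%:Z - (index_in M j)%:Z - q0).
    rewrite (eq_bigr (fun k : 'I_n => (j < k)%N%:R)) => [|k _ /=]; last first.
      by rewrite ltn_add2l ltnNge (leq_trans (ltnW (ltn_ord k)) (leq_addr _ _)) add0r.
    rewrite index_inC// -/a aE /k0 !natrD !(intrB, intrD) -!pmulrn; ring.
  exists (m1 + m2 - m3 - k1); rewrite !(intrD, intrB, intrM).
  by move: e2 e3; rewrite /k0 /t !intrD; lra.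
- by rewrite EG -addrA eq /e !(intrD, intrM); ring.
Qed.

End LowerBounds.

(** * Rank at least 1 from an even coordinate, by continuity *)

Section EvenCoordinate.
Variables (R : realType) (n : nat) (L : loop_of_loops R n).
Hypothesis n0 : (0 < n)%N.
Hypothesis hU : two_uniform L.
Local Notation C := (antipodal_cover L).
Local Notation Y := (lol_graph (antipodal_cover L)).
Local Notation et := (@et R _ C).
Local Notation vpos := (vpos C).
Local Notation ll := (ll C).
Implicit Types (j : 'I_n) (i : 'I_(n + n)) (D E F : divisor Y) (s z : R).

Let hUC : two_uniform C := two_uniform_cover hU.
Let N0 : (0 < n + n)%N := cover_gt0 n0.

Lemma vpos_rshift j : vpos (rshift n j) = vpos (lshift n j) + Lam L.
Proof.
have := et_proj n0 (inl (inl (rshift n j)) : point Y).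
have := et_proj n0 (inl (inl (lshift n j)) : point Y).
rewrite /= reduce_lshift reduce_rshift. rewrite /half_of /half /=. move=> -> /eqP.
rewrite leq_addr leqNgt ltn_ord /= mul0r subr0 mul1r => /eqP e.
by rewrite !vposE; lra.
Qed.

Lemma canon_et_vpos :
  canon_et L = \sum_j (2 * vpos (lshift n j) + ll (lshift n j)).
Proof.
rewrite /canon_et ev_canonical sum_vert -big_split; apply: eq_bigr => j _ /=.
have := et_proj n0 (inl (inl (lshift n j)) : point Y).
rewrite /= reduce_lshift /half_of /half /= leqNgt ltn_ord mul0r subr0 => e.
by rewrite et_w// vposE e ll_cover reduce_lshift -/(vpos _); ring.
Qed.

Lemma lipschitz_IVT (f : R -> R) a b v : a <= b -> f a <= v <= f b ->
  (forall z z', z <= z' -> f z <= f z' <= f z + 2 * (z' - z)) ->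
  exists2 z, a <= z <= b & f z = v.
Proof.
move=> ab fv hf; have [||z zab <-] := @IVT R f a b v ab; last by exists z => //; rewrite in_itv in zab.
  apply: continuous_subspaceT => z; apply/cvgrPdist_lt => e e0; near=> w.
  have wz : `|z - w| < e / 2 by near: w; apply: cvgr_dist_lt => //; rewrite divr_gt0.
  have := hf z w; have := hf w z; move: wz; rewrite !ltr_norml.
  by have [h|h] := orP (le_total z w); rewrite h => *; lra.
by rewrite ge_min le_max; case/andP: fv => -> ->; rewrite orbT.
Unshelve. all: by end_near.
Qed.

Variables (j0 : 'I_n) (x : 'I_n -> R).
Local Notation l := (lshift n j0).
Local Notation r := (rshift n j0).
Let P i := reduce_idx i != j0.
Let lr i : R := (i < l)%N%:R + (i < r)%N%:R.
Let e := canon_et L + (n%:R - 1) * Lam L.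

(** The angles on two antipodal loops add up to 1 modulo 2, so by [dist2_antipode] their chips are
    placed symmetrically and [x] drops out. *)
Lemma sum_pairs (c : int) :
  \sum_(i | P i) (vpos i + ll i * dist2 (coord false x i + c%:~R + lr i)) =
  e - 2 * vpos l - ll l.
Proof.
rewrite (sum_reduce (T := R) [pred j | j != j0]) /e canon_et_vpos [in RHS](bigD1 j0)//=.
rewrite (eq_bigr (fun j => 2 * vpos (lshift n j) + ll (lshift n j) + Lam L)) => [|j _].
  rewrite big_split /= sumr_const cardC1 card_ord -[Lam L *+ _]mulr_natl.
  have -> : (n%:R : R) = n.-1%:R + 1 by rewrite natr1 prednK.
  by ring.

rewrite coord_lshift coord_rshift vpos_rshift !ll_cover reduce_rshift reduce_lshift.
have -> : false%:R - x j + c%:~R + lr (rshift n j) =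
    1 - (x j + c%:~R + lr (lshift n j)) + 2 * (c + (j < j0)%N%:Z)%:~R.
  rewrite /lr /= ltn_add2l (_ : (j < n + j0)%N) ?ltn_addr//.
  have -> : (n + j < j0)%N = false by have := ltn_ord j0; lia.
  rewrite intrD -pmulrn /=. ring.
rewrite dist2_shift dist2_antipode; ring.
Qed.


(** When one chip moves, those on the other loops react, but in total by no more than its own
    motion. This makes [Phi] monotone in both variables and 2-Lipschitz in [z]. *)
Lemma sum_dist2_diff (A B : 'I_(n + n) -> R) z z' : z <= z' ->
  (forall i, `|A i - B i| <= clamp2 C i z' - clamp2 C i z) ->
  \sum_(i | P i) (vpos i + ll i * dist2 (A i)) -
    \sum_(i | P i) (vpos i + ll i * dist2 (B i)) <= z' - z.
Proof.
move=> zz AB; apply: le_trans (clamp2_sum hUC zz); rewrite -sumrB.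
rewrite [leRHS](bigID P) /= -[leLHS]addr0; apply: lerD; last first.
  by apply: sumr_ge0 => i _; rewrite mulr_ge0 ?subr_ge0 ?clamp2_le// ltW ?ll_gt0.
apply: ler_sum => i _; rewrite opprD addrACA subrr add0r -mulrBr ler_wpM2l ?(ltW (ll_gt0 _ _))//.
exact: le_trans (dist2_lipschitz _ _) (AB i).
Qed.

(* The position on the universal cover of the circle of the sum of the chips at
   [s] (reflected if [sg = -1]) and [z] and of those on the other loops. *)
Let Phi (sg s z : R) : R := s + z + \sum_(i | P i) (vpos i +
  ll i * dist2 (coord false x i + 1 + lr i - sg * clamp2 C i s - clamp2 C i z)).

Lemma Phi_lipschitz sg s z z' : z <= z' ->
  Phi sg s z <= Phi sg s z' <= Phi sg s z + 2 * (z' - z).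
Proof.
move=> zz; pose A w i := coord false x i + 1 + lr i - sg * clamp2 C i s - clamp2 C i w.
have AE w w' i : A w i - A w' i = clamp2 C i w' - clamp2 C i w by rewrite /A; ring.
have h1 : forall i, `|A z i - A z' i| <= clamp2 C i z' - clamp2 C i z.
  by move=> i; rewrite AE ger0_norm// subr_ge0 clamp2_le.
have h2 : forall i, `|A z' i - A z i| <= clamp2 C i z' - clamp2 C i z.
  by move=> i; rewrite distrC.
have := sum_dist2_diff zz h1; have := sum_dist2_diff zz h2; rewrite /Phi /A; lra.
Qed.

Lemma Phi_le sg s s' z : sg = 1 \/ sg = -1 -> s <= s' -> Phi sg s z <= Phi sg s' z.
Proof.
move=> hsg ss; pose A w i := coord false x i + 1 + lr i - sg * clamp2 C i w - clamp2 C i z.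
suff h : forall i, `|A s i - A s' i| <= clamp2 C i s' - clamp2 C i s.
  by have := sum_dist2_diff ss h; rewrite /Phi /A; lra.
move=> i; have c0 := clamp2_le C i ss; have -> : A s i - A s' i = sg * (clamp2 C i s' - clamp2 C i s).
  by rewrite /A; ring.
by rewrite normrM [X in _ * X]ger0_norm ?subr_ge0//; case: hsg => ->; rewrite ?normrN normr1 mul1r.
Qed.

(** If the two free chips shift the angles of all other loops by the same integer modulo 2, these
    loops fall under [sum_pairs] and the position is explicit. *)
Lemma Phi_balanced sg s z (c : int) :
  (forall i, P i -> exists m : int, 1 - sg * clamp2 C i s - clamp2 C i z = c%:~R + 2 * m%:~R) ->
  Phi sg s z = s + z + e - 2 * vpos l - ll l.
Proof.
move=> h; have := sum_pairs c; rewrite /Phi => sumE.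
rewrite (eq_bigr (fun i => vpos i + ll i * dist2 (coord false x i + c%:~R + lr i))).
  by rewrite sumE; ring.
move=> i Pi; congr (_ + _ * _); have [m hm] := h i Pi; rewrite -[RHS](dist2_shift _ m).
by congr dist2; lra.
Qed.

Lemma clamp2_vertex i o : P i -> ~~ P o ->
  [/\ clamp2 C i (vpos o) = (i < o)%N%:R, clamp2 C i (vpos o + ll o) = (i < o)%N%:R
    & clamp2 C i (Lam C + vpos o) = 1 + (i < o)%N%:R].
Proof.
move=> Pi Po; have io : i != o by apply: contraNneq Po => <-.
by rewrite -et_w addrC clamp2_kap1// !vposE !clamp2_kap//= (leq_neq_lt io).
Qed.

(** The two free chips sit at the two ends of the loop [l], or of the loop [r]; seen from any other
    loop these ends are indistinguishable up to a full turn, so [Phi_balanced] applies. *)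
Lemma Phi_ends sg : sg = 1 \/ sg = -1 ->
  [/\ Phi sg (vpos l + ll l) (Lam C + vpos l) = e + Lam C,
      Phi sg (vpos r) (vpos r + ll r) = e + Lam C,
      Phi sg (Lam C + vpos l) (vpos l + ll l) = e + Lam C
    & Phi sg (vpos r + ll r) (vpos r) = e + Lam C].
Proof.
have Pl : ~~ P l by rewrite /P reduce_lshift negbK.
have Pr : ~~ P r by rewrite /P reduce_rshift negbK.
have er := vpos_rshift j0.
have ellr : ll r = ll l by rewrite !ll_cover reduce_lshift reduce_rshift.
move=> hsg; split.
- rewrite (@Phi_balanced _ _ _ 0) => [|i Pi]; first by ring.
  have [_ -> ->] := clamp2_vertex Pi Pl; case: hsg => ->.
    by exists (- (i < l)%N%:Z); rewrite intrN -pmulrn; ring.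
  by exists 0; ring.
- rewrite (@Phi_balanced _ _ _ 1) => [|i Pi]; first by rewrite er ellr Lam_cover; lra.
  have [-> -> _] := clamp2_vertex Pi Pr; case: hsg => ->.
    by exists (- (i < r)%N%:Z); rewrite intrN -pmulrn; ring.
  by exists 0; ring.
- rewrite (@Phi_balanced _ _ _ 0) => [|i Pi]; first by ring.
  have [_ -> ->] := clamp2_vertex Pi Pl; case: hsg => ->.
    by exists (- (i < l)%N%:Z); rewrite intrN -pmulrn; ring.
  by exists 1; ring.
- rewrite (@Phi_balanced _ _ _ 1) => [|i Pi]; first by rewrite er ellr Lam_cover; lra.
  have [-> -> _] := clamp2_vertex Pi Pr; case: hsg => ->.
    by exists (- (i < r)%N%:Z); rewrite intrN -pmulrn; ring.
  by exists 0; ring.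
Qed.

(** Monotonicity in [s] compares with the configurations of [Phi_ends], which bracket the target
    value. The two chips stay on the opposite arcs that remain between the loops [l] and [r]. *)
Lemma Phi_solution sg s : sg = 1 \/ sg = -1 ->
  vpos l + ll l <= s <= vpos r \/ vpos r + ll r <= s <= Lam C + vpos l ->
  exists2 z, vpos r + ll r <= z <= Lam C + vpos l /\ vpos l + ll l <= s <= vpos r \/
    vpos l + ll l <= z <= vpos r /\ vpos r + ll r <= s <= Lam C + vpos l
  & Phi sg s z = e + Lam C.
Proof.
move=> hsg hs; have [e1 e2 e3 e4] := Phi_ends hsg.
have lrle : vpos l + ll l <= vpos r.
  by apply: (@et_after _ _ _ hUC (inl (inl r))) => /=; exact: ltn_addr.
have rlle : vpos r + ll r <= Lam C + vpos l.
  by apply: (le_trans (wpos_le hUC r)); rewrite lerDl vpos_ge0.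
case: hs => /andP[s1 s2].
  have [|z zz ez] := lipschitz_IVT (v := e + Lam C) rlle _ (Phi_lipschitz sg s).
    by rewrite -{1}e2 -e1 !Phi_le.
  by exists z => //; left; rewrite s1.
have [|z zz ez] := lipschitz_IVT (v := e + Lam C) lrle _ (Phi_lipschitz sg s).
  by rewrite -{1}e3 -e4 !Phi_le.
by exists z => //; right; rewrite s1.
Qed.


Variable q0 : int.
Hypothesis x0 : x j0 = 2 * q0%:~R.

Lemma card_P : (#|P| + 2 = n + n)%N.
Proof.
rewrite -sum1_card (sum_reduce (T := nat) [pred j | j != j0] (fun=> 1%N)) sum_nat_const.
by rewrite cardC1 card_ord; lia.
Qed.

Lemma sum_P_gtn i : \sum_(i' | P i') (i < i')%N%:R = (n + n)%:R - 1 - i%:R - lr i.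
Proof.
rewrite -(sum_gtn R N0 i) [X in _ = X - _](bigID P) /= [X in _ + X - _](_ : _ = lr i) ?addrK//.
rewrite (eq_bigl (fun i => reduce_idx i == j0)) => [|i']; last by rewrite /P negbK.
by rewrite (sum_reduce (T := R) (pred1 j0)) big_pred1_eq.
Qed.


Lemma axis_cases i : ~~ P i -> exists m : int, coord false x i = 2 * m%:~R /\
  (i = l /\ lr i = 1 \/ i = r /\ lr i = 0).
Proof.
rewrite /P negbK /lr -(splitK i); case: (fintype.split i) => j /=.
  rewrite reduce_lshift => /eqP ->; rewrite coord_lshift x0 ltnn ltn_addr// add0r.
  by exists q0; split=> //; left.
rewrite reduce_rshift => /eqP ->; rewrite coord_rshift x0 ltnn.
rewrite (_ : (n + j0 < j0)%N = false); last by have := ltn_ord j0; lia.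
by exists (- q0); rewrite intrN mulrN sub0r addr0; split=> //; right.
Qed.

(** The angle [1 - th o p] places the partner of [p] symmetrically in the same loop: the sum of the
    two positions does not depend on [p], and no continuity argument is called for. *)
Lemma conjugate_loop_rank1 (o : 'I_(n + n)) p : ~~ P o ->
  (passed p <= o)%N -> (o < entered p)%N ->
  exists2 F, effective F & at_coord (L := L) false x (<< p >> + F).
Proof.
(* From [l] to [r] the sum of the two positions grows by [2 * Lam L], one turn of the cover. *)
move=> Po po op; pose k : int := (o == r)%:Z.
pose t i := if P i then coord false x i + k%:~R + lr i else 1 - th o p.
have th_p i : i != o -> th i p = (i < o)%N%:R.
  move=> io; have pp := passed_entered p.
  have e1 : passed p = o by lia.
  have ni : (i : nat) != o by apply: contraNneq io => /val_inj ->.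
  by rewrite th_outside ?e1//; lia.
have [F [F0 dF hP hnP eF]] := loops_divisor hUC (predU1 o P) t.
exists F => //.
have predD i : predU1 o P i && (i != o) = P i.
  by rewrite /=; case: eqVneq => [->|_]; rewrite ?andbF ?andbT ?(negbTE Po).
have hs i : \sum_(j | predU1 o P j) (i < j)%N%:R = (n + n)%:R - 1 - i%:R - lr i + (i < o)%N%:R.
  by rewrite (bigD1 o) /= ?eqxx// (eq_bigl _ _ predD) sum_P_gtn addrC.
have dist_o : dist2 (1 - th o p) = 1 - kap o p by rewrite dist2_antipode dist2_th.
apply: (@at_coordI _ _ _ _ _ _ k).
- rewrite degD degU dF (_ : #|predU1 o P| = #|P|.+1); first by have := card_P; lia.
  have cU : (\sum_(i | predU1 o P i) 1 = (\sum_(i | P i) 1).+1)%N.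
    by rewrite (bigD1 o) /= ?eqxx// (eq_bigl _ _ predD) add1n.
  by rewrite -!sum1_card; exact: cU.
- move=> i; rewrite raddfD /= evU mul1r.
  have [Pi|nPi] := boolP (P i).
    have io : i != o by apply: contraNneq Po => <-.
    have [|m ->] := hP i; first by rewrite /= Pi orbT.
    exists (m + (i < o)%N%:Z); rewrite hs th_p// /t Pi intrD -pmulrn; ring.
  have [m0 [ui hi]] := axis_cases nPi.
  have [eio|io] := eqVneq i o.
    have [|m ->] := hP i; first by rewrite /= eio eqxx.
    rewrite hs ui /t (negbTE nPi) eio ltnn.
    exists (m - m0); rewrite -eio intrB /k -eio -pmulrn.
    by case: hi => -[-> ->]; rewrite ?eqxx ?eq_lrshift /=; ring.
  rewrite hnP ?hs ?th_p ?ui//; last by rewrite /= negb_or io.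
  exists (- m0); rewrite intrN /k -pmulrn.
  have [_ [_ ho]] := axis_cases Po.
  case: hi io => -[-> ->]; case: ho => -[-> _] /=; rewrite ?eqxx ?eq_lrshift //= => _.
    by rewrite ltn_addr//=; ring.
  by rewrite (_ : (n + j0 < j0)%N = false) /=; [ring|have := ltn_ord j0; lia].
rewrite raddfD /= evU mul1r eF (bigD1 o) /= ?eqxx//.
rewrite (eq_bigl _ _ predD).
rewrite (eq_bigr (fun i => vpos i + ll i * dist2 (coord false x i + k%:~R + lr i))); last first.
  by move=> i Pi; rewrite /t Pi.
rewrite sum_pairs /t (negbTE Po) dist_o (et_inside hUC po op) /k -pmulrn /e.
have [_ [_ [[-> _]|[-> _]]]] := axis_cases Po.
  by rewrite eq_lrshift /=; ring.
rewrite eqxx vpos_rshift Lam_cover ll_cover reduce_rshift ll_cover reduce_lshift /=; ring.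
Qed.


Lemma Phi_rank1 p s (kp : int) sg : sg = 1 \/ sg = -1 ->
  (forall i, exists m : int, th i p = sg * clamp2 C i s - kp%:~R + 2 * m%:~R) ->
  et p = s - kp%:~R * Lam C ->
  vpos l + ll l <= s <= vpos r \/ vpos r + ll r <= s <= Lam C + vpos l ->
  exists2 F, effective F & at_coord (L := L) false x (<< p >> + F).
Proof.
move=> hsg thp etp hs; have [z hz ez] := Phi_solution hsg hs.
have l0 := ll_gt0 C l; have wl := wpos_le hUC l; have wr := wpos_le hUC r.
have vl := vpos_ge0 hUC l; have vr := vpos_ge0 hUC r; have r0 := ll_gt0 C r.
have lrle : vpos l + ll l <= vpos r.
  by apply: (@et_after _ _ _ hUC (inl (inl r))) => /=; exact: ltn_addr.
have [|y [ky [ey thy]]] := extended_point hUC N0 (z := z); first by lra.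
pose t i := coord false x i + 1 + lr i - sg * clamp2 C i s - clamp2 C i z.
have [F [F0 dF hP hnP eF]] := loops_divisor hUC P t.
exists (<< y >> + F); first by apply: effectiveD => //; exact: effective_point.
rewrite addrA; apply: (@at_coordI _ _ _ _ _ _ (1 - kp - ky)).
- by rewrite !degD !degU dF; move: card_P; move: #|P| => b cP; clear -cP; lia.
- move=> i; rewrite !raddfD /= !evU !mul1r thy; have [m1 ->] := thp i.
  have [Pi|nPi] := boolP (P i).
    have [m2 ->] := hP i Pi; exists (m1 + m2); rewrite sum_P_gtn /t !(intrD, intrB); ring.
  have [m0 [-> hi]] := axis_cases nPi; rewrite (hnP i nPi) sum_P_gtn.
  have low o w : w <= vpos o -> clamp2 C o w = 0.
    by move=> h; rewrite clamp2_low ?clamp0//; have := wpos_le hUC o; have := ll_gt0 C o; lra.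
  have mid o w : vpos o + ll o <= w -> w <= Lam C + vpos o -> clamp2 C o w = 1.
    by move=> h h'; rewrite /clamp2 clamp1// clamp0 ?addr0//; lra.
  (* Neither free chip is inside [l] or [r]: both have passed [l] and exactly one has passed [r], in
     accordance with the values 1 and 0 of [lr]. *)
  case: hi => -[ei ->]; rewrite ei.
    have -> : clamp2 C l s = 1 by apply: mid; case: hz; lra.
    have -> : clamp2 C l z = 1 by apply: mid; case: hz; lra.
    case: hsg => ->; [exists (m1 - m0)|exists (m1 - m0 - 1)];
      rewrite !intrB /=; ring.
  case: hz => -[hz1 hz2].
    have -> : clamp2 C r s = 0 by apply: low; lra.
    have -> : clamp2 C r z = 1 by apply: mid; lra.
    by exists (m1 - m0); rewrite !intrB /=; ring.
  have -> : clamp2 C r z = 0 by apply: low; lra.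
  have -> : clamp2 C r s = 1 by apply: mid; lra.
  case: hsg => ->; [exists (m1 - m0)|exists (m1 - m0 - 1)];
      rewrite !intrB /=; ring.
rewrite !raddfD /= !evU !mul1r eF etp ey.
rewrite ?(intrB, intrN).
by move: ez; rewrite /Phi /t /e; lra.
Qed.

Lemma rank_ge1_even D : at_coord false x D -> rank_ge D 1.
Proof.
move=> hD; apply/rank_geP => E E0 dE; have [p ->] := effective_deg1 n0 E0 dE.
suff [F F0 hF] : exists2 F, effective F & at_coord (L := L) false x (<< p >> + F).
  by exists F => //; apply/(at_coord_cls n0 hU _ hD).
have Pl : ~~ P l by rewrite /P reduce_lshift negbK.
have Pr : ~~ P r by rewrite /P reduce_rshift negbK.
have [sg hsg hth] := th_sign p.
(* A point before the loop [l] is read one turn later, so that it lies on the arc from [r] back to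
   [l]. *)
have far : vpos r + ll r <= et p + Lam C <= Lam C + vpos l \/
    vpos l + ll l <= et p <= vpos r \/ vpos r + ll r <= et p <= Lam C + vpos l ->
    exists2 F, effective F & at_coord (L := L) false x (<< p >> + F).
  case=> hs; last first.
    apply: (@Phi_rank1 p (et p) 0 sg) => //; last by rewrite mul0r subr0.
    by move=> i; have [m ->] := hth i; exists m; rewrite clamp2_kap// subr0.
  apply: (@Phi_rank1 p (et p + Lam C) 1 sg) => //; last by right.
  - move=> i; have [m ->] := hth i; rewrite clamp2_kap1//.
    by case: hsg => ->; [exists m|exists (m + 1)]; rewrite ?intrD; ring.
  by rewrite mul1r addrK.
have [pl|lp] := leqP (entered p) l.
  apply: far; left; have := et_before hUC pl; have := et_ge0 hUC p.
  by have := wpos_le hUC r; lra.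
have [pl|{}lp'] := leqP (passed p) l; first exact: conjugate_loop_rank1 Pl pl lp.
have h1 := et_after hUC lp'.
have [pr|rp] := leqP (entered p) r.
  by apply: far; right; left; rewrite h1 et_before.
have [pr|rp'] := leqP (passed p) r; first exact: conjugate_loop_rank1 Pr pr rp.
apply: far; right; right; have := et_after hUC rp'; have := et_le_Lam hUC p.
by have := vpos_ge0 hUC l; lra.
Qed.

End EvenCoordinate.

(** * Tori in the fibre of the norm and their adjacency *)

Section Tori.
Variables (R : realType) (n : nat) (L : loop_of_loops R n).
Hypothesis n0 : (0 < n)%N.
Hypothesis hU : two_uniform L.
Local Notation C := (antipodal_cover L).
Local Notation Y := (lol_graph (antipodal_cover L)).
Local Notation et := (@et R _ C).
Implicit Types (j : 'I_n) (i : 'I_(n + n)) (D E F : divisor Y) (M : {set 'I_n}).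
Implicit Types (x b : 'I_n -> R) (eps : bool).

Let hUC : two_uniform C := two_uniform_cover hU.
Let N0 : (0 < n + n)%N := cover_gt0 n0.

Lemma at_coord_exists eps x : exists D, at_coord (L := L) eps x D.
Proof.
have [F [F0 dF hP _ eF]] := loops_divisor hUC xpredT (coord eps x).
pose p0 : point Y := inl (inl (Ordinal N0)).
have th0 i : th i p0 = 0 by [].
have et0 : et p0 = 0 by exact: vpos0.
have [q [q' [k [eq hq]]]] := conjugate_pair hUC N0
  (canon_et L + (n%:R - 1 + eps%:R) * Lam L - ev et F).
exists (F + << q >> + << q' >> - << 2 *g p0 >>); apply: (at_coordI (k := 2 * k)).
- by rewrite degB !degD !degU dF cardT size_enum_ord; lia.
- move=> i; have [m1 e1] := hP i isT; have [m2 e2] := hq i.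
  rewrite evB !evD !evU !mul1r th0 mulr0 e1 sum_gtn//.
  by exists (m1 + m2 - k); rewrite intrB !intrD intrM; lra.
by rewrite evB !evD !evU !mul1r et0 mulr0 intrM; lra.
Qed.

Lemma at_coord_uniq eps eps' x x' D : at_coord (L := L) eps x D -> at_coord eps' x' D ->
  eps = eps' /\ forall j, exists q : int, x j = x' j + 2 * q%:~R.
Proof.
move=> [_ [m [k [hm hk]]]] [_ [m' [k' [hm' hk']]]].
have Lam0 : Lam L != 0 by have := Lam_gt0 C N0; rewrite Lam_cover; case: eqP => // ->; rewrite mulr0 ltxx.
have ek : eps%:R + 2 * k%:~R = eps'%:R + 2 * k'%:~R :> R.
  by apply: (mulIf Lam0); move: hk'; rewrite hk Lam_cover; lra.
have {}ek : eps%:Z + 2 * k = eps'%:Z + 2 * k'.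
  by apply: (@intr_inj R); rewrite !intrD !intrM -!pmulrn.
have e : eps = eps' by case: eps eps' ek {hm hk hm' hk'} => [] [] //; lia.
split=> // j; exists (m' (lshift n j) - m (lshift n j)).
have ekk : k = k' by rewrite e in ek; lia.
have := hm' (lshift n j); rewrite hm -ekk !coord_lshift intrB; lra.
Qed.

Definition torus eps M b : set (Pic Y) := [set cls D | D in [set D | exists2 x,
  at_coord eps x D & forall j, j \in M -> exists q : int, x j = b j + 2 * q%:~R]].

Lemma torusP eps M b D : torus eps M b (cls D) <-> exists2 x,
  at_coord eps x D & forall j, j \in M -> exists q : int, x j = b j + 2 * q%:~R.
Proof.
split=> [[E [x hE hx] /(at_coord_cls n0 hU _ hE)]|h]; last by exists D.
by exists x.
Qed.

Lemma cycleB (z z' : edge Y -> int) : cycle z -> cycle z' -> cycle (fun e => z e - z' e).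
Proof. by move=> h h' v; rewrite !sumrB h h'. Qed.

Lemma cycle_intB (z z' : edge Y -> int) (w : edge Y -> R) :
  cycle_int (fun e => z e - z' e) w = cycle_int z w - cycle_int z' w.
Proof. by rewrite -sumrB; apply: eq_bigr => e _; rewrite intrB mulrBl mulrBr. Qed.

(** Direction in which [x j] varies along the fibre of the norm: the angles on antipodal loops move
    oppositely and the position is fixed. *)
Definition antisym_cycle j (e : edge Y) : int :=
  loop_cycle (lshift n j) e - loop_cycle (rshift n j) e.

Lemma antisym_cycle_om j i : cycle_int (antisym_cycle j) (om i) =
  2 * (i == lshift n j)%:R - 2 * (i == rshift n j)%:R.
Proof. by rewrite cycle_intB !cycle_int_loop_om. Qed.

Lemma antisym_cycle_eta j : cycle_int (antisym_cycle j) (@eta R _ C) = 0.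
Proof. by rewrite cycle_intB !(cycle_int_loop_eta hUC) subrr. Qed.

Lemma torus_subtorus eps M b : translated_subtorus #|~: M| (torus eps M b).
Proof.
have [D0 hD0] := at_coord_exists eps b.
pose c (a : 'I_#|~: M|) : 'I_n := enum_val a.
exists D0, (fun a => antisym_cycle (c a)); split.
- by move=> a; apply: cycleB; exact: cycle_loop_cycle.
- move=> y hy a; have := hy (inl (lshift n (c a), true)).
  rewrite (bigD1 a)//= big1 => [|a' aa'].
    by rewrite /antisym_cycle /= eqxx eq_lrshift /= addr0 (_ : _%:~R = 1) ?mulr1.
  rewrite /antisym_cycle /= (inj_eq (@lshift_inj _ _)) (inj_eq enum_val_inj).
  by rewrite eq_sym (negbTE aa') eq_lrshift subr0 mulr0.
pose X (y : 'I_#|~: M| -> R) j := \sum_a y a * (j == c a)%:R.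
have Xin y j : j \in M -> X y j = 0.
  move=> jM; rewrite /X big1// => a _; case: eqP => [e|_]; last by rewrite mulr0.
  by have := enum_valP a; rewrite inE -/(c a) -e jM.
have spanY (y : 'I_#|~: M| -> R) :
    spanned N0 (fun w => \sum_a y a * cycle_int (antisym_cycle (c a)) w).
  by apply: spanned_sum => a; exact: spanned_cycle.
have omY (y : 'I_#|~: M| -> R) i : \sum_a y a * cycle_int (antisym_cycle (c a)) (om i) =
    coord false (fun j => 2 * X y j) i.
  rewrite -(splitK i); case: (fintype.split i) => j /=.
    rewrite coord_lshift mulr_sumr; apply: eq_bigr => a _; rewrite antisym_cycle_om.
    by rewrite (inj_eq (@lshift_inj _ _)) eq_lrshift mulr0; ring.
  rewrite coord_rshift sub0r mulr_sumr -sumrN; apply: eq_bigr => a _; rewrite antisym_cycle_om.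
  by rewrite (inj_eq (@rshift_inj _ _)) eq_rlshift mulr0; ring.
have etaY (y : 'I_#|~: M| -> R) : \sum_a y a * cycle_int (antisym_cycle (c a)) (@eta R _ C) = 0.
  by rewrite big1// => a _; rewrite antisym_cycle_eta mulr0.
have [dD0 [m0 [k0 [hm0 hk0]]]] := hD0.
congr image; apply/seteqP; split=> D /=.
  move=> [x [dD [m [k [hm hk]]]] xb].
  have : forall j, exists q : int, j \in M -> x j = b j + 2 * q%:~R.
    by move=> j; case: (boolP (j \in M)) => [/xb[q]|_]; [exists q|exists 0].
  (* Off [M] the real parameter absorbs the whole difference, so an integral correction is made on
     [M] only. *)
  move/choice => [q hq]; pose q' j := if j \in M then q j else 0.
  (* The 2 is the integral of [om] along its loop. *)
  pose y a := (x (c a) - b (c a)) / 2; exists y; apply/(abel_jacobiP hUC _ (spanY y)).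
  have xE j : x j = b j + 2 * X y j + 2 * (q' j)%:~R.
    rewrite /q'; case: (boolP (j \in M)) => jM; first by rewrite hq// Xin// mulr0 addr0.
    have jM' : j \in ~: M by rewrite inE.
    rewrite mulr0 addr0 /X (bigD1 (enum_rank_in jM' j))//= big1 => [|a na].
      by rewrite /y /c enum_rankK_in// eqxx mulr1 addr0; field.
    case: eqP => [e|_]; last by rewrite mulr0.
    by case/eqP: na; apply: enum_val_inj; rewrite -/(c a) -e enum_rankK_in.
  split; first by rewrite degB dD dD0 subrr.
  exists (fun i => m i - m0 i + match fintype.split i with inl j => q' j | inr j => - q' j end), (k - k0).
  rewrite etaY evB hk hk0 intrB; split; last by ring.
  move=> i; rewrite evB hm hm0 omY /coord !(intrD, intrB).
  by case: (fintype.split i) => j; rewrite ?intrN xE /=; ring.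
move=> [y /(abel_jacobiP hUC _ (spanY y))[dD [m [k [hm]]]]].
rewrite etaY add0r evB => hk.
exists (fun j => b j + 2 * X y j); last by move=> j jM; exists 0; rewrite Xin//; ring.
split; first by move: dD; rewrite degB dD0 => /eqP; rewrite subr_eq0 => /eqP.
exists (fun i => m i + m0 i), (k + k0); split; last by move: hk; rewrite hk0 intrD; lra.
move=> i; have := hm i; rewrite evB hm0 omY /coord !intrD.
by case: (fintype.split i) => j /=; lra.
Qed.

Lemma torus_dim eps M b : has_dim (torus eps M b) #|~: M|.
Proof.
exists [set torus eps M b]; split; first exact: finite_set1.
- by move=> _ ->; exists #|~: M| => //; exact: torus_subtorus.
- by exists (torus eps M b) => //; exact: torus_subtorus.
- by rewrite bigcup_set1.
Qed.

Lemma torus_setI eps M M' b b' : (forall j, j \in M :&: M' ->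
    exists q : int, b j = b' j + 2 * q%:~R) ->
  torus eps M b `&` torus eps M' b' =
  torus eps (M :|: M') (fun j => if j \in M then b j else b' j).
Proof.
move=> bb'; apply/seteqP; split=> [_ [[D hD <-] /torusP hD']|_ [D [x hx h] <-]].
  have [x hx h] := hD; have [x' hx' h'] := hD'.
  have [_ xx'] := at_coord_uniq hx hx'; apply/torusP; exists x => // j.
  rewrite inE; case: (boolP (j \in M)) => /= [jM _|jM jM']; first exact: h.
  have [q e] := xx' j; have [q' e'] := h' j jM'.
  by exists (q + q'); rewrite e e' intrD; ring.
split; apply/torusP; exists x => // j jM; have := h j; rewrite inE jM ?orbT /=; first exact.
case: (boolP (j \in M)) => [jM1|_]; last exact.
move=> [//|q ->]; have [|q' ->] := bb' j; first by rewrite inE jM1.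
by exists (q + q'); rewrite intrD; ring.
Qed.

Lemma torus_codim1 eps M M' b b' : (forall j, j \in M :&: M' ->
    exists q : int, b j = b' j + 2 * q%:~R) -> #|M :|: M'| = #|M|.+1 ->
  has_codim1 (torus eps M b `&` torus eps M' b') (torus eps M b).
Proof.
move=> bb' cM; rewrite torus_setI//; exists #|~: (M :|: M')|; split; first exact: torus_dim.
have := cardsC M; have := cardsC (M :|: M'); rewrite cM => h1 h2.
by rewrite (_ : _.+1 = #|~: M|); [exact: torus_dim|lia].
Qed.

Lemma torus_subset eps M M' b b' : #|M| = #|M'| ->
  torus eps M b `<=` torus eps M' b' -> torus eps M' b' = torus eps M b.
Proof.
(* A test point of the first torus: off [M] it misses [b'] by 1, which is not even, so that it lies
   on the second torus only if [M'] is contained in [M]. *)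
move=> cM sub; pose x j := if j \in M then b j else b' j + 1.
have [D hD] := at_coord_exists eps x.
have /sub/torusP[x' hx' h'] : torus eps M b (cls D).
  by apply/torusP; exists x => // j jM; exists 0; rewrite /x jM mulr0 addr0.
have [_ xx'] := at_coord_uniq hD hx'.
have xb' j : j \in M' -> exists q : int, x j = b' j + 2 * q%:~R.
  move=> jM; have [q e] := xx' j; have [q' e'] := h' j jM.
  by exists (q + q'); rewrite e e' intrD; ring.
have eM : M' = M.
  apply/eqP; rewrite eqEcard cM leqnn andbT; apply/fintype.subsetP => j jM'.
  have [q] := xb' j jM'; rewrite /x; case: (j \in M) => // /addrI e.
  have {}e : 1 = 2 * q by apply: (@intr_inj R); rewrite intrM.
  lia.
rewrite eM; congr image; apply/seteqP; split=> E /= [y hy h]; exists y => // j jM;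
  have [q e] := h j jM; have [|q' e'] := xb' j; rewrite ?eM//; move: e'; rewrite /x jM => e'.
  by exists (q - q'); rewrite e e' intrB; ring.
by exists (q + q'); rewrite e e' intrD; ring.
Qed.

End Tori.

(** * The conditions on the rank expressed in coordinates *)

Section Classification.
Variables (R : realType) (n : nat) (L : loop_of_loops R n).
Hypothesis n0 : (0 < n)%N.
Hypothesis hU : two_uniform L.
Local Notation C := (antipodal_cover L).
Local Notation Y := (lol_graph (antipodal_cover L)).
Implicit Types (j : 'I_n) (D : divisor Y) (x : 'I_n -> R) (y : nat -> bool) (eps : bool).

Definition change_set y (t : nat) : {set 'I_n} :=
  [set j : 'I_n | (j < t)%N && (y j.+1 != y j)].

Lemma sum_change_set y (t s : nat) : (s <= t)%N -> (t <= n)%N ->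
  (\sum_(k in change_set y t) (k < s))%N = changes y s.
Proof.
move=> st tn; rewrite /changes big_mkord (big_ord_widen n (fun l => (y l.+1 != y l : nat))) ?(leq_trans st)//.
rewrite big_mkcond [RHS]big_mkcond; apply: eq_bigr => k _ /=; rewrite inE.
case: (ltnP k s) => ks; first by rewrite (leq_trans ks st) /=; case: (_ != _).
by case: ifP.
Qed.

Lemma card_change_set y t : (t <= n)%N -> #|change_set y t| = changes y t.
Proof.
move=> tn; rewrite -(sum_change_set y (leqnn t) tn) -sum1_card; apply: eq_bigr => k.
by rewrite inE => /andP[->].
Qed.

(** The first change leads from [y 0] to its opposite, hence the initial residue [~~ y 0]. *)
Lemma change_set_alternating eps x y t : filling eps x y -> (t <= n)%N ->
  alternating (change_set y t) (~~ y 0%N) x.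
Proof.
move=> [hi hn _] tn j; rewrite inE => /andP[jt ch].
have xi : x j \is a Num.int by apply: contraT => ni; rewrite (hn j ni) eqxx in ch.
rewrite /index_in (sum_change_set y (ltnW jt) tn).
have : y j.+1 = odd (~~ y 0%N + changes y j).
  by have := changes_odd y j; move: ch; rewrite oddD; case: (y j.+1); case: (y j);
    case: (y 0%N); case: (odd _).
rewrite (hi j xi); have /intrP[z ez] := xi; rewrite ez intrKfloor => e.
have [q eq] := oddzP z; rewrite e in eq; move: (~~ y 0%N + _)%N eq {e} => a eq.
exists (q - a./2%:Z); rewrite eq -{2}(odd_double_half a) -mul2n natrD natrM.
by rewrite intrD intrM intrB -!pmulrn; ring.
Qed.

Section Ranks.
Variables (eps : bool) (x : 'I_n -> R) (D : divisor Y).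
Hypothesis hD : at_coord eps x D.

Let p0 : point Y := inl (inl (Ordinal (cover_gt0 n0))).

Lemma filling_parity y : filling eps x y -> eps = odd (changes y n).
Proof. by case=> _ _; rewrite (changes_odd y n); case: (y 0%N); case: eps; case: (odd _). Qed.

Lemma rk_changes y : filling eps x y -> (0 < changes y n)%N -> rk D = (changes y n).-1%:Z.
Proof.
move=> hy y0; have cM := card_change_set y (leqnn n).
apply: rk_eq => [|s hs].
  rewrite -cM; apply: (rank_ge_alternating n0 hU hD (change_set_alternating hy (leqnn n))).
    by rewrite cM.
  by rewrite cM; exact: filling_parity.
rewrite -ltnS prednK// ltnNge; apply/negP => sy.
apply: (not_rank_ge_changes n0 hU hD hy); first by move=> e; rewrite e in y0.
exact: rank_ge_le p0 sy hs.
Qed.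

Lemma rk_unchanged y j0 : filling eps x y -> x j0 \is a Num.int -> changes y n = 0%N ->
  1 <= rk D -> [/\ eps = false, rk D = 1 & exists q : int, x j0 = 2 * q%:~R].
Proof.
move=> hy x0 cy; have e0 : eps = false by rewrite (filling_parity hy) cy.
move=> D1; have [|k [ek hk _]] := @rkP _ _ D; first by lia.
have k2 : (k < 2)%N.
  rewrite ltnNge; apply/negP => k2; apply: (not_rank_ge2 n0 hU hD hy x0 cy).
  exact: rank_ge_le p0 k2 hk.
split=> //; first by lia.
have y0 : y 0%N = false.
  apply/negP => y0; apply: (not_rank_ge_changes n0 hU hD hy (fun=> y0)).
  by apply: rank_ge_le p0 _ hk; rewrite cy.
have [hi _ _] := hy; have := hi j0 x0; have /intrP[z ez] := x0.
rewrite ez intrKfloor; have [q eq] := oddzP z.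
have const k' : (k' <= n)%N -> y k' = false.
  elim: k' => [//|k' IH] kn; have := cy; rewrite /changes (big_cat_nat (n := k')) ?(ltnW kn)//=.
  rewrite (big_ltn kn) => /eqP; rewrite !addn_eq0 => /andP[_ /andP[+ _]].
  by rewrite (IH (ltnW kn)); case: (y _).
rewrite const// => /esym e; exists q; rewrite eq e add0r intrM; ring.
Qed.

Lemma exists_int_coord : 1 <= rk D -> exists j, x j \is a Num.int.
Proof.
move=> D1; have [|k [ek hk _]] := @rkP _ _ D; first by lia.
apply/not_existsP => h; apply: (not_rank_ge1 n0 hU hD) => [j|]; first by apply/negP; exact: h.
by apply: rank_ge_le p0 _ hk; lia.
Qed.

Lemma changes_ge y (m : nat) : (m <= changes y n)%N -> exists2 t, (t <= n)%N & changes y t = m.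
Proof.
elim: (n) => [|t IH]; first by rewrite /changes big_geq// leqn0 => /eqP ->; exists 0%N; rewrite ?big_geq.
rewrite changesS => mt; have [|tm] := leqP m (changes y t).
  by move=> /IH[t' tt e]; exists t' => //; exact: leqW.
by exists t.+1 => //; rewrite changesS; move: mt tm; case: (_ != _); lia.
Qed.

(** The number of changes has the parity of [eps], which takes care of the congruence. The first
    [r.+1] changes form an [M]; conversely an [M] gives rank at least 2, which excludes a constant
    parity. *)
Lemma rank_locus (r : nat) : (2 <= r)%N -> r%:Z <= rk D /\ (rk D = r%:Z %[mod 2])%Z <->
  eps = odd r.+1 /\ exists (M : {set 'I_n}) c, #|M| = r.+1 /\ alternating M c x.
Proof.
move=> r2; split.
  move=> [rD par]; have [|j0 x0] := exists_int_coord; first by lia.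
  have [y hy] := filling_exists eps x0; have [cy|cy] := posnP (changes y n).
    by have [|_ e _] := rk_unchanged hy x0 cy; lia.
  have eD := rk_changes hy cy; rewrite eD in rD par; split.
    by rewrite (filling_parity hy); lia.
  have [|t tn ct] := @changes_ge y r.+1; first by lia.
  exists (change_set y t), (~~ y 0%N); rewrite card_change_set//; split=> //.
  exact: change_set_alternating hy tn.
move=> [er [M [c [cM hM]]]].
have rD : rank_ge D r.
  by have := rank_ge_alternating n0 hU hD hM; rewrite cM; exact.
have [j0 j0M] : exists j, j \in M by apply/set0Pn; rewrite -card_gt0 cM.
have x0 : x j0 \is a Num.int.
  have [q ->] := hM j0 j0M; rewrite rpredD ?rpredM ?natr_int ?intr_int//.
have [y hy] := filling_exists eps x0; have [cy|cy] := posnP (changes y n).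
  by case: (not_rank_ge2 n0 hU hD hy x0 cy); exact: rank_ge_le p0 r2 rD.
have eD := rk_changes hy cy.
have [|k [ek _ hk]] := @rkP _ _ D; first by rewrite eD.
have := hk r rD; have := filling_parity hy; rewrite er; lia.
Qed.

(** For [eps] false the number of changes is even; if it is positive both parities occur, and if it
    is 0 the constant parity must be even. *)
Lemma rank1_locus : 1 <= rk D /\ (rk D = 1 %[mod 2])%Z <->
  eps = false /\ exists j, exists q : int, x j = 2 * q%:~R.
Proof.
split.
  move=> [rD par]; have [j0 x0] := exists_int_coord rD.
  have [y hy] := filling_exists eps x0; have [cy|cy] := posnP (changes y n).
    by have [e _ eq] := rk_unchanged hy x0 cy rD; split=> //; exists j0.
  have eD := rk_changes hy cy; rewrite eD in rD par.
  have e0 : eps = false by rewrite (filling_parity hy); lia.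
  split=> //; apply: contrapT => none.
  (* Without even coordinates the filling can only pass from [false] to [true], hence at most once;
     as it closes up for [eps] false, it does not change at all. *)
  have mono t : (t <= n)%N -> changes y t = (y t != y 0%N) /\ (y 0%N -> y t).
    elim: t => [_|t IH tn]; first by rewrite /changes big_geq// eqxx.
    have [ct yt] := IH (ltnW tn).
    suff : y t -> y t.+1.
      rewrite changesS ct; move: yt; case: (y t); case: (y 0%N); case: (y t.+1) => // h1 h2;
        by [have := h1 isT|have := h2 isT].
    move=> yt1; have [hi hn _] := hy; pose j := Ordinal tn.
    have [xi|xn] := boolP (x j \is a Num.int); last by rewrite (hn j xn).
    rewrite (hi j xi); apply: contraT => /negbTE odd0; case: none; exists j.
    have /intrP[z ez] := xi; have [q eq] := oddzP z; exists q.
    by move: odd0; rewrite ez intrKfloor => odd0; rewrite eq odd0 add0r intrM; ring.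
  have [cn _] := mono n (leqnn n); have [_ _ yn] := hy.
  by rewrite cn yn e0 addbF eqxx in cy.
move=> [e0 [j0 [q eq]]].
have D1 : rank_ge D 1 by apply: (rank_ge1_even n0 hU eq); rewrite -e0.
have x0 : x j0 \is a Num.int by rewrite eq rpredM ?natr_int ?intr_int.
have [y hy] := filling_exists eps x0; have [cy|cy] := posnP (changes y n).
  suff -> : rk D = 1 by [].
  apply: (@rk_eq _ _ D 1) => // s hs; rewrite -ltnS ltnNge; apply/negP => s2.
  by apply: (not_rank_ge2 n0 hU hD hy x0 cy); exact: rank_ge_le p0 s2 hs.
have eD := rk_changes hy cy.
have [|k [ek _ hk]] := @rkP _ _ D; first by rewrite eD.
have := hk 1%N D1; have := filling_parity hy; rewrite e0; lia.
Qed.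

End Ranks.
End Classification.

(** * Combinatorics of exchanges between index sets *)

Section ExchangeGraph.
Variable n : nat.
Implicit Types (j k : 'I_n) (M : {set 'I_n}) (c : bool).

Definition initial (m : nat) : {set 'I_n} := [set j : 'I_n | (j < m)%N].

Lemma sum_initial (s t : nat) : (s <= t)%N -> (t <= n)%N ->
  (\sum_(k in initial t) (k < s))%N = s.
Proof.
move=> st tn; rewrite -[RHS]card_ord -sum1_card.
rewrite (big_ord_widen n (fun=> 1%N)) ?(leq_trans st)//.
rewrite big_mkcond [RHS]big_mkcond; apply: eq_bigr => k _ /=; rewrite inE.
by case: (ltnP k s) => ks; [rewrite (leq_trans ks st)|case: ifP].
Qed.

Lemma card_initial (t : nat) : (t <= n)%N -> #|initial t| = t.
Proof.
move=> tn; rewrite -[RHS](sum_initial (leqnn t) tn) -sum1_card.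
by apply: eq_bigr => k; rewrite inE => ->.
Qed.

Lemma downclosed_initial M : (forall j k, j \in M -> k.+1 = j :> nat -> k \in M) ->
  M = initial #|M|.
Proof.
move=> down; have cM : (#|M| <= n)%N by rewrite -[leqRHS]card_ord max_card.
apply/eqP; rewrite eqEcard card_initial// leqnn andbT; apply/fintype.subsetP => j jM.
rewrite inE -[X in (X < _)%N](card_initial (ltnW (ltn_ord j))).
have sub d k : (k + d = j)%N -> k \in M.
  elim: d k => [|d IH] k kd; first by rewrite (_ : k = j)//; apply: val_inj; rewrite /= -kd addn0.
  have kn : (k.+1 < n)%N by have := ltn_ord j; lia.
  by apply: (down (Ordinal kn)) => //; apply: IH => /=; lia.
apply: proper_card; rewrite properE; apply/andP; split; apply/fintype.subsetP.
  by move=> k; rewrite inE => kj; apply: (sub (j - k)%N); lia.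
by move=> /(_ j jM); rewrite inE ltnn.
Qed.

(* [(M, c)] encodes the residues [c], [c + 1], [c], ... on the successive
   elements of [M]. *)
Definition exchange (m : nat) : rel ({set 'I_n} * bool) := fun u v =>
  [&& #|u.1| == m, #|v.1| == m, #|u.1 :|: v.1| == m.+1 &
    [forall j in u.1 :&: v.1, odd (u.2 + index_in u.1 j) == odd (v.2 + index_in v.1 j)]].

Lemma exchange_sym m : symmetric (exchange m).
Proof.
move=> u v; rewrite /exchange andbCA finset.setUC; congr [&& _, _, _ & _].
by apply: eq_forallb => j; rewrite finset.setIC eq_sym.
Qed.

(** No index lies between [k] and [j], so the other elements keep their rank in the set and the same
    [c] serves. *)
Lemma exchange_slide M c j k : j \in M -> k.+1 = j :> nat -> k \notin M ->
  exchange #|M| (M, c) (k |: M :\ j, c).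
Proof.
move=> jM kj kM; have kMj : k \notin M :\ j by rewrite inE (negbTE kM) andbF.
have nkj : j != k by apply: contraNneq kM => <-.
apply/and4P; split=> //=.
- by rewrite cardsU1 kMj (cardsD1 j M) jM.
- have -> : M :|: (k |: M :\ j) = k |: M.
    apply/finset.setP => i; rewrite !inE.
    by case: (eqVneq i j) => [->|]; rewrite ?jM ?orbT//= orbCA orbb.
  by rewrite cardsU1 kM.
apply/forall_inP => i; rewrite !inE => /andP[iM].
move=> /orP[/eqP ik|/andP[ij _]]; first by rewrite -ik iM in kM.
have ik : i != k by apply: contraNneq kM => <-.
rewrite /index_in (big_setD1 j jM) big_setU1//= (_ : (j < i)%N = (k < i)%N)//.
by move: ij ik; rewrite -!(inj_eq val_inj) /=; lia.
Qed.

(** Each slide lowers the sum of the elements; a set without possible slide is closed downwards. *)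
Lemma connect_initial M c : connect (exchange #|M|) (M, c) (initial #|M|, c).
Proof.
have [s] := ubnP (\sum_(j in M) j)%N; elim: s M => // s IH M; rewrite ltnS => Ms.
have [[j k] /= /and3P[jM /eqP kj kM]|none] := pickP
    (fun jk : 'I_n * 'I_n => [&& jk.1 \in M, jk.2.+1 == jk.1 & jk.2 \notin M]).
  have e := exchange_slide c jM kj kM; apply: connect_trans (connect1 e) _.
  have /and4P[_ /eqP cM _ _] := e; rewrite -cM; apply: IH.
  apply: leq_trans Ms; rewrite big_setU1 ?inE ?(negbTE kM) ?andbF//=.
  by rewrite (big_setD1 j jM) /= ltn_add2r -kj.
rewrite -downclosed_initial// => j k jM kj; apply: contraT => kM.
by have := none (j, k); rewrite /= jM kj eqxx kM.
Qed.

(** In the shifted segment, without 0, each common element has its rank lowered by one, which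
    passing from [c] to [~~ c] compensates. Sliding back then preserves [~~ c]. *)
Lemma connect_flip (m : nat) c : (0 < m)%N -> (m < n)%N ->
  connect (exchange m) (initial m, c) (initial m, ~~ c).
Proof.
move=> m0 mn; have n0 : (0 < n)%N by lia.
pose o : 'I_n := Ordinal n0; pose M := initial m.+1 :\ o.
have oI : o \in initial m.+1 by rewrite inE.
have cM : #|M| = m.
  by have := card_initial mn; rewrite (cardsD1 o) oI add1n => -[].
have flip : exchange m (initial m, c) (M, ~~ c).
  apply/and4P; split=> /=.
  - by rewrite card_initial// ltnW.
  - by rewrite cM.
  - have -> : initial m :|: M = initial m.+1.
      apply/finset.setP => j; rewrite !inE -(inj_eq val_inj) /= ltnS; lia.
    by rewrite card_initial.
  apply/forall_inP => j; rewrite !inE => /andP[jm /andP[jo _]].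
  have j0 : (0 < j)%N by move: jo; rewrite -(inj_eq val_inj) /= lt0n.
  rewrite /index_in (sum_initial (ltnW jm) (ltnW mn)).
  have := sum_initial (leqW (ltnW jm)) mn; rewrite (big_setD1 o oI) /= j0 -/M.
  by move: (\sum_(_ in M) _)%N => s <-; rewrite !oddD; case: c; case: (odd s).
rewrite -cM in flip *; apply: connect_trans (connect1 flip) _.
exact: connect_initial.
Qed.
End ExchangeGraph.

Lemma connect_codim1_chain (R : realType) (G : metric_graph R) (F : set (set (Pic G)))
    (I : finType) (T : I -> set (Pic G)) (e : rel I) :
  (forall u v, e u v -> [/\ maximal_in F (T v), has_codim1 (T u `&` T v) (T u)
     & has_codim1 (T u `&` T v) (T v)]) ->
  forall u v, maximal_in F (T u) -> connect e u v -> codim1_chain F (T u) (T v).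
Proof.
move=> he u v mu /connectP[p /(pathP u) ep ->].
exists (size p), (fun i => T (nth u (u :: p) i)); split=> //.
- by rewrite (last_nth u).
- by move=> [//|i] ip; have [] := he _ _ (ep i ip).
- by move=> i ip; have [] := he _ _ (ep i ip).
Qed.

(** * Connectedness in codimension 1 *)

Section Connectedness.
Variables (R : realType) (n : nat) (L : loop_of_loops R n).
Hypothesis n0 : (0 < n)%N.
Hypothesis hU : two_uniform L.
Local Notation Y := (lol_graph (antipodal_cover L)).

(** Having equal dimensions, the tori cannot strictly contain one another, so all of them are
    maximal and paths in [e] give the chains. *)
Lemma tori_connected (eps : bool) (m : nat) (I : finType) (A : pred I) (e : rel I)
    (M : I -> {set 'I_n}) (b : I -> 'I_n -> R) (V : set (Pic Y)) :
  (forall u, A u -> #|M u| = m) ->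
  (forall u v, e u v -> [/\ A u, A v, #|M u :|: M v| = m.+1 &
     forall j, j \in M u :&: M v -> exists q : int, b u j = b v j + 2 * q%:~R]) ->
  (forall u v, A u -> A v -> connect e u v) ->
  V = \bigcup_(u in [set u | A u]) torus (L := L) eps (M u) (b u) ->
  connected_in_codim1 V.
Proof.
move=> cM he conn eV; pose T u := torus (L := L) eps (M u) (b u).
have maxT u : A u -> maximal_in (T @` [set u | A u]) (T u).
  move=> Au; split=> [|_ [v Av <-] sub]; first by exists u.
  by apply: (torus_subset n0 hU _ sub); rewrite !cM.
exists (T @` [set u | A u]); split.
- by apply: finite_image; exact: finite_finset.
- by move=> _ [u _ <-]; exists #|~: M u|; exact: torus_subtorus.
- by rewrite bigcup_image.
move=> _ _ [[u0 Au <-] _] [[v0 Av <-] _].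
apply: (connect_codim1_chain (e := e)) (maxT u0 Au) (conn u0 v0 Au Av).
move=> {Au Av} u v /he[Au Av cUV agree]; split; first exact: maxT.
  by apply: torus_codim1 => //; rewrite cUV cM.
rewrite classical_sets.setIC; apply: torus_codim1 => //; last by rewrite finset.setUC cUV cM.
move=> j; rewrite finset.setIC => /agree[q ->]; exists (- q); rewrite intrN; ring.
Qed.

Lemma prym_brill_noether_ge2 (r : nat) : (2 <= r)%N ->
  prym_brill_noether L r = \bigcup_(u in [set u : {set 'I_n} * bool | #|u.1| == r.+1])
    torus (odd r.+1) u.1 (fun j => (u.2 + index_in u.1 j)%N%:R).
Proof.
move=> r2; apply/seteqP; split=> [_ [D [nD rD par] <-]|c [[M c'] /= /eqP cM [D [x hx hM] <-]]].
  have [eps [x hx]] := (normP n0 hU D).1 nD.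
  have [e [M [c [cM hM]]]] := (rank_locus n0 hU hx r2).1 (conj rD par).
  exists (M, c); first exact/eqP.
  by exists D => //; exists x; [rewrite -e|exact: hM].
have [rD par] := (rank_locus n0 hU hx r2).2 (conj erefl (ex_intro _ M (ex_intro _ c' (conj cM hM)))).
by exists D => //; split=> //; apply/(normP n0 hU); exists (odd r.+1), x.
Qed.

Lemma prym_brill_noether1 : prym_brill_noether L 1 =
  \bigcup_(j in [set j : 'I_n | true]) torus false [set j]%SET (fun=> 0).
Proof.
apply/seteqP; split=> [_ [D [nD rD par] <-]|c [j _ [D [x hx hM] <-]]].
  have [eps [x hx]] := (normP n0 hU D).1 nD.
  have [e [j [q eq]]] := (rank1_locus n0 hU hx).1 (conj rD par).
  exists j => //; exists D => //; exists x; first by rewrite -e.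
  by move=> k; rewrite inE => /eqP ->; exists q; rewrite add0r.
have [|q eq] := hM j; first by rewrite inE.
have [rD par] := (rank1_locus n0 hU hx).2 (conj erefl (ex_intro _ j (ex_intro _ q (etrans eq (add0r _))))).
by exists D => //; split=> //; apply/(normP n0 hU); exists false, x.
Qed.

Lemma prym_brill_noether_connected (r : nat) : (1 <= r)%N -> (r + 1 < n)%N ->
  connected_in_codim1 (prym_brill_noether L r).
Proof.
move=> r1 rn; have [r2|r1'] := leqP 2 r.
  apply: (tori_connected (m := r.+1) (e := exchange r.+1) _ _ _ (prym_brill_noether_ge2 r2)).
  - by move=> u /eqP.
  - move=> u v /and4P[uA vA /eqP uv /forall_inP agree]; split=> // j /agree.
    move: (u.2 + _)%N (v.2 + _)%N => a a' /eqP aa'; exists (a./2%:Z - a'./2%:Z).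
    by rewrite (natr_parity R a) (natr_parity R a') aa' intrB -!pmulrn; ring.
  move=> [M c] [M' c'] /= /eqP cM /eqP cM'.
  have conn (N : {set 'I_n}) (d : bool) : #|N| = r.+1 -> connect (exchange r.+1) (N, d) (initial n r.+1, d).
    by move=> cN; have := connect_initial N d; rewrite cN.
  apply: connect_trans (conn _ c cM) _.
  rewrite (sym_connect_sym (@exchange_sym n r.+1)); apply: connect_trans (conn _ c' cM') _.
  have [->|cc'] := eqVneq c' c; first exact: connect0.
  (* The room needed to shift an initial segment of [r.+1] elements is the hypothesis
     [r + 1 < n]. *)
  by have -> : c = ~~ c' by [case: c c' cc' => [] []]; apply: connect_flip => //; lia.
have -> : r = 1%N by lia.
(* For [r = 1] any two distinct tori meet in codimension 1, so the graph is complete. *)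
apply: (tori_connected (A := xpredT) (m := 1%N) (e := fun u v => u != v) _ _ _ prym_brill_noether1).
- by move=> u _; rewrite cards1.
- by move=> u v uv; split=> //; [rewrite cards2 uv|move=> j _; exists 0; ring].
move=> u v _ _; have [->|uv] := eqVneq u v; first exact: connect0.
exact: connect1.
Qed.

End Connectedness.

Theorem proposition6p10 (R : realType) (r g : nat) (Gamma : loop_of_loops R (g - 1)%N)
    (hr : (1 <= r)%N) (hg : (2 <= g)%N) (hGamma : two_uniform Gamma)
    (hrg : (r + 1 < g - 1)%N) :
  connected_in_codim1 (prym_brill_noether Gamma r).
Proof. by apply: prym_brill_noether_connected => //; lia. Qed.
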